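(* Fix $\theta\in(-\frac{\pi}{2},\frac{\pi}{2})$. The semigroup $\{T_t^2\}_{t\ge0}$ defined below is a semigroup of normal operators in $L^2(\gamma)$, and consequently its infinitesimal generator $\mathcal{A}_2$ is a normal operator in $L^2(\gamma)$.
   Context: Identify $\mathbb{R}^2$ with $\mathbb{C}$ via $(y_1,y_2)\mapsto y_1+\mathrm{i}y_2$. Let $d\gamma(y)=\frac{1}{2\pi}e^{-(y_1^2+y_2^2)/2}\,dy_1\,dy_2$ and $L^p(\gamma)$ the corresponding complex $L^p$ spaces. For $\varphi\in C_b(\mathbb{R}^2)$ (bounded continuous complex functions), $t\ge0$, $x\in\mathbb{C}$, let $$P_t\varphi(x)=\int_{\mathbb{C}}\varphi\big(e^{-(\cos\theta+\mathrm{i}\sin\theta)t}x+\sqrt{1-e^{-2t\cos\theta}}\,y\big)\,d\gamma(y).$$ For each $p\ge1$, $\|P_t\varphi\|_{L^p(\gamma)}\le\|\varphi\|_{L^p(\gamma)}$, and $\{P_t\}$ extends uniquely (by closure) to a strongly continuous contraction semigroup $\{T_t^p\}_{t\ge0}$ on $L^p(\gamma)$; $\mathcal{A}_p$ denotes its infinitesimal generator. An (unbounded, densely defined, closed) operator $N$ is normal if $D(N)=D(N^* )$ and $\|Nf\|=\|N^*f\|$ for $f\in D(N)$ (equivalently $NN^*=N^*N$). *)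

(* Defs.v *)
From HB Require Import structures.
From mathcomp Require Import all_boot all_order all_algebra.
From mathcomp Require Import all_classical all_reals all_analysis.
From mathcomp Require Import complex.

Set Implicit Arguments.
Unset Strict Implicit.
Unset Printing Implicit Defensive.

Import Order.TTheory GRing.Theory Num.Theory.
Import numFieldNormedType.Exports.

Local Open Scope classical_set_scope.
Local Open Scope ring_scope.
Local Open Scope complex_scope.

Section Defs.
Variable R : realType.

Definition pt := (R * R)%type.
Definition fn := pt -> R[i].

Definition gdens (y : pt) : R :=
  expR (- (y.1 ^+ 2 + y.2 ^+ 2) / 2) / (2 * pi).

Definition gint (f : pt -> R) : \bar R :=
  (\int[(@lebesgue_measure R \x @lebesgue_measure R)%E]_y
      (f y * gdens y)%:E)%E.

Definition cint (h : fn) : R[i] :=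
  (fine (gint (fun y => complex.Re (h y)))) +i* (fine (gint (fun y => complex.Im (h y)))).

Definition sqmod (z : R[i]) : R := complex.Re z ^+ 2 + complex.Im z ^+ 2.

(* membership in L^2(gamma) (of a representative) *)
Definition L2 (f : fn) : Prop :=
  measurable_fun setT (fun y => complex.Re (f y)) /\
  measurable_fun setT (fun y => complex.Im (f y)) /\
  (gint (fun y => sqmod (f y)) < +oo)%E.

Definition norm2 (f : fn) : R := Num.sqrt (fine (gint (fun y => sqmod (f y)))).

Definition inner (f g : fn) : R[i] := cint (fun y => f y * conjc (g y)).

Definition fsub (f g : fn) : fn := fun y => f y - g y.
Definition fscale (c : R[i]) (f : fn) : fn := fun y => c * f y.

Definition Cb (phi : fn) : Prop :=
  continuous (fun y : pt => complex.Re (phi y)) /\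
  continuous (fun y : pt => complex.Im (phi y)) /\
  exists M : R, forall y, sqmod (phi y) <= M.

Definition toC (y : pt) : R[i] := y.1 +i* y.2.
Definition ofC (z : R[i]) : pt := (complex.Re z, complex.Im z).

Definition cexp (z : R[i]) : R[i] :=
  (expR (complex.Re z) * cos (complex.Im z)) +i* (expR (complex.Re z) * sin (complex.Im z)).

Definition Pt (th t : R) (phi : fn) : fn := fun x =>
  cint (fun y => phi (ofC (cexp (- ((cos th +i* sin th) * (t +i* 0))) * toC x
                            + (Num.sqrt (1 - expR (- (2 * t * cos th))) +i* 0) * toC y))).

(* Operators in L^2(gamma) are represented by their graphs (relations
   between representatives). *)
Definition op := fn -> fn -> Prop.

(* T_t^2: closure in L^2(gamma) of P_t defined on C_b *)
Definition Tt (th t : R) : op := fun f g =>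
  L2 f /\ L2 g /\
  exists phi : nat -> fn, (forall n, Cb (phi n)) /\
    (fun n => norm2 (fsub (phi n) f)) @ \oo --> 0 /\
    (fun n => norm2 (fsub (Pt th t (phi n)) g)) @ \oo --> 0.

Definition gen (th : R) : op := fun f g =>
  L2 f /\ L2 g /\
  exists u : R -> fn, (forall t, 0 < t -> Tt th t f (u t)) /\
    (fun t => norm2 (fsub (fscale ((t^-1) +i* 0) (fsub (u t) f)) g)) @ 0^'+ --> 0.

Definition dom (A : op) (f : fn) : Prop := exists g, A f g.

(* A is a (single-valued, modulo gamma-null functions) operator in L^2(gamma) *)
Definition is_op (A : op) : Prop :=
  (forall f g, A f g -> L2 f /\ L2 g) /\
  (forall f g1 g2, A f g1 -> A f g2 -> norm2 (fsub g1 g2) = 0).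

Definition densely_defined (A : op) : Prop :=
  forall f, L2 f -> forall e : R, 0 < e -> exists d, dom A d /\ norm2 (fsub f d) < e.

Definition closed_op (A : op) : Prop :=
  forall (fs gs : nat -> fn) f g, (forall n, A (fs n) (gs n)) -> L2 f -> L2 g ->
    (fun n => norm2 (fsub (fs n) f)) @ \oo --> 0 ->
    (fun n => norm2 (fsub (gs n) g)) @ \oo --> 0 -> A f g.

Definition adjoint (A : op) : op := fun g h =>
  L2 g /\ L2 h /\ forall f k, A f k -> inner k g = inner f h.

Definition normal_op (N : op) : Prop :=
  is_op N /\ densely_defined N /\ closed_op N /\
  (forall f, dom N f <-> dom (adjoint N) f) /\
  (forall f g h, N f g -> adjoint N f h -> norm2 g = norm2 h).

End Defs.

(* Main.v *)
(* Identify R^2 with C. For a in C and s real with |a|^2 + s^2 = 1 the Mehler operator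
   M_a u (x) = E u (a x + s Y) is a contraction of L^2(gamma), because
   (x, y) |-> (a x + s y, s x - conj a y) preserves gamma (x) gamma; the same map shows that
   M_a^* = M_(conj a), and the stability of Gaussians gives M_a M_b = M_(a b). Hence the
   T_t = M_(a(t)), with a(t) = exp (- e^(i theta) t), commute with their adjoints S_t, which
   are the same operators for - theta.
   For generators A of T and B of S: a telescoping sum gives A^* = B once D(A) is dense, and
   D(A) contains the averages of t |-> T_t f for f bounded continuous. By normality,
   (T_t f - f) / t - (T_r f - f) / r and its analogue for S have the same norm, so one
   difference quotient is Cauchy iff the other is: D(A) = D(B) and |A f| = |B f|.
   All of this is done in the real space L^2(gamma), and the complex statement is obtained
   by splitting functions into real and imaginary parts. *)
Require Import Defs.
From HB Require Import structures.
From mathcomp Require Import all_boot all_order all_algebra.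
From mathcomp Require Import all_classical all_reals all_analysis.
From mathcomp Require Import complex.
From mathcomp Require Import measurable_realfun ring lra.
Import Order.TTheory GRing.Theory Num.Theory.
Local Open Scope ring_scope.
Set Implicit Arguments.
Unset Strict Implicit.
Unset Printing Implicit Defensive.
Import numFieldNormedType.Exports.
Local Open Scope classical_set_scope.

(** Vectors are square-integrable functions rather than classes, so the pairing is only
    semi-definite and operator identities are identities modulo [ipeq]. No vector-valued integral is
    used. The formula T_t x - x = int_0^t T_s A x ds becomes a finite sum tested against a fixed
    vector, and averages of T_s f are integrals of real numbers at each point, which is where
    boundedness and continuity of f enter. Closedness needs no separate study of limits of
    semigroups: each graph is shown to be the full adjoint of the other one, and adjoints are
    closed. These facts are packed in [adjoint_pair], of which both the fixed-time operators and the
    generators are instances, so normality is derived once. Composition rules for Mehler operators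
    hold at every point for bounded functions, and reach all of L^2 through density and
    contractivity. *)

(** * Adjoint semigroups and their generators in a real semi-inner product space *)

Section SemiInner.
Variables (R : realType) (V : lmodType R) (ip : V -> V -> R).

(** Only semi-definite, because a nonzero function that vanishes almost everywhere has norm zero. *)
Record semi_inner : Prop := SemiInner {
  ipC : forall x y, ip x y = ip y x;
  ipDl : forall x y z, ip (x + y) z = ip x z + ip y z;
  ipZl : forall a x z, ip (a *: x) z = a * ip x z;
  ip_ge0 : forall x, 0 <= ip x x }.

Hypothesis ipP : semi_inner.
Let ipC := ipC ipP.
Let ipDl := ipDl ipP.
Let ipZl := ipZl ipP.
Let ip_ge0 := ip_ge0 ipP.

Definition hnorm x : R := Num.sqrt (ip x x).
Local Notation nm := hnorm.

Lemma ipDr x y z : ip z (x + y) = ip z x + ip z y.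
Proof. by rewrite ipC ipDl !(ipC z). Qed.
Lemma ipZr a x z : ip z (a *: x) = a * ip z x.
Proof. by rewrite ipC ipZl (ipC z). Qed.
Lemma ipNl x z : ip (- x) z = - ip x z.
Proof. by rewrite -scaleN1r ipZl mulN1r. Qed.
Lemma ipNr x z : ip z (- x) = - ip z x.
Proof. by rewrite ipC ipNl ipC. Qed.
Lemma ipBl x y z : ip (x - y) z = ip x z - ip y z.
Proof. by rewrite ipDl ipNl. Qed.
Lemma ipBr x y z : ip z (x - y) = ip z x - ip z y.
Proof. by rewrite ipDr ipNr. Qed.

Definition ipE := (ipDl, ipDr, ipZl, ipZr, ipNl, ipNr).

Lemma nm_ge0 x : 0 <= nm x. Proof. exact: sqrtr_ge0. Qed.
Lemma nm_sqr x : nm x ^+ 2 = ip x x. Proof. by rewrite sqr_sqrtr. Qed.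

Lemma cauchy_schwarz x y : `|ip x y| <= nm x * nm y.
Proof.
have h a b : 0 <= a ^+ 2 * ip x x + 2 * (a * b) * ip x y + b ^+ 2 * ip y y.
  have := ip_ge0 (a *: x + b *: y); rewrite !ipE (ipC y x); congr (_ <= _).
  by ring.
rewrite -ler_sqr ?nnegrE ?mulr_ge0 ?nm_ge0 // exprMn !nm_sqr real_normK ?num_real //.
have [y0|y0] := eqVneq (ip y y) 0.
  have [->|c0] := eqVneq (ip x y) 0; first by rewrite y0 expr0n /= mulr0.
  (* With [ip y y = 0] the form is affine in its second coefficient; this value makes it equal to
     [- ip x x - 2], which is negative. *)
  have := h 1 (- (ip x x + 1) / ip x y); rewrite y0.
  have -> : 1 ^+ 2 * ip x x + 2 * (1 * (- (ip x x + 1) / ip x y)) * ip x y +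
    (- (ip x x + 1) / ip x y) ^+ 2 * 0 = - ip x x - 2 by field.
  by have := ip_ge0 x; lra.
have yp : 0 < ip y y by rewrite lt_def y0 ip_ge0.
(* Up to a factor, these coefficients produce the component of x orthogonal to y. *)
have := h (ip y y) (- ip x y).
have -> : (ip y y) ^+ 2 * ip x x + 2 * (ip y y * - ip x y) * ip x y
  + (- ip x y) ^+ 2 * ip y y = ip y y * (ip x x * ip y y - ip x y ^+ 2) by ring.
by rewrite pmulr_rge0 // subr_ge0.
Qed.

Lemma nmZ a x : nm (a *: x) = `|a| * nm x.
Proof. by rewrite /hnorm !ipE mulrA -expr2 sqrtrM ?sqr_ge0 // sqrtr_sqr. Qed.
Lemma nmN x : nm (- x) = nm x.
Proof. by rewrite /hnorm !ipE opprK. Qed.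
Lemma nmBC x y : nm (x - y) = nm (y - x).
Proof. by rewrite -nmN opprB. Qed.
Lemma nmD x y : nm (x + y) <= nm x + nm y.
Proof.
rewrite -ler_sqr ?nnegrE ?addr_ge0 ?nm_ge0 // nm_sqr !ipE (ipC y x) sqrrD !nm_sqr.
have := le_trans (ler_norm _) (cauchy_schwarz x y); lra.
Qed.
Lemma nm_tri z x y : nm (x - y) <= nm (x - z) + nm (z - y).
Proof. by rewrite -[x - y](subrKA z) nmD. Qed.
Lemma nm_le_tri x y : nm x <= nm y + nm (x - y).
Proof. by rewrite -{1}[x](subrK y) addrC nmD. Qed.
Lemma nm0 : nm 0 = 0.
Proof. by rewrite -(scale0r 0) nmZ normr0 mul0r. Qed.

(** Equality modulo null vectors. Testing against all z makes it a rewrite rule inside [ip]; [simP]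
    identifies it with distance zero. *)
Definition ipeq x y := forall z, ip x z = ip y z.
Local Notation sim := ipeq.

Lemma simP x y : nm (x - y) = 0 <-> sim x y.
Proof.
split=> [h z|h].
  have := cauchy_schwarz (x - y) z; rewrite h mul0r normr_le0 ipBl.
  by rewrite subr_eq0 => /eqP.
by rewrite /hnorm ipBl h subrr sqrtr0.
Qed.

Lemma sim_refl x : sim x x. Proof. by []. Qed.
Lemma sim_sym x y : sim x y -> sim y x. Proof. by move=> h z; rewrite h. Qed.
Lemma sim_trans y x z : sim x y -> sim y z -> sim x z.
Proof. by move=> h k w; rewrite h k. Qed.
Lemma sim_nm x y : sim x y -> nm x = nm y.
Proof. by move=> h; rewrite /hnorm h (ipC y x) h. Qed.
Lemma simB x x' y y' : sim x x' -> sim y y' -> sim (x - y) (x' - y').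
Proof. by move=> h k z; rewrite !ipE h k. Qed.
Lemma simZ a x x' : sim x x' -> sim (a *: x) (a *: x').
Proof. by move=> h z; rewrite !ipE h. Qed.
Lemma sim_ipr x x' y : sim x x' -> ip y x = ip y x'.
Proof. by move=> h; rewrite !(ipC y). Qed.

(** A relation, because the limit of the difference quotients is determined only modulo [ipeq]. *)
Definition generator (T : R -> V -> V) (x y : V) : Prop :=
  forall e : R, 0 < e -> exists2 d : R, 0 < d & forall t, 0 < t < d ->
    nm (t^-1 *: (T t x - x) - y) < e.

Definition hdense (D : V -> Prop) : Prop :=
  forall x (e : R), 0 < e -> exists2 y, D y & nm (x - y) < e.

Lemma le_eps (a b : R) : (forall e, 0 < e -> a <= b + e) -> a <= b.
Proof. by move=> h; apply/ler_addgt0Pr. Qed.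

Section Pair.
Variables T S : R -> V -> V.
Hypothesis adj : forall t x y, 0 <= t -> ip (T t x) y = ip x (S t y).

Lemma adjointC t x y : 0 <= t -> ip (S t x) y = ip x (T t y).
Proof. by move=> t0; rewrite ipC -adj // ipC. Qed.

(** Linearity is not assumed of T: the existence of an adjoint forces it modulo null vectors, since
    <T_t x, z> = <x, S_t z> is linear in x. *)
Lemma sim_opB t x y : 0 <= t -> sim (T t (x - y)) (T t x - T t y).
Proof. by move=> t0 z; rewrite !(adj, ipE). Qed.
Lemma sim_opZ t a x : 0 <= t -> sim (T t (a *: x)) (a *: T t x).
Proof. by move=> t0 z; rewrite !(adj, ipE). Qed.

Hypothesis contr : forall t x, 0 <= t -> nm (T t x) <= nm x.

Lemma contrB t x y : 0 <= t -> nm (T t x - T t y) <= nm (x - y).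
Proof. by move=> t0; rewrite -(sim_nm (sim_opB x y t0)) contr. Qed.

Hypothesis semi : forall s t x, 0 <= s -> 0 <= t -> sim (T s (T t x)) (T (s + t) x).

(** [T s] commutes with the difference quotients of T and, being a contraction, carries their limit
    along. *)
Lemma generator_op s x y : 0 <= s -> generator T x y -> generator T (T s x) (T s y).
Proof.
move=> s0 h e e0; have [d d0 hd] := h e e0; exists d => // t /[dup] tt /hd.
apply: le_lt_trans; have t0 : 0 <= t by case/andP: tt => /ltW.
rewrite (_ : nm _ = nm (T s (t^-1 *: (T t x - x)) - T s y)); first exact: contrB.
apply: sim_nm; apply: simB => //; apply: sim_sym.
apply: sim_trans (sim_opZ _ _ s0) _; apply: simZ.
apply: sim_trans (sim_opB _ _ s0) _; apply: simB => //.
apply: sim_trans (semi _ s0 t0) _; rewrite addrC; exact/sim_sym/semi.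
Qed.

Lemma generator_unique x y z : generator T x y -> generator T x z -> sim y z.
Proof.
move=> hy hz; apply/simP/eqP; rewrite eq_le nm_ge0 andbT; apply: le_eps => e e0.
have e2 : 0 < e / 2 by lra.
have [d d0 hd] := hy _ e2; have [d' d'0 hd'] := hz _ e2.
pose t := Num.min d d' / 2.
have m0 : 0 < Num.min d d' by rewrite lt_min d0.
have tm : t < Num.min d d' by rewrite /t; lra.
have t0 : 0 < t by rewrite /t; lra.
move: tm; rewrite lt_min => /andP[td td'].
have := hd t; have := hd' t; rewrite t0 td td' => /(_ isT) a /(_ isT) b.
have := nm_tri (t^-1 *: (T t x - x)) y z.
rewrite (nmBC y (_ *: _)); lra.
Qed.

Lemma generator_scale c x y : generator T x y -> generator T (c *: x) (c *: y).
Proof.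
move=> g e e0; have c1 : 0 < `|c| + 1 by rewrite ltr_wpDl.
have [d d0 hd] := g _ (divr_gt0 e0 c1); exists d => // t td.
have t0 : 0 <= t by case/andP: td => /ltW.
rewrite (_ : nm _ = nm (c *: (t^-1 *: (T t x - x) - y))); last first.
  have -> : c *: (t^-1 *: (T t x - x) - y) = t^-1 *: (c *: T t x - c *: x) - c *: y.
    by rewrite [LHS]scalerBr scalerA [c * _]mulrC -scalerA [c *: (_ - _)]scalerBr.
  apply: sim_nm; apply: simB => //; apply: simZ; apply: simB => //.
  exact: sim_opZ.
rewrite nmZ; apply: (@le_lt_trans _ _ (`|c| * (e / (`|c| + 1)))).
  by rewrite ler_wpM2l // ltW // hd.
by rewrite mulrA ltr_pdivrMr // mulrC ltr_pM2l // ltrDl.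
Qed.

(** The limit, as t tends to 0, of <(T_t x - x) / t, x'> = <x, (S_t x' - x') / t>. *)
Lemma generator_adjoint x y x' y' : generator T x y -> generator S x' y' ->
  ip y x' = ip x y'.
Proof.
move=> h h'; apply/eqP; rewrite -subr_eq0 -normr_le0; apply: le_eps => e e0.
(* The two approximation errors cost at most [e / c] times [nm x'] and [e / c] times [nm x]; the
   extra 1 keeps c positive. *)
pose c := nm x' + nm x + 1.
have c0 : 0 < c by rewrite /c; have := nm_ge0 x'; have := nm_ge0 x; lra.
have e2 : 0 < e / c by rewrite divr_gt0.
have [d d0 hd] := h _ e2; have [d' d'0 hd'] := h' _ e2.
pose t := Num.min d d' / 2.
have m0 : 0 < Num.min d d' by rewrite lt_min d0.
have tm : t < Num.min d d' by rewrite /t; lra.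
have t0 : 0 < t by rewrite /t; lra.
move: tm; rewrite lt_min => /andP[td td'].
have := hd t; have := hd' t; rewrite t0 td td' => /(_ isT) a /(_ isT) b.
set u := t^-1 *: (T t x - x) in b; set v := t^-1 *: (S t x' - x') in a.
have uv : ip u x' = ip x v by rewrite /u /v !ipE adj // ltW.
have -> : ip y x' - ip x y' = ip x (v - y') - ip (u - y) x'.
  by rewrite ipBr ipBl uv; ring.
have n1 := cauchy_schwarz (u - y) x'; have n2 := cauchy_schwarz x (v - y').
have := ler_normB (ip x (v - y')) (ip (u - y) x').
have n3 : nm (u - y) * nm x' <= e / c * nm x' by rewrite ler_wpM2r ?nm_ge0 // ltW.
have n4 : nm x * nm (v - y') <= nm x * (e / c) by rewrite ler_wpM2l ?nm_ge0 // ltW.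
have : e = e / c * nm x' + nm x * (e / c) + e / c by rewrite /c in c0 *; field; lra.
lra.
Qed.

End Pair.

Definition sg_adjoint (T S : R -> V -> V) :=
  forall t x y, 0 <= t -> ip (T t x) y = ip x (S t y).
Definition sg_contraction (T : R -> V -> V) := forall t x, 0 <= t -> nm (T t x) <= nm x.
Definition sg_semigroup (T : R -> V -> V) :=
  forall s t x, 0 <= s -> 0 <= t -> sim (T s (T t x)) (T (s + t) x).
Definition sg_continuous (T : R -> V -> V) :=
  forall x (e : R), 0 < e -> exists2 d : R, 0 < d & forall t, 0 <= t < d ->
    nm (T t x - x) < e.
Definition sg_commute (T S : R -> V -> V) :=
  forall s t x, 0 <= s -> 0 <= t -> sim (T s (S t x)) (S t (T s x)).

Section AdjointGenerator.
Variables T S : R -> V -> V.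
Hypothesis adj : sg_adjoint T S.
Hypothesis contr : sg_contraction T.
Hypothesis semi : sg_semigroup T.
Hypothesis scont : sg_continuous S.
Hypothesis dens : hdense (fun x => exists y, generator T x y).
Hypothesis T0 : forall x, sim (T 0 x) x.

(* Splitting [0, t] into n equal steps d = t / n gives
   T_t x - x = \sum_k d T_{kd} (d^-1 (T_d x - x)), whose pairing with g is close
   to \sum_k d <x, S_{kd} h>. *)
Lemma generator_telescope x y g h t e :
  (forall x y, generator T x y -> ip y g = ip x h) ->
  generator T x y -> 0 < t -> 0 <= e ->
  (forall s, 0 <= s <= t -> nm (S s h - h) <= e) ->
  `|ip x (S t g - g - t *: h)| <= t * (e * nm x).
Proof.
move=> gh xy t0 e0 he; apply: le_eps => eta eta0.
(* An error [eta / c] in the difference quotient, paired with g and summed over the total time t,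
   stays below eta. *)
pose c := t * (nm g + 1).
have c0 : 0 < c by rewrite /c mulr_gt0 //; have := nm_ge0 g; lra.
have [d d0 hd] := xy (eta / c) (divr_gt0 eta0 c0).
pose n := (Num.truncn (t / d)).+1.
have nd : t / d < n%:R by rewrite /n truncnS_gt.
have n0 : 0 < n%:R :> R by rewrite ltr0n.
pose del := t / n%:R.
have del0 : 0 < del by rewrite divr_gt0.
have deld : del < d by rewrite /del ltr_pdivrMr // mulrC -ltr_pdivrMr.
have := hd del; rewrite del0 deld => /(_ isT) hdel.
have key k : (k <= n)%N ->
  `|ip (T (k%:R * del) x - x) g - k%:R * del * ip x h|
    <= k%:R * del * (e * nm x + eta / c * nm g).
  elim: k => [|k IH] kn.
    by rewrite mul0r !mul0r subr0 !ipE T0 subrr normr0.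
  have {}IH := IH (ltnW kn).
  have s0 : 0 <= k%:R * del by rewrite mulr_ge0 // ltW.
  have st : k%:R * del <= t.
    rewrite /del mulrA ler_pdivrMr // mulrC ler_pM2l // ler_nat; exact: ltnW.
  set s := k%:R * del in IH s0 st *.
  have -> : k.+1%:R * del = s + del by rewrite /s -natr1; ring.
  have E1 : ip (T (s + del) x) g = ip (T s x) g + del * ip (T s (del^-1 *: (T del x - x))) g.
    rewrite -(semi x s0 (ltW del0)) (sim_opZ adj _ _ s0) !ipE.
    rewrite (sim_opB adj _ _ s0) ipBl; field; lra.
  (* The hypothesis on g and h is applied at [T s x], which is still in the domain, with image
     [T s y]. *)
  have E2 : ip (T s y) g = ip x (S s h).
    by rewrite (gh _ _ (generator_op adj contr semi s0 xy)) adj.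
  have E3 : ip (T s (del^-1 *: (T del x - x))) g =
     ip (T s (del^-1 *: (T del x - x) - y)) g + ip x (S s h - h) + ip x h.
    by rewrite (sim_opB adj _ _ s0) ipBl ipBr E2; ring.
  have B1 : `|ip (T s (del^-1 *: (T del x - x) - y)) g| <= eta / c * nm g.
    apply: le_trans (cauchy_schwarz _ _) _; rewrite ler_wpM2r ?nm_ge0 //.
    exact: le_trans (contr _ s0) (ltW hdel).
  have B2 : `|ip x (S s h - h)| <= e * nm x.
    apply: le_trans (cauchy_schwarz _ _) _; rewrite mulrC ler_wpM2r ?nm_ge0 //.
    by apply: he; rewrite s0.
  have -> : ip (T (s + del) x - x) g - (s + del) * ip x h =
    (ip (T s x - x) g - s * ip x h) +
     del * (ip (T s (del^-1 *: (T del x - x) - y)) g + ip x (S s h - h)).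
    by rewrite !ipBl E1 E3; ring.
  apply: le_trans (ler_normD _ _) _; rewrite normrM (gtr0_norm del0).
  have := ler_normD (ip (T s (del^-1 *: (T del x - x) - y)) g) (ip x (S s h - h)).
  have : del * `|ip (T s (del^-1 *: (T del x - x) - y)) g + ip x (S s h - h)|
    <= del * (e * nm x + eta / c * nm g).
    rewrite ler_pM2l //; apply: le_trans (ler_normD _ _) _; lra.
  rewrite -/s mulrDl; lra.
have := key n (leqnn n).
have -> : n%:R * del = t by rewrite /del; field; lra.
have -> : ip (T t x - x) g - t * ip x h = ip x (S t g - g - t *: h).
  by rewrite !ipE adj ?ltW //; ring.
move=> /le_trans; apply; rewrite mulrDr lerD2l.
have : eta = t * (eta / c * nm g) + t * (eta / c) by rewrite /c in c0 *; field; have := nm_ge0 g; lra.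
have : 0 < t * (eta / c) by rewrite mulr_gt0 // divr_gt0.
lra.
Qed.

(** The telescoping estimate bounds w = S_t g - g - t h only against vectors of the domain of the
    generator of T. By density w itself is an admissible test vector up to eta, which turns the weak
    bound into [nm w <= t * (e / 2)]. *)
Lemma adjoint_generator g h :
  (forall x y, generator T x y -> ip y g = ip x h) -> generator S g h.
Proof.
move=> gh e e0; have [d d0 hd] := scont h (divr_gt0 e0 (ltr0n R 2)).
exists d => // t /andP[t0 td].
set w := S t g - g - t *: h.
have key x : (exists y, generator T x y) -> `|ip x w| <= t * (e / 2 * nm x).
  move=> [y xy]; apply: generator_telescope xy t0 _ _ => //; first lra.
  by move=> s /andP[s0 st]; apply/ltW/hd; rewrite s0 (le_lt_trans st).
have wle : nm w ^+ 2 <= t * (e / 2) * nm w.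
  apply: le_eps => eta eta0.
  pose c := t * (e / 2) + nm w + 1.
  have te : 0 < t * (e / 2) by rewrite mulr_gt0 //; lra.
  have c0 : 0 < c by rewrite /c; have := nm_ge0 w; lra.
  have [x Dx xw] := dens w (divr_gt0 eta0 c0).
  rewrite nm_sqr.
  have -> : ip w w = ip x w + ip (w - x) w by rewrite [ip (w - x) w]ipBl; ring.
  have h1 := le_trans (ler_norm _) (key _ Dx).
  have h2 := le_trans (ler_norm _) (cauchy_schwarz (w - x) w).
  have h3 : nm (w - x) * nm w <= eta / c * nm w by rewrite ler_wpM2r ?nm_ge0 // ltW.
  have h4 : nm x <= nm w + eta / c.
    by have := nm_le_tri x w; rewrite (nmBC x w); lra.
  have h5 : t * (e / 2) * nm x <= t * (e / 2) * (nm w + eta / c) by rewrite ler_pM2l.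
  have : eta = t * (e / 2) * (eta / c) + eta / c * nm w + eta / c.
    by rewrite /c in c0 *; field; lra.
  have : 0 < eta / c by rewrite divr_gt0.
  lra.
have wle' : nm w <= t * (e / 2).
  have [->|w0] := eqVneq (nm w) 0; first by rewrite mulr_ge0 //; lra.
  have wp : 0 < nm w by rewrite lt_def w0 nm_ge0.
  by move: wle; rewrite expr2 ler_pM2r.
have -> : t^-1 *: (S t g - g) - h = t^-1 *: w.
  by rewrite /w [in RHS]scalerBr (scalerA _ t) mulVf ?scale1r // gt_eqF.
rewrite nmZ gtr0_norm ?invr_gt0 // mulrC ltr_pdivrMr //.
by apply: le_lt_trans wle' _; rewrite mulrC ltr_pM2r //; lra.
Qed.

End AdjointGenerator.

Section NormalGenerator.
Variables T S : R -> V -> V.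
Hypothesis adj : sg_adjoint T S.
Hypothesis comm : sg_commute T S.
Hypothesis complete : forall u : nat -> V,
  (forall e : R, 0 < e -> exists N, forall m n, (N <= m)%N -> (N <= n)%N ->
     nm (u m - u n) < e) ->
  exists l, forall e : R, 0 < e -> exists N, forall n, (N <= n)%N -> nm (u n - l) < e.

(** <T_s x, T_t x> = <x, S_s T_t x> = <x, T_t S_s x> = <S_t x, S_s x>. *)
Lemma normal_ip s t x : 0 <= s -> 0 <= t -> ip (T s x) (T t x) = ip (S s x) (S t x).
Proof.
move=> s0 t0; rewrite adj // -(sim_ipr x (comm x t0 s0)) -(adjointC adj _ _ t0).
exact: ipC.
Qed.

Lemma normal_nm t x : 0 <= t -> nm (T t x) = nm (S t x).
Proof. by move=> t0; rewrite /hnorm normal_ip. Qed.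

(** After expansion the terms with two operators agree by [normal_ip]. Those with one operator agree
    because the space is real: <S_r x, x> = <x, T_r x> = <T_r x, x>. *)
Lemma normal_nm_comb (a b : R) s t x : 0 <= s -> 0 <= t ->
  nm (a *: (T s x - x) - b *: (T t x - x)) = nm (a *: (S s x - x) - b *: (S t x - x)).
Proof.
move=> s0 t0; congr Num.sqrt.
have Sx r : 0 <= r -> ip (S r x) x = ip (T r x) x.
  by move=> r0; rewrite adj // ipC.
have xS r : 0 <= r -> ip x (S r x) = ip (T r x) x by move=> r0; rewrite adj.
have xT r : 0 <= r -> ip x (T r x) = ip (T r x) x by move=> r0; rewrite ipC.
by rewrite !ipE !normal_ip // !Sx // !xS // !xT.
Qed.

Lemma normal_generator x y : generator T x y ->
  exists2 z, generator S x z & nm z = nm y.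
Proof.
move=> xy.
have cau e : 0 < e -> exists2 d : R, 0 < d & forall s t, 0 < s < d -> 0 < t < d ->
    nm (s^-1 *: (S s x - x) - t^-1 *: (S t x - x)) < e.
  move=> e0; have [d d0 hd] := xy _ (divr_gt0 e0 (ltr0n R 2)).
  exists d => // s t hs ht; rewrite -normal_nm_comb; last 2 first.
  - by case/andP: hs => /ltW.
  - by case/andP: ht => /ltW.
  have := nm_tri y (s^-1 *: (T s x - x)) (t^-1 *: (T t x - x)).
  by rewrite (nmBC y); have := hd _ hs; have := hd _ ht; lra.
(* Completeness concerns sequences, so z is found along t = 1 / (n + 1); the Cauchy estimate [cau]
   then extends the convergence to all small t. *)
pose r (n : nat) : R := n.+1%:R^-1.
have r0 n : 0 < r n by rewrite invr_gt0 ltr0n.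
have rlt (d : R) : 0 < d -> exists N, forall n, (N <= n)%N -> r n < d.
  move=> d0; exists (Num.truncn d^-1) => n Nn.
  rewrite /r -(invrK d) ltf_pV2 ?posrE ?ltr0n ?invr_gt0 //.
  by apply: lt_le_trans (truncnS_gt _) _; rewrite ler_nat ltnS.
have [|z hz] := complete (u := fun n => (r n)^-1 *: (S (r n) x - x)).
  move=> e /cau[d d0 hd]; have [N hN] := rlt d d0; exists N => m n mN nN.
  by apply: hd; rewrite r0 hN.
have gz : generator S x z.
  move=> e e0; have e2 : 0 < e / 2 by lra.
  have [d d0 hd] := cau _ e2; exists d => // t td.
  have [N hN] := rlt d d0; have [N' hN'] := hz _ e2.
  have n1 := hN _ (leq_maxl N N'); have n2 := hN' _ (leq_maxr N N').
  set n := maxn N N' in n1 n2.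
  have := nm_tri ((r n)^-1 *: (S (r n) x - x)) (t^-1 *: (S t x - x)) z.
  have : nm (t^-1 *: (S t x - x) - (r n)^-1 *: (S (r n) x - x)) < e / 2.
    by apply: hd; rewrite ?r0.
  lra.
exists z => //.
have nTS t : 0 < t -> nm (t^-1 *: (T t x - x)) = nm (t^-1 *: (S t x - x)).
  move=> t0; have := normal_nm_comb t^-1 0 x (ltW t0) (ltW t0).
  by rewrite !scale0r !subr0.
have close e : 0 < e -> exists2 t, nm (t^-1 *: (T t x - x) - y) < e
    /\ nm (t^-1 *: (S t x - x) - z) < e & 0 < t.
  move=> e0; have [d d0 hd] := xy _ e0; have [d' d'0 hd'] := gz _ e0.
  have m0 : 0 < Num.min d d' by rewrite lt_min d0.
  have tm : Num.min d d' / 2 < Num.min d d' by lra.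
  exists (Num.min d d' / 2); last lra.
  by move: tm; rewrite lt_min => /andP[td td']; split; [apply: hd|apply: hd'];
    rewrite ?td ?td' andbT; lra.
apply/eqP; rewrite eq_le; apply/andP; split; apply: le_eps => e e0;
  have [t [a b] t0] := close _ (divr_gt0 e0 (ltr0n R 2)).
  have := nm_le_tri z (t^-1 *: (S t x - x)); rewrite nmBC -nTS //.
  have := nm_le_tri (t^-1 *: (T t x - x)) y; lra.
have := nm_le_tri y (t^-1 *: (T t x - x)); rewrite nmBC nTS //.
have := nm_le_tri (t^-1 *: (S t x - x)) z; lra.
Qed.

End NormalGenerator.

End SemiInner.

(** * Integration against a measure given by a density *)

Section density.
Local Open Scope ereal_scope.
Context d (T : measurableType d) (R : realType).
Variables (mu nu : {measure set T -> \bar R}) (w : T -> R).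
Hypotheses (mw : measurable_fun setT w) (w0 : forall x, (0 <= w x)%R).
Hypothesis nuE : forall A, measurable A -> nu A = \int[mu]_(x in A) (w x)%:E.
Import HBNNSimple.

(** True for indicators by [nuE], for simple functions by linearity, and in general by monotone
    convergence on both sides along the same simple functions. *)
Lemma ge0_integral_density (f : T -> \bar R) : measurable_fun setT f ->
  (forall x, 0 <= f x) -> \int[nu]_x f x = \int[mu]_x (f x * (w x)%:E).
Proof.
move=> mf f0; pose g := nnsfun_approx measurableT mf.
have gf x : EFin \o (g ^~ x) @ \oo --> f x by apply: cvg_nnsfun_approx.
have mEw : measurable_fun setT (fun x => (w x)%:E) by exact/measurable_EFinP.
have mg n : measurable_fun setT (fun x => (g n x)%:E).
  by apply/measurable_EFinP/measurable_funP.
have -> : \int[nu]_x f x = limn (fun n => \int[nu]_x (g n x)%:E).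
  rewrite -monotone_convergence //.
  - by apply: eq_integral => x _; apply/esym/cvg_lim => //; exact: gf.
  - by move=> n x _; rewrite lee_fin.
  - by move=> x _ m n mn; rewrite lee_fin; exact/lefP/nd_nnsfun_approx.
have -> : \int[mu]_x (f x * (w x)%:E) = limn (fun n => \int[mu]_x ((g n x)%:E * (w x)%:E)).
  rewrite -monotone_convergence //.
  - apply: eq_integral => x _; apply/esym/cvg_lim => //.
    by apply: cvgeZr => //; exact: gf.
  - by move=> n; apply: emeasurable_funM.
  - by move=> n x _; rewrite mule_ge0 // lee_fin.
  - move=> x _ m n mn; rewrite lee_wpmul2r ?lee_fin //; exact/lefP/nd_nnsfun_approx.
congr (limn _); apply/funext => n.
have gE x : (g n x)%:E = \sum_(k \in range (g n)) (k%:E * (\1_(g n @^-1` [set k]) x)%:E).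
  by rewrite fsumEFin //= fimfunE.
have gwE x : (g n x)%:E * (w x)%:E =
    \sum_(k \in range (g n)) (k%:E * (\1_(g n @^-1` [set k]) x)%:E * (w x)%:E).
  by rewrite gE ge0_mule_fsuml // => k; rewrite nnfun_muleindic_ge0.
rewrite integral_nnsfun // sintegralE.
under [RHS]eq_integral do rewrite gwE.
rewrite ge0_integral_fsum //; last 2 first.
- by move=> r; apply: emeasurable_funM => //; exact/measurable_EFinP/measurableT_comp.
- move=> r x _; apply: mule_ge0; last by rewrite lee_fin.
  exact: nnfun_muleindic_ge0.
have -> : (g n : T -> R) \_ setT = g n.
  by apply/funext => x; rewrite patchE mem_set.
apply: eq_fsbigr => k; rewrite inE => -[/= t _ <-{k}].
under [RHS]eq_integral do rewrite -muleA.
rewrite ge0_integralZl_EFin //; last first.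
- by apply: emeasurable_funM => //; exact/measurable_EFinP.
- by move=> x _; rewrite mule_ge0 ?lee_fin.
congr (_ * _); rewrite nuE // integral_mkcond; apply: eq_integral => x _.
by rewrite /= patchE indicE; case: ifP => _; rewrite ?mul1e ?mul0e.
Qed.
End density.

(** * Invariance of planar Lebesgue measure under rotations *)

Section planar_rotation.
Local Open Scope ereal_scope.
Context {R : realType}.
Local Notation mu := (@lebesgue_measure R).
Local Notation mR := (measurableTypeR R).
Implicit Type f : mR * mR -> \bar R.

(** The image of Lebesgue measure under a translation gives half-open intervals their length, so
    uniqueness identifies it with Lebesgue measure. *)
Lemma lebesgue_integral_shift (g : mR -> \bar R) (c : R) :
  measurable_fun setT g -> (forall x, 0 <= g x) ->
  \int[mu]_x g (x + c)%R = \int[mu]_x g x.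
Proof.
move=> mg g0.
have mphi : measurable_fun setT (fun x : mR => (x + c)%R : mR).
  by apply: measurable_funD.
rewrite -[LHS](ge0_integral_pushforward mphi mu (D := setT)) //.
apply: eq_measure_integral => /= A mA _; apply/esym.
apply: (@lebesgue_measure_unique _ (pushforward mu (fun x : mR => (x + c)%R : mR))) mA.
move=> _ [[a b]] _ <-.
rewrite /= /pushforward.
have -> : (fun x : R => (x + c)%R) @^-1` `]a, b] = `](a - c)%R, (b - c)%R]%classic :> set R.
  by apply/seteqP; split => x /=; rewrite !in_itv /= ltrBlDr lerBrDr.
rewrite !lebesgue_measure_itv /= !lte_fin ltrD2r.
by case: ifP => // _; rewrite -!EFinD; congr EFin; ring.
Qed.

(** For a fixed second coordinate the shear is a translation of the first one, so Tonelli reduces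
    the claim to translation invariance. *)
Lemma integral_shear1 f (c : R) : measurable_fun setT f -> (forall z, 0 <= f z) ->
  \int[mu \x mu]_z f (z.1 + c * z.2, z.2)%R = \int[mu \x mu]_z f z.
Proof.
move=> mf f0.
have mphi : measurable_fun setT (fun z : mR * mR => (z.1 + c * z.2, z.2)%R : mR * mR).
  apply: measurable_fun_pair => //; apply: measurable_funD => //.
  by apply: measurable_funM.
rewrite (fubini_tonelli2 (fun z : mR * mR => f (z.1 + c * z.2, z.2)%R)) //; last first.
  exact: (measurableT_comp mf mphi).
rewrite fubini_tonelli2 //; apply: eq_integral => y _; rewrite /fubini_G /=.
by rewrite (lebesgue_integral_shift (g := fun x => f (x, y))) //; exact: measurableT_comp.
Qed.

Lemma integral_shear2 f (c : R) : measurable_fun setT f -> (forall z, 0 <= f z) ->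
  \int[mu \x mu]_z f (z.1, z.2 + c * z.1)%R = \int[mu \x mu]_z f z.
Proof.
move=> mf f0.
have mphi : measurable_fun setT (fun z : mR * mR => (z.1, z.2 + c * z.1)%R : mR * mR).
  apply: measurable_fun_pair => //; apply: measurable_funD => //.
  by apply: measurable_funM.
rewrite (fubini_tonelli1 (fun z : mR * mR => f (z.1, z.2 + c * z.1)%R)) //; last first.
  exact: (measurableT_comp mf mphi).
rewrite fubini_tonelli1 //; apply: eq_integral => x _; rewrite /fubini_F /=.
by rewrite (lebesgue_integral_shift (g := fun y => f (x, y))) //; exact: measurableT_comp.
Qed.

Definition rotation (c s : R) (z : mR * mR) : mR * mR :=
  (c * z.1 - s * z.2, s * z.1 + c * z.2)%R.

Lemma measurable_rotation c s : measurable_fun setT (rotation c s).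
Proof.
apply: measurable_fun_pair.
  by apply: measurable_funB; apply: measurable_funM.
by apply: measurable_funD; apply: measurable_funM.
Qed.

(* For c <> -1 a rotation is a product of three shears, with
   tan (angle / 2) = s / (1 + c). *)
Lemma integral_rotation f (c s : R) : (c ^+ 2 + s ^+ 2 = 1)%R ->
  measurable_fun setT f -> (forall z, 0 <= f z) ->
  \int[mu \x mu]_z f (rotation c s z) = \int[mu \x mu]_z f z.
Proof.
have gen c' s' g : (c' ^+ 2 + s' ^+ 2 = 1)%R -> c' != (-1)%R ->
    measurable_fun setT g -> (forall z, 0 <= g z) ->
    \int[mu \x mu]_z g (rotation c' s' z) = \int[mu \x mu]_z g z.
  move=> cs c1 mg g0; pose t : R := (s' / (1 + c'))%R.
  have c1' : (1 + c' != 0)%R by rewrite addrC addr_eq0.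
  have mp1 (a : R) : measurable_fun setT
      (fun z : mR * mR => (z.1 + a * z.2, z.2)%R : mR * mR).
    apply: measurable_fun_pair => //; apply: measurable_funD => //.
    by apply: measurable_funM.
  have mp2 (a : R) : measurable_fun setT
      (fun z : mR * mR => (z.1, z.2 + a * z.1)%R : mR * mR).
    apply: measurable_fun_pair => //; apply: measurable_funD => //.
    by apply: measurable_funM.
  rewrite -(integral_shear1 (- t) mg g0).
  pose g1 := fun z : mR * mR => g (z.1 + - t * z.2, z.2)%R.
  have mg1 : measurable_fun setT g1 by exact: (measurableT_comp mg (mp1 _)).
  have g10 z : 0 <= g1 z by exact: g0.
  rewrite -[RHS](integral_shear2 s' mg1 g10).
  pose g2 := fun z : mR * mR => g1 (z.1, z.2 + s' * z.1)%R.
  have mg2 : measurable_fun setT g2 by exact: (measurableT_comp mg1 (mp2 _)).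
  have g20 z : 0 <= g2 z by exact: g0.
  rewrite -[RHS](integral_shear1 (- t) mg2 g20).
  apply: eq_integral => z _; rewrite /g2 /g1 /rotation /=; congr (g (_, _)).
    have s2 : (s' ^+ 2 = (1 - c') * (1 + c'))%R by move: cs; lra.
    have st : (s' * t = 1 - c')%R by rewrite /t mulrA -expr2 s2 mulfK.
    have tc : (t * (1 + c') = s')%R by rewrite /t mulfVK.
    transitivity ((1 - s' * t) * z.1 - (t * (1 + (1 - s' * t))) * z.2)%R; last by ring.
    by rewrite st subKr tc.
  have s2 : (s' ^+ 2 = (1 - c') * (1 + c'))%R by move: cs; lra.
  have st : (s' * t = 1 - c')%R by rewrite /t mulrA -expr2 s2 mulfK.
  transitivity (s' * z.1 + (1 - s' * t) * z.2)%R; last by ring.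
  by rewrite st subKr.
move=> cs mf f0; have [c1|c1] := eqVneq c (-1)%R; last exact: gen.
(* The half turn, for which the shear parameter is undefined, is the quarter turn (0, 1) performed
   twice. *)
have s0 : s = 0%R by apply/eqP; rewrite -sqrf_eq0; move: cs; rewrite c1; move=> ?; apply/eqP; lra.
have q : (0 ^+ 2 + 1 ^+ 2 = 1 :> R)%R by rewrite expr0n /= add0r expr1n.
have n1 : (0 != -1 :> R)%R by rewrite eq_sym oppr_eq0 oner_eq0.
rewrite -(gen _ _ _ q n1 mf f0).
rewrite -[RHS](gen 0%R 1%R (fun z => f (rotation 0 1 z))) //; last first.
  exact: (measurableT_comp mf (measurable_rotation _ _)).
by apply: eq_integral => z _; rewrite /rotation c1 s0 /=; congr (f (_, _)); ring.
Qed.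

End planar_rotation.

(* The measurable structure carried by [lebesgue_measure]; it has the same sets as
   the one on [R], but the two are not identified by unification. *)
Definition mpt (R : realType) := (measurableTypeR R * measurableTypeR R)%type.
HB.instance Definition _ (R : realType) := Measurable.on (mpt R).

Definition gauss1 (R : realType) : probability (measurableTypeR R) R := normal_prob 0 1.

Definition gam (R : realType) : probability (mpt R) R := (gauss1 R \x gauss1 R)%E.

(** * The standard Gaussian measure of the plane *)

Section gaussian_measure.
Context {R : realType}.
Local Notation mu := (@lebesgue_measure R).
Local Notation gam := (gam R).

Lemma gdensE (z : pt R) : gdens z = normal_pdf 0 1 z.1 * normal_pdf 0 1 z.2.
Proof.
rewrite !normal_pdfE ?oner_neq0 //= /normal_fun /normal_peak /gdens.
rewrite !subr0 !expr1n mul1r mulrACA -expRD -invfM -expr2 sqr_sqrtr; last first.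
  by rewrite mulrn_wge0 // pi_ge0.
by rewrite mulrC mulr_natl; congr (_ * expR _); field.
Qed.

Lemma gdens_ge0 (z : pt R) : 0 <= gdens z.
Proof. by rewrite gdensE mulr_ge0 // normal_pdf_ge0. Qed.

Lemma measurable_gdens : measurable_fun setT (@gdens R : mpt R -> R).
Proof.
rewrite (_ : @gdens R = fun z => normal_pdf 0 1 z.1 * normal_pdf 0 1 z.2); last first.
  by apply/funext => z; rewrite gdensE.
by apply: measurable_funM; apply: measurableT_comp => //; exact: measurable_normal_pdf.
Qed.

Local Open Scope ereal_scope.

Lemma ge0_integral_normal (f : measurableTypeR R -> \bar R) : measurable_fun setT f ->
  (forall x, 0 <= f x) ->
  \int[gauss1 R]_x f x = \int[mu]_x (f x * (normal_pdf 0 1 x)%:E).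
Proof.
move=> mf f0; apply: ge0_integral_density => //.
- exact: measurable_normal_pdf.
- by move=> x; exact: normal_pdf_ge0.
Qed.

Lemma ge0_integral_gam (f : mpt R -> \bar R) : measurable_fun setT f ->
  (forall z, 0 <= f z) ->
  \int[gam]_z f z = \int[mu \x mu]_z (f z * (gdens z)%:E).
Proof.
move=> mf f0; rewrite /gam fubini_tonelli1 //.
rewrite [RHS](fubini_tonelli1 (m1 := mu) (m2 := mu)) //; last 2 first.
- by apply: emeasurable_funM => //; apply/measurable_EFinP; exact: measurable_gdens.
- by move=> z; rewrite mule_ge0 // lee_fin gdens_ge0.
rewrite ge0_integral_normal; last 2 first.
- exact: measurable_fun_fubini_tonelli_F.
- by move=> x; apply: integral_ge0.
apply: eq_integral => x _; rewrite /fubini_F.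
rewrite ge0_integral_normal //; last exact: measurableT_comp.
rewrite -ge0_integralZr //; last 3 first.
- apply: emeasurable_funM; first exact: measurableT_comp.
  by apply/measurable_EFinP; exact: measurable_normal_pdf.
- by move=> y _; rewrite mule_ge0 // lee_fin normal_pdf_ge0.
- by rewrite lee_fin normal_pdf_ge0.
by apply: eq_integral => y _; rewrite gdensE /= -muleA -EFinM [(_ * _)%R]mulrC.
Qed.

(** The density is nonnegative, so multiplication by it commutes with taking positive and negative
    parts, and the nonnegative case applies to each part. *)
Lemma gintE (f : mpt R -> R) : measurable_fun setT f ->
  gint f = \int[gam]_z (f z)%:E.
Proof.
move=> mf.
have maxM (a : R) z : (Num.max (a * gdens z) 0 = Num.max a 0 * gdens z)%R.
  by rewrite -{1}[0%R](mul0r (gdens z)) -maxr_pMl ?gdens_ge0.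
rewrite /gint [LHS]integralE [RHS]integralE; congr (_ - _).
  rewrite ge0_integral_gam //; last by apply: measurable_funepos; exact/measurable_EFinP.
  apply: eq_integral => z _.
  by rewrite !funeposE -!EFin_max -EFinM maxM.
rewrite ge0_integral_gam //; last by apply: measurable_funeneg; exact/measurable_EFinP.
apply: eq_integral => z _; rewrite !funenegE.
by rewrite -!EFinN -!EFin_max -EFinM -mulNr maxM.
Qed.

Lemma gdens_rotation (c s : R) z : (c ^+ 2 + s ^+ 2 = 1)%R -> gdens (rotation c s z) = gdens z.
Proof.
move=> cs; rewrite /gdens.
suff -> : ((rotation c s z).1 ^+ 2 + (rotation c s z).2 ^+ 2 = z.1 ^+ 2 + z.2 ^+ 2)%R by [].
transitivity ((c ^+ 2 + s ^+ 2) * (z.1 ^+ 2 + z.2 ^+ 2))%R; last by rewrite cs mul1r.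
by rewrite /rotation /=; ring.
Qed.

Lemma gam_rotation (f : mpt R -> \bar R) (c s : R) : (c ^+ 2 + s ^+ 2 = 1)%R ->
  measurable_fun setT f -> (forall z, 0 <= f z) ->
  \int[gam]_z f (rotation c s z) = \int[gam]_z f z.
Proof.
move=> cs mf f0; have mr := measurable_rotation c s.
rewrite !ge0_integral_gam //; last exact: measurableT_comp mf mr.
rewrite -[RHS](integral_rotation cs); first by apply: eq_integral => z _; rewrite gdens_rotation.
- by apply: emeasurable_funM => //; apply/measurable_EFinP; exact: measurable_gdens.
- by move=> z; rewrite mule_ge0 // lee_fin gdens_ge0.
Qed.

End gaussian_measure.

(** * Measure-preserving maps *)

Section preserves.
Local Open Scope ereal_scope.
Context d1 d2 (X : measurableType d1) (Y : measurableType d2) (R : realType).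

(** The image measure is described through integrals of nonnegative functions: in this form the
    property composes by substitution and combines directly with Tonelli. *)
Definition preserves (m : {measure set X -> \bar R}) (n : {measure set Y -> \bar R})
    (phi : X -> Y) :=
  measurable_fun setT phi /\
  forall f : Y -> \bar R, measurable_fun setT f -> (forall y, 0 <= f y) ->
    \int[m]_x f (phi x) = \int[n]_y f y.

Variables (m : {measure set X -> \bar R}) (n : {measure set Y -> \bar R}) (phi : X -> Y).
Hypothesis pphi : preserves m n phi.

Lemma preserves_integral f : measurable_fun setT f ->
  \int[m]_x f (phi x) = \int[n]_y f y.
Proof.
case: pphi => mphi h mf; rewrite [LHS]integralE [RHS]integralE; congr (_ - _).
  rewrite -h; [|exact: measurable_funepos|by []].
  by apply: eq_integral => x _; rewrite !funeposE.
rewrite -h; [|exact: measurable_funeneg|by []].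
  by apply: eq_integral => x _; rewrite !funenegE.
Qed.

End preserves.

Lemma preserves_comp d1 d2 d3 (X : measurableType d1) (Y : measurableType d2)
  (Z : measurableType d3) (R : realType)
  (m : {measure set X -> \bar R}) (n : {measure set Y -> \bar R})
  (p : {measure set Z -> \bar R}) (phi : X -> Y) (psi : Y -> Z) :
  preserves m n phi -> preserves n p psi -> preserves m p (psi \o phi).
Proof.
move=> [mphi h] [mpsi k]; split; first exact: measurableT_comp.
by move=> f mf f0; rewrite -k // -h //; exact: measurableT_comp mf mpsi.
Qed.

Lemma gam_tonelli (R : realType) (f : mpt R -> \bar R) :
  measurable_fun setT f -> (forall w, 0 <= f w)%E ->
  (\int[gam R]_w f w = \int[gauss1 R]_a \int[gauss1 R]_b f (a, b))%E.
Proof. exact: (fubini_tonelli1 (m1 := gauss1 R) (m2 := gauss1 R)). Qed.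

Opaque gam gauss1.

(** * Unitary maps preserving the product of two planar Gaussians *)

Section gam4.
Context {R : realType}.
Local Notation gam := (gam R).
Local Notation P2 := (mpt R).
Local Open Scope ereal_scope.

(** An involution that gathers the first coordinates of x and y in one plane and the second ones in
    another, so that a rotation mixing x with y acts inside each plane. *)
Definition swap_mid (w : P2 * P2) : P2 * P2 := ((w.1.1, w.2.1), (w.1.2, w.2.2)).

Lemma measurable_swap_mid : measurable_fun setT swap_mid.
Proof.
by apply: measurable_fun_pair; apply: measurable_fun_pair; apply: measurableT_comp.
Qed.

Lemma gam4E (f : P2 * P2 -> \bar R) : measurable_fun setT f -> (forall w, 0 <= f w) ->
  \int[gam \x gam]_w f w = \int[gauss1 R]_a \int[gauss1 R]_b
    \int[gauss1 R]_c \int[gauss1 R]_d f ((a, b), (c, d)).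
Proof.
move=> mf f0; rewrite fubini_tonelli1 //.
have mF : measurable_fun setT (fubini_F gam f) by exact: measurable_fun_fubini_tonelli_F.
have F0 x : 0 <= fubini_F gam f x by exact: integral_ge0.
rewrite (gam_tonelli mF F0); apply: eq_integral => a _; apply: eq_integral => b _.
rewrite /fubini_F (gam_tonelli (f := fun y => f ((a, b), y))) //.
exact: measurableT_comp.
Qed.

(** In the fourfold iterated integral this exchanges the two middle variables, which Tonelli
    allows. *)
Lemma preserves_swap_mid : preserves (gam \x gam) (gam \x gam) swap_mid.
Proof.
split=> [|f mf f0]; first exact: measurable_swap_mid.
apply: etrans (esym (gam4E mf f0)).
have mfs : measurable_fun setT (fun w => f (swap_mid w)).
  exact: measurableT_comp mf measurable_swap_mid.
apply: (etrans (gam4E mfs (fun w => f0 _))).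
apply: eq_integral => a _; rewrite /swap_mid /=.
have mg : measurable_fun setT (fun p : P2 * measurableTypeR R =>
    f ((a, p.1.1), (p.1.2, p.2))).
  by apply: measurableT_comp => //; apply: measurable_fun_pair;
    apply: measurable_fun_pair => //; apply: measurableT_comp.
rewrite (fubini_tonelli (m1 := gauss1 R) (m2 := gauss1 R)
  (fun p : P2 => \int[gauss1 R]_d f ((a, p.1), (p.2, d)))) //.
- exact: (measurable_fun_fubini_tonelli_F (fun p : P2 * measurableTypeR R =>
    f ((a, p.1.1), (p.1.2, p.2)))).
- by move=> p; apply: integral_ge0.
Qed.

Lemma preserves_fst (phi : P2 -> P2) : preserves gam gam phi ->
  preserves (gam \x gam) (gam \x gam) (fun w => (phi w.1, w.2)).
Proof.
move=> [mphi h]; have mp : measurable_fun setT (fun w : P2 * P2 => (phi w.1, w.2)).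
  by apply: measurable_fun_pair => //; exact: measurableT_comp.
split=> // f mf f0.
have mfp : measurable_fun setT (fun w => f (phi w.1, w.2)) by exact: measurableT_comp mf mp.
apply: (etrans (fubini_tonelli2 _ mfp (fun w => f0 _))).
apply: (etrans _ (esym (fubini_tonelli2 _ mf f0))); apply: eq_integral => y _; rewrite /fubini_G /=.
by rewrite (h (fun x => f (x, y))) //; exact: measurableT_comp.
Qed.

Lemma preserves_snd (phi : P2 -> P2) : preserves gam gam phi ->
  preserves (gam \x gam) (gam \x gam) (fun w => (w.1, phi w.2)).
Proof.
move=> [mphi h]; have mp : measurable_fun setT (fun w : P2 * P2 => (w.1, phi w.2)).
  by apply: measurable_fun_pair => //; exact: measurableT_comp.
split=> // f mf f0.
have mfp : measurable_fun setT (fun w => f (w.1, phi w.2)) by exact: measurableT_comp mf mp.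
apply: (etrans (fubini_tonelli1 _ mfp (fun w => f0 _))).
apply: (etrans _ (esym (fubini_tonelli1 _ mf f0))); apply: eq_integral => x _; rewrite /fubini_F /=.
by rewrite (h (fun y => f (x, y))) //; exact: measurableT_comp.
Qed.

Lemma preserves_rotation (c s : R) : (c ^+ 2 + s ^+ 2 = 1)%R ->
  preserves gam gam (rotation c s).
Proof. by move=> cs; split=> [|f]; [exact: measurable_rotation|exact: gam_rotation]. Qed.

(* [mix a s x y] is a x + s y under the identification of R^2 with C. *)
Definition mix (a : R * R) (s : R) (x y : P2) : P2 :=
  (a.1 * x.1 - a.2 * x.2 + s * y.1, a.2 * x.1 + a.1 * x.2 + s * y.2)%R.

Definition conjp (a : R * R) : R * R := (a.1, - a.2)%R.
Definition oppp (a : R * R) : R * R := (- a.1, - a.2)%R.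
Definition sqnorm (a : R * R) : R := (a.1 ^+ 2 + a.2 ^+ 2)%R.

Definition unitary (a : R * R) (s : R) (w : P2 * P2) : P2 * P2 :=
  (mix a s w.1 w.2, mix (oppp (conjp a)) s w.2 w.1).

(* With a = r e and |e| = 1, the map (x, y) |-> (a x + s y, s x - conj a y) factors
   through rotations of the planes of x, of y, and of the pairs (x.1, y.1), (x.2, y.2). *)
Lemma preserves_unitary (a : R * R) (s : R) : (sqnorm a + s ^+ 2 = 1)%R ->
  preserves (gam \x gam) (gam \x gam) (unitary a s).
Proof.
move=> as1.
(* Polar decomposition of a; for a = 0 any unit vector would do and (1, 0) is taken. *)
have [r [e [ea1 ea2 e1]]] : exists r : R, exists e : R * R,
    [/\ a.1 = r * e.1, a.2 = r * e.2 & e.1 ^+ 2 + e.2 ^+ 2 = 1]%R.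
  have [a0|a0] := eqVneq (sqnorm a) 0%R.
    have := a0; rewrite /sqnorm => /eqP; rewrite paddr_eq0 ?sqr_ge0 // !sqrf_eq0.
    move=> /andP[/eqP h1 /eqP h2].
    exists 0%R, (1, 0)%R; split; rewrite ?mul0r //=.
    by rewrite expr1n expr0n addr0.
  have ap : (0 < sqnorm a)%R by rewrite lt_def a0 addr_ge0 ?sqr_ge0.
  have r0 : Num.sqrt (sqnorm a) != 0%R by rewrite gt_eqF // sqrtr_gt0.
  exists (Num.sqrt (sqnorm a)), (a.1 / Num.sqrt (sqnorm a), a.2 / Num.sqrt (sqnorm a))%R.
  split=> /=; rewrite ?mulrA ?[(Num.sqrt _ * _)%R]mulrC ?mulfK //.
  by rewrite !exprMn -mulrDl exprVn sqr_sqrtr ?mulfV // ltW.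
have rs : (r ^+ 2 + s ^+ 2 = 1)%R.
  move: as1; rewrite /sqnorm ea1 ea2 !exprMn -mulrDr e1 mulr1; done.
have e1' : (e.1 ^+ 2 + (- e.2) ^+ 2 = 1)%R by rewrite sqrrN.
have n1 : ((-1) ^+ 2 + 0 ^+ 2 = 1 :> R)%R by rewrite sqrrN expr1n expr0n addr0.
(* In complex terms: (x, y) becomes (e x, - y); rotating by (r, s) across the planes gives (r e x +
   s y, s e x - r y); multiplying the second entry by conj e gives s x - conj a y. *)
have := preserves_fst (preserves_rotation e1).
move/preserves_comp/(_ (preserves_snd (preserves_rotation n1))).
move/preserves_comp/(_ preserves_swap_mid).
move/preserves_comp/(_ (preserves_fst (preserves_rotation rs))).
move/preserves_comp/(_ (preserves_snd (preserves_rotation rs))).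
move/preserves_comp/(_ preserves_swap_mid).
move/preserves_comp/(_ (preserves_snd (preserves_rotation e1'))).
congr preserves; apply/funext => -[[x1 x2] [y1 y2]].
rewrite /unitary /mix /rotation /swap_mid /conjp /oppp /= ea1 ea2.
congr ((_, _), (_, _)); [by ring|by ring| |].
  transitivity (s * x1 * (e.1 ^+ 2 + e.2 ^+ 2) - r * (e.1 * y1 + e.2 * y2))%R; first by ring.
  by rewrite e1; ring.
transitivity (s * x2 * (e.1 ^+ 2 + e.2 ^+ 2) + r * (e.2 * y1 - e.1 * y2))%R; first by ring.
by rewrite e1; ring.
Qed.

End gam4.

(** * The real space L^2 of a probability measure *)

Section L2space.
Context d (T : measurableType d) (R : realType) (P : probability T R).
Local Notation W := (LfunType P (lee1n 2)).
Implicit Types u v : T -> R.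

Definition L2r u := measurable_fun setT u /\ (\int[P]_x ((u x) ^+ 2)%:E < +oo)%E.

Lemma L2rP u : L2r u <-> u \in Lfun P 2%:E.
Proof.
split=> [[mu uy]|h].
  apply/andP; split; rewrite inE //= /finite_norm unlock.
  apply: poweR_lty; under eq_integral do
    rewrite /= powR_mulrn // real_normK ?num_real //.
  exact: uy.
split; first by have /andP[] := h; rewrite inE.
have /integrableP[_] := Lfun2_integrable_sqr h.
by under eq_integral do rewrite /= ger0_norm ?sqr_ge0 //.
Qed.

Lemma measurable_sqr u : measurable_fun setT u ->
  measurable_fun setT (fun x => ((u x) ^+ 2)%:E).
Proof. by move=> mu; apply/measurable_EFinP; exact: measurable_funX. Qed.

Lemma L2_sqr_integrable u : L2r u -> P.-integrable setT (fun x => ((u x) ^+ 2)%:E).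
Proof.
move=> [mu uy]; apply/integrableP; split; first exact: measurable_sqr.
by under eq_integral do rewrite /= ger0_norm ?sqr_ge0 //.
Qed.

Lemma L2_mul_integrable u v : L2r u -> L2r v ->
  P.-integrable setT (fun x => (u x * v x)%:E).
Proof.
move=> hu hv; apply: (le_integrable measurableT _ _
  (integrableD measurableT (L2_sqr_integrable hu) (L2_sqr_integrable hv))).
  by case: hu hv => mu _ [mv _]; apply/measurable_EFinP; exact: measurable_funM.
move=> x _ /=; rewrite lee_fin normrM [leRHS]ger0_norm ?addr_ge0 ?sqr_ge0 //.
rewrite -(real_normK (num_real (u x))) -(real_normK (num_real (v x))).
have := sqr_ge0 (`|u x| - `|v x|); have := mulr_ge0 (normr_ge0 (u x)) (normr_ge0 (v x)).
rewrite sqrrB; lra.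
Qed.

Lemma integral_cst_prob (c : R) : (\int[P]_x c%:E = c%:E)%E.
Proof.
apply: (etrans (integral_cst P measurableT c%:E)).
exact: etrans (congr1 (mule c%:E) (probability_setT P)) (mule1 _).
Qed.

Lemma L2_cst c : L2r (cst c).
Proof.
split; first exact: measurable_cst.
by have := integral_cst_prob (c ^+ 2); rewrite /cst => ->; rewrite ltry.
Qed.

Lemma L2_integrable u : L2r u -> P.-integrable setT (fun x => (u x)%:E).
Proof.
move=> hu; have := L2_mul_integrable hu (L2_cst 1).
by apply: eq_integrable => // x _; rewrite mulr1.
Qed.

Lemma L2_bounded u (M : R) : measurable_fun setT u -> (forall x, `|u x| <= M) -> L2r u.
Proof.
move=> mu uM; split=> //; apply: (@le_lt_trans _ _ (\int[P]_x (M ^+ 2)%:E)%E).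
  apply: ge0_le_integral => //.
  - by move=> x _; rewrite lee_fin sqr_ge0.
  - exact: measurable_sqr.
  - by move=> x _; rewrite lee_fin -real_normK ?num_real // lerXn2r ?nnegrE // (le_trans _ (uM x)).
by rewrite integral_cst_prob ltry.
Qed.

Definition ipW (u v : W) : R := \int[P]_x (u x * v x).

Lemma W_L2 (u : W) : L2r u. Proof. apply/L2rP; exact: LfunP. Qed.

Lemma ipWC (u v : W) : ipW u v = ipW v u.
Proof. by apply: eq_Rintegral => x _; rewrite mulrC. Qed.

Lemma ipWDl (u v w : W) : ipW (u + v) w = ipW u w + ipW v w.
Proof.
rewrite /ipW -RintegralD //; last 2 first.
- exact: L2_mul_integrable (W_L2 u) (W_L2 w).
- exact: L2_mul_integrable (W_L2 v) (W_L2 w).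
by apply: eq_Rintegral => x _; rewrite -mulrDl.
Qed.

Lemma ipWZl a (u w : W) : ipW (a *: u) w = a * ipW u w.
Proof.
rewrite /ipW -RintegralZl //; last exact: L2_mul_integrable (W_L2 u) (W_L2 w).
by apply: eq_Rintegral => x _; rewrite mulrA.
Qed.

Lemma ipW_ge0 (u : W) : 0 <= ipW u u.
Proof. by apply: Rintegral_ge0 => x _; rewrite -expr2 sqr_ge0. Qed.

Lemma ipW_semi_inner : semi_inner ipW.
Proof. by split; [exact: ipWC|exact: ipWDl|exact: ipWZl|exact: ipW_ge0]. Qed.

(** The default 0 is returned for functions outside L^2, so equations on [toW u] go through
    [toWE]. *)
Definition toW u : W := insubd 0 u.

Lemma toWE u : L2r u -> toW u = u :> (T -> R).
Proof. by move=> /L2rP h; rewrite /toW insubdK. Qed.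

Lemma valWB (u v : W) : (u - v : W) = (fun x => u x - v x) :> (T -> R).
Proof. by []. Qed.

Lemma nmW_sqr (u : W) : hnorm ipW u ^+ 2 = fine (\int[P]_x ((u x) ^+ 2)%:E).
Proof.
by rewrite (nm_sqr ipW_semi_inner).
Qed.

Lemma L2r_fin u : L2r u -> (\int[P]_x ((u x) ^+ 2)%:E)%E \is a fin_num.
Proof. by move=> [_ h]; rewrite ge0_fin_numE // integral_ge0 // => x _; rewrite lee_fin sqr_ge0. Qed.

(** Cauchy-Schwarz against the constant 1, which has norm 1; an infinite right side leaves nothing
    to show. *)
Lemma jensen_sqr u : measurable_fun setT u ->
  (((\int[P]_x u x)%R ^+ 2)%:E <= \int[P]_x ((u x) ^+ 2)%:E)%E.
Proof.
move=> mu; have [uy|] := ltP (\int[P]_x ((u x) ^+ 2)%:E)%E +oo%E; last first.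
  by move=> h; apply: le_trans h; rewrite leey.
have hu : L2r u by [].
have := cauchy_schwarz ipW_semi_inner (toW u) (toW (cst 1)).
have -> : ipW (toW u) (toW (cst 1)) = \int[P]_x u x.
  by apply: eq_Rintegral => x _; rewrite !toWE ?mulr1 //; exact: L2_cst.
have -> : hnorm ipW (toW (cst 1)) = 1.
  rewrite /hnorm (_ : ipW _ _ = 1) ?sqrtr1 // /ipW toWE; last exact: L2_cst.
  by rewrite /cst /Rintegral mulr1 integral_cst_prob.
rewrite mulr1 => h; rewrite -[leRHS]fineK ?L2r_fin // lee_fin.
have := nmW_sqr (toW u); rewrite toWE // => <-.
rewrite -real_normK ?num_real // lerXn2r ?nnegrE //; exact: sqrtr_ge0.
Qed.

End L2space.

Lemma preserves_proj1 d1 d2 (X : measurableType d1) (Y : measurableType d2) (R : realType)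
  (P : probability X R) (Q : probability Y R) : preserves (P \x Q)%E P fst.
Proof.
split=> [|f mf f0]; first exact: measurable_fst.
have mf1 : measurable_fun setT (fun w : X * Y => f w.1) by exact: measurableT_comp.
apply: (etrans (fubini_tonelli1 _ mf1 (fun w => f0 _))); apply: eq_integral => x _.
rewrite /fubini_F /=; apply: (etrans (integral_cst Q measurableT (f x))).
exact: etrans (congr1 (mule (f x)) (probability_setT Q)) (mule1 _).
Qed.

(** * Mehler operators: contraction, adjoint, composition *)

Section mehler.
Context {R : realType}.
Local Notation gam := (gam R).
Local Notation P2 := (mpt R).
Local Notation gam2 := (gam \x gam)%E.
Implicit Types (a b : R * R) (s : R) (u v : P2 -> R).

(** [Rintegral] gives a real value at every x, namely 0 where the integral is infinite; for u in L^2
    this can happen only on a null set. *)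
Definition mehler a s u : P2 -> R := fun x => \int[gam]_y u (mix a s x y).

Lemma measurable_mix a s : measurable_fun setT (fun w : P2 * P2 => mix a s w.1 w.2).
Proof.
have m11 : measurable_fun setT (fun w : P2 * P2 => w.1.1) by apply: measurableT_comp.
have m12 : measurable_fun setT (fun w : P2 * P2 => w.1.2) by apply: measurableT_comp.
have m21 : measurable_fun setT (fun w : P2 * P2 => w.2.1) by apply: measurableT_comp.
have m22 : measurable_fun setT (fun w : P2 * P2 => w.2.2) by apply: measurableT_comp.
apply: measurable_fun_pair.
  by apply: measurable_funD; [apply: measurable_funB|]; apply: measurable_funM.
by apply: measurable_funD; [apply: measurable_funD|]; apply: measurable_funM.
Qed.

Lemma measurable_mix2 a s x : measurable_fun setT (mix a s x : P2 -> P2).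
Proof.
have m2 : measurable_fun setT (fun y : P2 => (x, y)) by exact: measurable_fun_pair.
exact: (measurableT_comp (measurable_mix a s) m2).
Qed.

Section L2_action.
Variables (a : R * R) (s : R).
Hypothesis as1 : sqnorm a + s ^+ 2 = 1.

Lemma preserves_mix : preserves gam2 gam (fun w => mix a s w.1 w.2).
Proof. exact: preserves_comp (preserves_unitary as1) (preserves_proj1 _ _). Qed.

Lemma preserves_L2 d (T : measurableType d) (P : probability T R) (phi : T -> P2) u :
  preserves P gam phi -> L2r gam u -> L2r P (u \o phi).
Proof.
move=> [mphi h] [mu uy]; split; first exact: measurableT_comp.
by rewrite (h (fun x => ((u x) ^+ 2)%:E)) // => [|x]; [exact: measurable_sqr|rewrite lee_fin sqr_ge0].
Qed.

Lemma mix_integrable u : L2r gam u ->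
  gam2.-integrable setT (fun w => (u (mix a s w.1 w.2))%:E).
Proof. by move=> /(preserves_L2 preserves_mix)/L2_integrable. Qed.

Lemma measurable_mehler u : L2r gam u -> measurable_fun setT (mehler a s u).
Proof.
move=> hu; have mF := measurable_fubini_F (mix_integrable hu).
have mfine : measurable_fun setT (@fine R) by [].
exact: (measurableT_comp mfine mF).
Qed.

(** Jensen for the inner integral, then the fact that a x + s y has law [gam] under the product
    measure. *)
Lemma mehler_sqr_le u : L2r gam u ->
  (\int[gam]_x ((mehler a s u x) ^+ 2)%:E <= \int[gam]_x ((u x) ^+ 2)%:E)%E.
Proof.
move=> hu; have [mu _] := hu; have mu2 := measurable_sqr mu.
have mum : measurable_fun setT (fun w : P2 * P2 => ((u (mix a s w.1 w.2)) ^+ 2)%:E).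
  exact: (measurableT_comp mu2 (measurable_mix a s)).
have sq0 (x : R) : (0 <= (x ^+ 2)%:E)%E by rewrite lee_fin sqr_ge0.
rewrite -(preserves_mix.2 _ mu2) //.
apply: le_trans (_ : (\int[gam]_x \int[gam]_y ((u (mix a s x y)) ^+ 2)%:E <= _)%E); last first.
  by rewrite [leRHS](fubini_tonelli1 _ mum).
apply: ge0_le_integral => //.
- by apply: measurable_sqr; exact: measurable_mehler.
- exact: (measurable_fun_fubini_tonelli_F _ mum).
- move=> x _; apply: jensen_sqr; exact: (measurableT_comp mu (measurable_mix2 a s x)).
Qed.

Lemma mehler_L2 u : L2r gam u -> L2r gam (mehler a s u).
Proof.
move=> hu; split; first exact: measurable_mehler.
by case: (hu) => _; apply: le_lt_trans; exact: mehler_sqr_le.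
Qed.

Lemma integral_mehlerM u v : L2r gam u -> L2r gam v ->
  (\int[gam]_x (mehler a s u x * v x)%:E =
   \int[gam2]_w (u (mix a s w.1 w.2) * v w.1)%:E)%E.
Proof.
move=> hu hv.
have hv1 : L2r gam2 (v \o fst) by exact: preserves_L2 (preserves_proj1 _ _) hv.
have hh := L2_mul_integrable (preserves_L2 preserves_mix hu) hv1.
apply: etrans (integral12_prod_meas1 hh); apply: ae_eq_integral => //.
- by have [? _] := mehler_L2 hu; have [? _] := hv; apply/measurable_EFinP; exact: measurable_funM.
- exact: measurable_fubini_F hh.
(* Pulling [v x] out of the inner integral needs integrability in y, which is known for almost every
   x only. *)
have := ae_integrable1 (mix_integrable hu); apply: filterS => x /= ix _.
rewrite /fubini_F /=; under [RHS]eq_integral do rewrite EFinM.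
rewrite integralZr // EFinM /mehler /Rintegral fineK //.
exact: integrable_fin_num ix.
Qed.

End L2_action.

Lemma mehler_adjoint a s u v : sqnorm a + s ^+ 2 = 1 -> L2r gam u -> L2r gam v ->
  \int[gam]_x (mehler a s u x * v x) = \int[gam]_x (u x * mehler (conjp a) s v x).
Proof.
move=> as1 hu hv.
have as1' : sqnorm (conjp a) + s ^+ 2 = 1 by rewrite /sqnorm /conjp /= sqrrN.
rewrite /Rintegral (integral_mehlerM as1 hu hv); congr fine.
transitivity (\int[gam]_x (mehler (conjp a) s v x * u x)%:E)%E; last first.
  by apply: eq_integral => x _; rewrite mulrC.
apply: etrans (esym (integral_mehlerM as1' hv hu)).
have mh : measurable_fun setT (fun w : P2 * P2 =>
    (v (mix (conjp a) s w.1 w.2) * u w.1)%:E).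
  case: hu hv => mu _ [mv _]; apply/measurable_EFinP/measurable_funM.
    exact: measurableT_comp mv (measurable_mix _ _).
  exact: measurableT_comp mu measurable_fst.
(* Substitute (x', y') = (a x + s y, s x - conj a y): then conj a x' + s y' = (|a|^2 + s^2) x = x,
   so u and v exchange their roles. *)
rewrite -(preserves_integral (preserves_unitary as1) mh).
apply: eq_integral => -[[x1 x2] [y1 y2]] _; rewrite [(v _ * _)%R]mulrC; congr (_ * v _)%:E.
rewrite /unitary /mix /conjp /oppp /=.
have as2 : a.1 ^+ 2 + a.2 ^+ 2 + s ^+ 2 = 1 by [].
congr pair.
  transitivity ((a.1 ^+ 2 + a.2 ^+ 2 + s ^+ 2) * x1); first by rewrite as2 mul1r.
  by ring.
transitivity ((a.1 ^+ 2 + a.2 ^+ 2 + s ^+ 2) * x2); first by rewrite as2 mul1r.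
by ring.
Qed.

Definition mulp a b : R * R := (a.1 * b.1 - a.2 * b.2, a.1 * b.2 + a.2 * b.1).

Lemma sqnormM a b : sqnorm (mulp a b) = sqnorm a * sqnorm b.
Proof. by rewrite /sqnorm /mulp /=; ring. Qed.

Lemma bounded_integrable d (T : measurableType d) (P : probability T R) (g : T -> R) M :
  measurable_fun setT g -> (forall x, `|g x| <= M) ->
  P.-integrable setT (fun x => (g x)%:E).
Proof. by move=> mg gM; apply: L2_integrable; exact: L2_bounded gM. Qed.

(** The argument of u is b (a x + s Y) + r Z = a b x + (b s Y + r Z), and the noise b s Y + r Z has
    the law of q Y because |b|^2 s^2 + r^2 = q^2. Boundedness of u makes every integral finite, so
    the identity holds at every x. *)
Lemma mehler_comp a s b r q u M x :
  sqnorm a + s ^+ 2 = 1 -> sqnorm b + r ^+ 2 = 1 -> sqnorm (mulp a b) + q ^+ 2 = 1 ->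
  measurable_fun setT u -> (forall x, `|u x| <= M) ->
  mehler a s (mehler b r u) x = mehler (mulp a b) q u x.
Proof.
move=> as1 br1 abq mu uM.
have q2 : q ^+ 2 = sqnorm b * s ^+ 2 + r ^+ 2.
  have ha : sqnorm a = 1 - s ^+ 2 by lra.
  have hb : sqnorm b = 1 - r ^+ 2 by lra.
  by move: abq; rewrite sqnormM ha hb; lra.
pose h (w : P2 * P2) := u (mix b r (mix a s x w.1) w.2).
have mh : measurable_fun setT h.
  have m2 : measurable_fun setT (fun w : P2 * P2 => (mix a s x w.1, w.2)).
    apply: measurable_fun_pair => //.
    exact: (measurableT_comp (measurable_mix2 a s x) measurable_fst).
  exact: (measurableT_comp mu (measurableT_comp (measurable_mix b r) m2)).
have ih : gam2.-integrable setT (fun w => (h w)%:E).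
  by apply: bounded_integrable mh _ => w; exact: uM.
rewrite {1}/mehler /Rintegral.
have -> : (\int[gam]_y (mehler b r u (mix a s x y))%:E = \int[gam2]_w (h w)%:E)%E.
  apply: etrans (integral12_prod_meas1 ih); apply: eq_integral => y _.
  rewrite /mehler /Rintegral fineK //; apply: integrable_fin_num => //.
  apply: (@bounded_integrable _ _ _ _ M) => //.
  exact: (measurableT_comp mu (measurable_mix2 _ _ _)).
(* If q = 0 the noise cannot be normalised by q, but then r and b s vanish and the integrand is
   constant. *)
congr fine; have [q0|q0] := eqVneq q 0.
  have r0 : r = 0.
    apply/eqP; rewrite -sqrf_eq0; apply/eqP; move: q2; rewrite q0 expr0n /=.
    have := sqr_ge0 r; have : 0 <= sqnorm b * s ^+ 2 by rewrite mulr_ge0 ?addr_ge0 ?sqr_ge0.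
    lra.
  have [b10 b20] : b.1 * s = 0 /\ b.2 * s = 0.
    move: q2; rewrite q0 r0 !expr0n /= addr0 => /esym/eqP.
    rewrite /sqnorm mulrDl -!exprMn paddr_eq0 ?sqr_ge0 // !sqrf_eq0.
    by move=> /andP[/eqP ? /eqP ?].
  transitivity (\int[gam2]_w ((u (mix (mulp a b) 0 x w.1))%:E))%E.
    apply: eq_integral => w _; rewrite /h /mix r0 /mulp /=; congr (u _)%:E; congr pair.
      transitivity (b.1 * (a.1 * x.1 - a.2 * x.2) - b.2 * (a.2 * x.1 + a.1 * x.2)
        + b.1 * s * w.1.1 - b.2 * s * w.1.2); first by ring.
      by rewrite b10 b20; ring.
    transitivity (b.2 * (a.1 * x.1 - a.2 * x.2) + b.1 * (a.2 * x.1 + a.1 * x.2)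
        + b.2 * s * w.1.1 + b.1 * s * w.1.2); first by ring.
    by rewrite b10 b20; ring.
  rewrite q0; apply: (preserves_integral (preserves_proj1 gam gam)
    (f := fun y => (u (mix (mulp a b) 0 x y))%:E)).
  apply/measurable_EFinP; exact: (measurableT_comp mu (measurable_mix2 _ _ _)).
(* [mix beta (r / q)] sends (Y, Z) to (b s Y + r Z) / q, again a standard Gaussian. *)
pose beta := (b.1 * s / q, b.2 * s / q).
have br : sqnorm beta + (r / q) ^+ 2 = 1.
  have -> : sqnorm beta + (r / q) ^+ 2 = (sqnorm b * s ^+ 2 + r ^+ 2) / q ^+ 2.
    by rewrite /sqnorm /beta /=; field.
  by rewrite -q2 divff // sqrf_eq0.
rewrite -(preserves_integral (preserves_mix br)
  (f := fun y => (u (mix (mulp a b) q x y))%:E)); last first.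
  apply/measurable_EFinP; exact: (measurableT_comp mu (measurable_mix2 _ _ _)).
apply: eq_integral => w _; rewrite /h /mix /mulp /beta /=.
by congr (u (_, _))%:E; field.
Qed.

End mehler.

(** * Completeness of L^2 *)

Section L2_complete.
Context d (T : measurableType d) (R : realType) (P : probability T R).
Local Notation W := (LfunType P (lee1n 2)).
Local Notation nm := (hnorm (ipW (P := P))).

Lemma L1_le_nm (w : W) : (\int[P]_x `|w x|%:E <= (nm w)%:E)%E.
Proof.
have [mw wy] := W_L2 w.
have ma : measurable_fun setT (fun x => `|w x|) by exact: measurableT_comp.
have iw : P.-integrable setT (fun x => (`|w x|)%:E).
  by have /integrable_abse := L2_integrable (W_L2 w).
have fw := integrable_fin_num measurableT iw.
rewrite -(fineK fw) lee_fin -ler_sqr ?nnegrE ?sqrtr_ge0 //; last first.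
  by apply: fine_ge0; apply: integral_ge0 => x _; rewrite lee_fin.
rewrite nmW_sqr -lee_fin fineK; last exact: L2r_fin (W_L2 w).
have := jensen_sqr P ma; rewrite /Rintegral.
by under [leRHS]eq_integral do rewrite real_normK ?num_real //.
Qed.

Lemma limn_einf_le (f : (\bar R)^nat) (c : \bar R) N :
  (forall n, (N <= n)%N -> (f n <= c)%E) -> (limn_einf f <= c)%E.
Proof.
move=> h; rewrite limn_einf_lim; apply: lime_le; first exact: is_cvg_einfs.
exists N => // n /= Nn; apply: le_trans (h n Nn).
by apply: ereal_inf_lbound; exists n => //=.
Qed.

(** Riesz-Fischer: a subsequence with summable increments converges almost everywhere, and Fatou
    along it bounds the distance from each late [u m] to the limit. *)
Lemma L2_complete (u : nat -> W) :
  (forall e : R, 0 < e -> exists N, forall m n, (N <= m)%N -> (N <= n)%N ->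
     nm (u m - u n) < e) ->
  exists l, forall e : R, 0 < e -> exists N, forall n, (N <= n)%N -> nm (u n - l) < e.
Proof.
move=> cau.
have half0 k : 0 < 2^-1 ^+ k :> R by rewrite exprn_gt0 // invr_gt0.
have /choice[N hN] : forall k, exists N, forall m n, (N <= m)%N -> (N <= n)%N ->
    nm (u m - u n) < 2^-1 ^+ k.
  by move=> k; exact: cau.
(* The maximum puts [nk k] beyond [N k] and keeps [nk] nondecreasing; the summand k gives
   [k <= nk k], used when [v k] is compared with the whole sequence. *)
pose nk k := (k + \max_(i < k.+1) N i)%N.
have nkS k : (nk k <= nk k.+1)%N by rewrite /nk leq_add // [leqRHS]big_ord_recr /= leq_maxl.
have nkN k : (N k <= nk k)%N by rewrite /nk big_ord_recr /= (leq_trans _ (leq_addl _ _)) // leq_maxr.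
pose v k : W := u (nk k).
have vS k : nm (v k.+1 - v k) < 2^-1 ^+ k.
  by apply: hN; [exact: leq_trans (nkN k) (nkS k)|exact: nkN].
have mv k : measurable_fun setT (v k : T -> R) by have [] := W_L2 (v k).
pose D k x : \bar R := `|v k.+1 x - v k x|%:E.
have mD k : measurable_fun setT (D k).
  by apply/measurable_EFinP; apply: measurableT_comp => //; exact: measurable_funB.
have iD k : (\int[P]_x D k x <= (2^-1 ^+ k)%:E)%E.
  by apply: le_trans (L1_le_nm (v k.+1 - v k)) _; rewrite lee_fin ltW.
have D0 k x : (0 <= D k x)%E by rewrite lee_fin.
(* The total variation of the subsequence at x. Its integral is at most a geometric sum, hence it is
   finite almost everywhere, and there the subsequence converges. *)
pose S x := (\sum_(k <oo) D k x)%E.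
have iS : (\int[P]_x S x < +oo)%E.
  rewrite integral_nneseries //.
  apply: (@le_lt_trans _ _ (\sum_(k <oo) (2^-1 ^+ k)%:E)%E).
    by apply: lee_nneseries => // k _ _; apply: integral_ge0.
  have := @cvg_geometric_eseries_half R 2 0.
  have -> : (fun k => (2 / (2 ^ (k + 1))%:R)%:E) = (fun k => (2^-1 ^+ k)%:E) :> (nat -> \bar R).
    apply/funext => k; rewrite addn1 expnS natrM natrX exprVn invfM mulrA divff ?mul1r //.
  move=> /cvg_lim; rewrite -[X in limn X]/(fun n => _) => h.
  by rewrite h // ltry.
have mS : measurable_fun setT S by exact: ge0_emeasurable_sum.
have S0 x : (0 <= S x)%E by apply: nneseries_ge0.
have Sae : {ae P, forall x, (S x < +oo)%E}.
  have : P.-integrable setT S.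
    by apply/integrableP; split => //; under eq_integral do rewrite gee0_abs //.
  move=> /integrable_ae => /(_ measurableT); apply: filterS => x /(_ I).
  by rewrite ge0_fin_numE.
have cvgx x : (S x < +oo)%E -> cvgn (fun k => v k x).
  move=> Sx.
  have c1 : cvgn [normed series (telescope (fun k => v k x))].
    apply: nondecreasing_is_cvgn.
      by apply: nondecreasing_series => k _ _; rewrite normr_ge0.
    exists (fine (S x)) => _ [n _ <-].
    rewrite -lee_fin fineK ?ge0_fin_numE //.
    apply: le_trans (nneseries_lim_ge n _); last by move=> k _ _; exact: D0.
    by rewrite /normed_series_of seriesEnat /= -sumEFin.
  have := normed_cvg c1; rewrite telescopeK => c2.
  have -> : (fun k => v k x) = (fun k => [sequence v n x - v 0%N x]_n k + v 0%N x).
    by apply/funext => k /=; rewrite subrK.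
  by apply: is_cvgD => //; exact: is_cvg_cst.
(* An upper limit rather than a limit, so that l is measurable on the whole space, including the
   points of divergence. *)
pose l x : R := fine (limn_esup (fun k => (v k x)%:E)).
have ml : measurable_fun setT l.
  have mfine : measurable_fun setT (@fine R) by [].
  apply: (measurableT_comp mfine); apply: measurable_fun_limn_esup => k.
  exact/measurable_EFinP.
have lE x : (S x < +oo)%E -> (fun k => v k x) @ \oo --> l x.
  move=> /cvgx c; suff -> : l x = limn (fun k => v k x) by [].
  rewrite /l is_cvg_limn_esupE; last by apply/cvg_ex; exists (limn (fun k => v k x))%:E;
    apply: cvg_EFin => //; exact: nearW.
  by rewrite EFin_lim.
have key m (e : R) K : (forall k, (K <= k)%N -> nm (u m - v k) <= e) ->
    (\int[P]_x ((u m x - l x) ^+ 2)%:E <= (e ^+ 2)%:E)%E.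
  move=> hk; have [mum _] := W_L2 (u m).
  pose f k x : \bar R := ((u m x - v k x) ^+ 2)%:E.
  have mf k : measurable_fun setT (f k).
    by apply/measurable_EFinP; apply: measurable_funX; exact: measurable_funB.
  have f0 k x : setT x -> (0 <= f k x)%E by rewrite lee_fin sqr_ge0.
  have <- : (\int[P]_x limn_einf (f ^~ x) = \int[P]_x ((u m x - l x) ^+ 2)%:E)%E.
    apply: ae_eq_integral => //.
    - have mo : measurable_fun setT (-%E : \bar R -> \bar R) by [].
      apply: (measurableT_comp mo).
      apply: (measurable_fun_limn_esup (f := fun k x => (- f k x)%E)) => k.
      exact: (measurableT_comp mo).
    - by apply/measurable_EFinP; apply: measurable_funX; exact: measurable_funB.
    apply: filterS Sae => x /lE vl _.
    have c : f ^~ x @ \oo --> ((u m x - l x) ^+ 2)%:E.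
      apply: cvg_EFin; first exact: nearW.
      have c0 : (fun k => u m x - v k x) @ \oo --> u m x - l x.
        by apply: cvgB => //; exact: cvg_cst.
      exact: (cvgM c0 c0).
    rewrite is_cvg_limn_einfE; first exact: cvg_lim c.
    by apply/cvg_ex; eexists; exact: c.
  apply: le_trans (fatou P measurableT mf f0) _.
  apply: (limn_einf_le (N := K)) => k Kk.
  have := hk k Kk; rewrite -ler_sqr ?nnegrE ?sqrtr_ge0 //; last first.
    exact: le_trans (sqrtr_ge0 _) (hk k Kk).
  rewrite nmW_sqr -lee_fin fineK //; exact: L2r_fin (W_L2 (u m - v k)).
have uvk (e : R) : 0 < e -> exists N0, forall m, (N0 <= m)%N ->
    (\int[P]_x ((u m x - l x) ^+ 2)%:E <= (e ^+ 2)%:E)%E.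
  move=> e0; have [N0 hN0] := cau e e0; exists N0 => m N0m.
  apply: (key m e N0) => k N0k; apply/ltW/hN0 => //.
  by rewrite (leq_trans N0k) // /nk leq_addr.
have hl : L2r P l.
  have [N0 /(_ _ (leqnn N0)) h] := uvk 1 ltr01.
  have hd : L2r P (fun x => u N0 x - l x).
    split; first by apply: measurable_funB => //; case: (W_L2 (u N0)).
    by apply: le_lt_trans h _; rewrite ltry.
  have -> : l = (u N0 - toW P (fun x => u N0 x - l x) : W).
    by apply/funext => x; rewrite valWB toWE // subKr.
  exact: W_L2.
exists (toW P l) => e e0.
have [N0 hN0] := uvk (e / 2) (divr_gt0 e0 (ltr0n R 2)); exists N0 => n N0n.
apply: (@le_lt_trans _ _ (e / 2)); last lra.
rewrite -ler_sqr ?nnegrE ?sqrtr_ge0 //; last lra.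
rewrite nmW_sqr -lee_fin fineK; last exact: L2r_fin (W_L2 _).
by apply: le_trans (hN0 n N0n); rewrite valWB toWE.
Qed.

End L2_complete.

(** * Measurability of continuous functions of two variables *)

Section measurable_continuous2.
Context {R : realType}.

(* f(x, y) is the limit of f(floor(nx)/n, y), which depends on x through countably
   many values. *)
Lemma measurable_continuous2 (f : pt R -> R) : continuous f ->
  measurable_fun setT (f : mpt R -> R).
Proof.
move=> cf.
pose N n : R := n.+1%:R.
have N0 n : 0 < N n by rewrite ltr0n.
pose g n (x : R) : R := (Num.floor (N n * x))%:~R / N n.
pose h n (z : mpt R) : R := f (g n z.1, z.2).
apply: (measurable_fun_cvg (h := h)) => [n|[x y] _].
  move=> _ Y mY; rewrite setTI.
  have -> : h n @^-1` Y = \bigcup_(k : int)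
     ([set x | Num.floor (N n * x) = k] `*` [set y | Y (f (k%:~R / N n, y))]).
    apply/seteqP; split => [[x y] /= Yh|[x y] [k _ [/= <-]]] //.
    by exists (Num.floor (N n * x)).
  apply: countable_bigcupT_measurable => // k; apply: measurableX.
    have -> : [set x | Num.floor (N n * x) = k] = `[k%:~R / N n, (k + 1)%:~R / N n[%classic.
      apply/seteqP; split => x /=; rewrite in_itv /= ler_pdivrMr // ltr_pdivlMr // mulrC.
        by move=> <-; apply: real_floor_itv; exact: num_real.
      exact: floor_def.
    exact: measurable_itv.
  have cy : continuous (fun y : R => f (k%:~R / N n, y)).
    move=> y; apply: continuous_comp; last exact: cf.
    exact: (cvg_pair (cvg_cst _) cvg_id).
  have := continuous_measurable_fun cy measurableT mY; by rewrite setTI.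
have gx : g ^~ x @ \oo --> x.
  apply/cvgrPdist_le => e e0.
  near=> n.
  have /andP[h1 h2] : (Num.floor (N n * x))%:~R <= N n * x < (Num.floor (N n * x) + 1)%:~R.
    by apply: real_floor_itv; exact: num_real.
  have h3 : g n x <= x by rewrite /g ler_pdivrMr // [x * _]mulrC.
  have h4 : x - g n x <= (N n)^-1.
    have : x < (Num.floor (N n * x) + 1)%:~R / N n by rewrite ltr_pdivlMr // [x * _]mulrC.
    by rewrite intrD mulrDl mulr1z mul1r -/(g n x) lerBlDl => /ltW.
  rewrite ger0_norm ?subr_ge0 //; apply: le_trans h4 _.
  rewrite invf_ple ?posrE //.
  near: n; exists (Num.truncn e^-1) => // n /= en.
  by rewrite ltW // (lt_le_trans (truncnS_gt _)) // ler_nat ltnS.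
have : (fun n => (g n x, y) : pt R) @ \oo --> ((x, y) : pt R).
  exact: (cvg_pair gx (cvg_cst _)).
move/(cvg_comp _ _); apply; exact: cf.
Unshelve. all: by end_near. Qed.

End measurable_continuous2.

Lemma cvge0_lt (R : realType) (f : (\bar R)^nat) (e : R) :
  f @ \oo --> 0%E -> 0 < e -> exists n, (f n < e%:E)%E.
Proof.
move=> /fine_cvgP[[N1 _ h1] /cvgrPdist_lt h] e0; have [N2 _ h2] := h e e0.
exists (maxn N1 N2); rewrite -(fineK (h1 _ (leq_maxl N1 N2))) lte_fin.
have := h2 _ (leq_maxr N1 N2); rewrite /= sub0r normrN.
exact: le_lt_trans (ler_norm _).
Qed.

(** * Approximation in L^1 by a linear class of functions *)

Section L1_approximation.
Context d (T : measurableType d) (R : realType) (P : probability T R).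
Variable C : (T -> R) -> Prop.
Hypothesis C_measurable : forall f, C f -> measurable_fun setT f.
Hypothesis C_linear : forall a b f g, C f -> C g -> C (fun x => a * f x + b * g x).
Hypothesis C_1 : C (cst 1).
Implicit Types u v w f g : T -> R.

Definition dist1 u v : \bar R := (\int[P]_x `|u x - v x|%:E)%E.

Definition L1_closure u :=
  measurable_fun setT u /\ forall e : R, 0 < e -> exists2 f, C f & (dist1 u f < e%:E)%E.

Let mdist u v : measurable_fun setT u -> measurable_fun setT v ->
  measurable_fun setT (fun x => `|u x - v x|%:E).
Proof.
by move=> mu mv; apply/measurable_EFinP; apply: measurableT_comp => //; exact: measurable_funB.
Qed.

Lemma dist1_comb (a b : R) u v f g : measurable_fun setT u -> measurable_fun setT v ->
  measurable_fun setT f -> measurable_fun setT g ->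
  (dist1 (fun x => a * u x + b * v x)%R (fun x => a * f x + b * g x)%R <=
   `|a|%:E * dist1 u f + `|b|%:E * dist1 v g)%E.
Proof.
move=> mu mv mf mg; have m1 := mdist mu mf; have m2 := mdist mv mg.
rewrite /dist1 -!ge0_integralZl //; do 2?[by move=> x _; rewrite lee_fin].
rewrite -ge0_integralD //; do ?[exact: measurable_funeM].
apply: ge0_le_integral => //.
- apply: mdist; apply: measurable_funD; exact: measurable_funM.
- by apply: emeasurable_funD; exact: measurable_funeM.
move=> x _; rewrite -!EFinM -EFinD lee_fin -!normrM.
apply: le_trans (ler_normD _ _); rewrite (_ : _ - _ = a * (u x - f x) + b * (v x - g x)) //.
by ring.
Qed.

Lemma dist1_tri v u w : measurable_fun setT u -> measurable_fun setT v ->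
  measurable_fun setT w -> (dist1 u w <= dist1 u v + dist1 v w)%E.
Proof.
move=> mu mv mw; have m1 := mdist mu mv; have m2 := mdist mv mw.
rewrite /dist1 -ge0_integralD //.
apply: ge0_le_integral => //; [exact: mdist|exact: emeasurable_funD|].
move=> x _; rewrite -EFinD lee_fin.
by rewrite -[u x - w x](subrKA (v x)) ler_normD.
Qed.

Lemma L1_closure_linear a b u v : L1_closure u -> L1_closure v ->
  L1_closure (fun x => a * u x + b * v x).
Proof.
move=> [mu hu] [mv hv]; split.
  by apply: measurable_funD; exact: measurable_funM.
move=> e e0.
have q0 (c : R) : 0 < e / (2 * (`|c| + 1)).
  by rewrite divr_gt0 // mulr_gt0 // ltr_wpDl.
have [f Cf uf] := hu _ (q0 a); have [g Cg vg] := hv _ (q0 b).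
exists (fun x => a * f x + b * g x); first exact: C_linear.
apply: le_lt_trans (dist1_comb a b mu mv (C_measurable Cf) (C_measurable Cg)) _.
have bnd (c : R) (z : \bar R) : (z < (e / (2 * (`|c| + 1)))%:E)%E -> (0 <= z)%E ->
    (`|c|%:E * z <= (e / 2 * (`|c| / (`|c| + 1)))%:E)%E.
  move=> zc z0; rewrite (_ : e / 2 * _ = `|c| * (e / (2 * (`|c| + 1)))); last first.
    by field; have := normr_ge0 c; lra.
  by rewrite EFinM; apply: lee_wpmul2l; rewrite ?lee_fin // ltW.
have d0 p q : (0 <= dist1 p q)%E by apply: integral_ge0 => x _; rewrite lee_fin.
have lt1 (c : R) : `|c| / (`|c| + 1) < 1.
  have c1 : 0 < `|c| + 1 by rewrite ltr_wpDl.
  by rewrite ltr_pdivrMr // mul1r ltrDl.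
apply: le_lt_trans (leeD (bnd _ _ uf (d0 _ _)) (bnd _ _ vg (d0 _ _))) _.
rewrite -EFinD lte_fin -mulrDr.
have := lt1 a; have := lt1 b => h1 h2.
have : e / 2 * (`|a| / (`|a| + 1) + `|b| / (`|b| + 1)) < e / 2 * 2 by rewrite ltr_pM2l; lra.
lra.
Qed.

Lemma C_L1_closure f : C f -> L1_closure f.
Proof.
move=> Cf; split=> [|e e0]; first exact: C_measurable.
exists f => //; rewrite /dist1; under eq_integral do rewrite subrr normr0.
by rewrite integral0 lte_fin.
Qed.

Lemma L1_closure_closed u : measurable_fun setT u ->
  (forall e : R, 0 < e -> exists2 v, L1_closure v & (dist1 u v < e%:E)%E) ->
  L1_closure u.
Proof.
move=> mu h; split=> // e e0; have e2 : 0 < e / 2 by lra.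
have [v [mv hv] uv] := h _ e2; have [f Cf vf] := hv _ e2.
exists f => //; apply: le_lt_trans (dist1_tri mu mv (C_measurable Cf)) _.
by rewrite (_ : e = e / 2 + e / 2) ?EFinD ?lteD //; lra.
Qed.

Lemma L1_closure_cst c : L1_closure (cst c).
Proof.
have := L1_closure_linear c 0 (C_L1_closure C_1) (C_L1_closure C_1).
by congr L1_closure; apply/funext => x /=; rewrite mulr1 mul0r addr0.
Qed.

Lemma L1_closure_sum (I : eqType) (s : seq I) (c : I -> R) (F : I -> T -> R) :
  (forall i, i \in s -> L1_closure (F i)) ->
  L1_closure (fun x => \sum_(i <- s) c i * F i x).
Proof.
elim: s => [|i s IH] h.
  have := L1_closure_cst 0; congr L1_closure; apply/funext => x.
  by rewrite big_nil.
have := L1_closure_linear (c i) 1 (h i (mem_head _ _))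
  (IH (fun j js => h j (mem_behead (s := i :: s) js))).
by congr L1_closure; apply/funext => x; rewrite big_cons mul1r.
Qed.

(** The sets with approximable indicator form a Dynkin class: complements come from linearity,
    disjoint unions from linearity and continuity of P. The pi-lambda theorem then reduces
    everything to G. *)
Lemma L1_closure_measurable_set (G : set (set T)) : measurable = <<s G >> -> setI_closed G ->
  (forall A, G A -> L1_closure \1_A) -> forall A, measurable A -> L1_closure \1_A.
Proof.
move=> mG IG hG A; rewrite mG; apply: (dynkin_induction (P := fun A => L1_closure \1_A)) => //.
- have := L1_closure_cst 1; congr L1_closure; apply/funext => x.
  by rewrite indicE mem_set.
- move=> B mB hB; have := L1_closure_linear (-1) 1 hB (L1_closure_cst 1).
  congr L1_closure; apply/funext => x; rewrite !indicE in_setC /=.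
  by case: (x \in B) => /=; ring.
move=> F mF tF hF.
have mU : measurable (\bigcup_k F k) by exact: bigcup_measurable.
apply: L1_closure_closed => [|e e0]; first exact: measurable_indic.
(* By disjointness the indicator of a partial union is a sum of indicators; its L^1 distance to the
   full union is the measure of what remains. *)
pose V n := \big[setU/set0]_(i < n.+1) F i.
have mV n : measurable (V n) by exact: bigsetU_measurable.
have VU n : V n `<=` \bigcup_k F k by exact: bigsetU_bigcup.
have hV n : L1_closure \1_(V n).
  elim: n => [|n IH].
    by rewrite /V big_ord1.
  have := L1_closure_linear 1 1 IH (hF n.+1); congr L1_closure; apply/funext => x.
  rewrite !mul1r {2}/V big_ord_recr /= -/(V n) !indicE in_setU.
  have [xV|xV] := boolP (x \in V n); have [xF|xF] := boolP (x \in F n.+1);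
    rewrite /= ?addr0 ?add0r //.
  exfalso; move: xV xF; rewrite !inE /V -bigcup_mkord => -[k /= kn Fkx] Fnx.
  have kn' : k = n.+1 by apply: (tF k n.+1) => //; exists x.
  by move: kn; rewrite kn' ltnn.
have cP : (fun n => P (V n)) @ \oo --> P (\bigcup_k F k).
  rewrite -[\bigcup_k F k]bigcup_bigsetU_bigcup; apply: nondecreasing_cvg_mu => //.
    exact: bigcup_measurable.
  move=> m n mn; apply/subsetPset; rewrite /V -!bigcup_mkord => x [k /= km Fkx].
  by exists k => //=; exact: leq_trans km _.
have [n hn] : exists n, (P (\bigcup_k F k) - P (V n) < e%:E)%E.
  have fP (B : set T) : measurable B -> P B \is a fin_num by move=> mB; exact: fin_num_measure.
  have cP' : (fun n => P (V n)) @ \oo --> (fine (P (\bigcup_k F k)))%:E by rewrite fineK ?fP.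
  have /fine_cvgP[_ /cvgrPdist_lt hc] := cP'.
  have [n _ /(_ n (leqnn n)) /= hn] := hc e e0.
  exists n; rewrite -(fineK (fP _ mU)) -(fineK (fP _ (mV n))) -EFinB lte_fin.
  exact: le_lt_trans (ler_norm _) hn.
exists \1_(V n) => //; apply: le_lt_trans hn.
rewrite -[X in (_ - P X)%E](setIidr (VU n)) -measureD //; last first.
  by rewrite -ge0_fin_numE // fin_num_measure.
have mD : measurable (\bigcup_k F k `\` V n) by exact: measurableD.
have := integral_indic P measurableT mD; rewrite setIT => h.
apply: (@le_trans _ _ (\int[P]_x (\1_(\bigcup_k F k `\` V n) x)%:E)%E); last by rewrite h.
apply: ge0_le_integral => //.
- by apply: mdist; exact: measurable_indic.
- by apply/measurable_EFinP; exact: measurable_indic.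
move=> x _; rewrite lee_fin !indicE in_setD.
have [xV|xV] := boolP (x \in V n).
  have -> : x \in \bigcup_k F k by apply/mem_set/(VU n)/set_mem.
  by rewrite subrr normr0.
by rewrite subr0 andbT ger0_norm.
Qed.

Import HBSimple.

Lemma L1_closure_integrable (G : set (set T)) : measurable = <<s G >> -> setI_closed G ->
  (forall A, G A -> L1_closure \1_A) ->
  forall u, P.-integrable setT (fun x => (u x)%:E) -> L1_closure u.
Proof.
move=> mG IG hG u iu.
have hA := L1_closure_measurable_set mG IG hG.
have mu : measurable_fun setT u by apply/measurable_EFinP; exact: measurable_int iu.
apply: L1_closure_closed => // e e0.
have [g [ig _ gu]] := approximation_sfun_integrable measurableT iu.
have [n hn] : exists n, (dist1 u (g n) < e%:E)%E.
  have [n hn] := cvge0_lt gu e0; exists n; apply: le_lt_trans hn.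
  by rewrite /dist1.
exists (g n) => //.
have -> : (g n : T -> R) = (fun x => \sum_(i <- finmap.enum_fset (fset_set (range (g n))))
    i * \1_(g n @^-1` [set i]) x).
  by apply/funext => x; rewrite [LHS]fimfunE fsbig_finite.
by apply: (L1_closure_sum id) => y _; exact: hA.
Qed.

End L1_approximation.

Lemma dominated_cvg_real d (T : measurableType d) (R : realType) (P : probability T R)
  (f : nat -> T -> R) (l g : T -> R) :
  (forall n, measurable_fun setT (f n)) -> measurable_fun setT l ->
  (forall x, f ^~ x @ \oo --> l x) -> P.-integrable setT (fun x => (g x)%:E) ->
  (forall n x, `|f n x| <= g x) ->
  (fun n => \int[P]_x (f n x)%:E)%E @ \oo --> (\int[P]_x (l x)%:E)%E.
Proof.
move=> mf ml fl ig fg.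
have [] := @dominated_convergence _ _ _ P setT measurableT
  (fun n x => (f n x)%:E) (fun x => (l x)%:E) (fun x => (g x)%:E) => //.
- by move=> n; exact/measurable_EFinP.
- exact/measurable_EFinP.
- by apply/aeW => x _; apply: cvg_EFin; [exact: nearW|exact: fl].
- by apply/aeW => x n _; rewrite lee_fin.
Qed.

(** * Truncation, and density of bounded continuous functions in L^2(gamma) *)

Section clamp.
Context {R : realType}.
Definition clamp (M t : R) : R := Num.max (- M) (Num.min M t).

Lemma clamp_bound M t : 0 <= M -> `|clamp M t| <= M.
Proof.
move=> M0; rewrite /clamp ler_norml le_max lexx /= ge_max ge_min lexx /= andbT; lra.
Qed.

Lemma clamp_id M t : `|t| <= M -> clamp M t = t.
Proof. by rewrite ler_norml => /andP[h1 h2]; rewrite /clamp (min_idPr h2) (max_idPr h1). Qed.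

(** Projecting t onto [-M, M] cannot move it away from a point s of that interval. *)
Lemma clamp_dist M s t : `|s| <= M -> `|s - clamp M t| <= `|s - t|.
Proof.
rewrite ler_norml => /andP[h1 h2]; rewrite /clamp.
case: (leP M t) => h3.
  have -> : Num.max (- M) M = M by apply/max_idPr; lra.
  by rewrite !ler0_norm; lra.
case: (leP (- M) t) => h4 //.
by rewrite !ger0_norm; lra.
Qed.

Lemma continuous_clamp M : continuous (clamp M).
Proof.
move=> t; apply: (continuous_max (f := fun=> - M) (g := fun t => Num.min M t)).
  exact: cvg_cst.
apply: (continuous_min (f := fun=> M) (g := fun t => t)); [exact: cvg_cst|exact: cvg_id].
Qed.

Lemma measurable_clamp d (T : measurableType d) M (u : T -> R) :
  measurable_fun setT u -> measurable_fun setT (fun x => clamp M (u x)).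
Proof.
move=> mu; apply: (measurable_maxr (f := fun=> - M) (g := fun x => Num.min M (u x))) => //.
exact: (measurable_minr (f := fun=> M)).
Qed.
End clamp.

Section density.
Context {R : realType}.
Local Notation gam := (gam R).

Definition bcont1 (f : measurableTypeR R -> R) :=
  continuous (f : R -> R) /\ exists M, forall x, `|f x| <= M.
Definition bcont2 (f : mpt R -> R) :=
  continuous (f : pt R -> R) /\ exists M, forall x, `|f x| <= M.

Lemma bcont1_measurable f : bcont1 f -> measurable_fun setT f.
Proof. by case=> cf _; exact: (continuous_measurable_fun cf). Qed.

Lemma bcont2_measurable f : bcont2 f -> measurable_fun setT f.
Proof. by case=> cf _; exact: measurable_continuous2. Qed.

Lemma bounded_comb (T : Type) (a b : R) (f g : T -> R) :
  (exists M, forall x, `|f x| <= M) -> (exists M, forall x, `|g x| <= M) ->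
  exists M, forall x, `|a * f x + b * g x| <= M.
Proof.
move=> [M fM] [M' gM]; exists (`|a| * M + `|b| * M') => x.
by apply: le_trans (ler_normD _ _) _; rewrite !normrM lerD // ler_wpM2l.
Qed.

Lemma continuous_comb (T : topologicalType) (a b : R) (f g : T -> R) :
  continuous f -> continuous g -> continuous (fun x => a * f x + b * g x).
Proof.
move=> cf cg x; apply: cvgD; apply: cvgM => //; [exact: cvg_cst|exact: cf|exact: cvg_cst|exact: cg].
Qed.

Lemma bcont1_linear a b f g : bcont1 f -> bcont1 g -> bcont1 (fun x => a * f x + b * g x).
Proof. by move=> [cf bf] [cg bg]; split; [exact: continuous_comb|exact: bounded_comb]. Qed.

Lemma bcont2_linear a b f g : bcont2 f -> bcont2 g -> bcont2 (fun x => a * f x + b * g x).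
Proof. by move=> [cf bf] [cg bg]; split; [exact: continuous_comb|exact: bounded_comb]. Qed.

Lemma bcont1_cst c : bcont1 (cst c).
Proof. by split; [move=> x; exact: cvg_cst|exists `|c|]. Qed.

Lemma bcont2_cst c : bcont2 (cst c).
Proof. by split; [move=> x; exact: cvg_cst|exists `|c|]. Qed.

(** Approximation by ramps that rise from 0 to 1 on [a, a + 1/n]; at each point they are eventually
    equal to the indicator of the open ray. *)
Lemma L1_closure_ray a : L1_closure (gauss1 R) bcont1 \1_(`]a, +oo[%classic).
Proof.
have mA : measurable (`]a, +oo[%classic : set (measurableTypeR R)) by exact: measurable_itv.
split=> [|e e0]; first exact: measurable_indic.
pose f n x : R := clamp 1 (n%:R * Num.max 0 (x - a)).
have bf n : bcont1 (f n).
  split; last by exists 1 => x; rewrite clamp_bound.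
  move=> x; apply: (continuous_comp (f := fun x : R => n%:R * Num.max 0 (x - a))
    (g := clamp 1)); last exact: continuous_clamp.
  apply: cvgM; first exact: cvg_cst.
  apply: (continuous_max (f := fun=> 0) (g := fun x => x - a)); first exact: cvg_cst.
  by apply: cvgB; [exact: cvg_id|exact: cvg_cst].
have [n hn] : exists n, (dist1 (gauss1 R) \1_(`]a, +oo[%classic) (f n) < e%:E)%E.
  apply: cvge0_lt e0.
  rewrite -[X in _ --> X](integral0 (gauss1 R) setT).
  apply: (dominated_cvg_real (l := fun=> 0) (g := fun=> 2)).
  - move=> n; apply: measurableT_comp => //; apply: measurable_funB.
      exact: measurable_indic.
    exact: bcont1_measurable.
  - exact: measurable_cst.
  - move=> x; apply: cvg_near_cst; rewrite indicE.
    have [ax|xa] := ltP a x; last first.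
      apply: nearW => n; rewrite memNset /= ?in_itv /= ?andbT; last by apply/negP; rewrite -leNgt.
      by rewrite /f (max_idPl _) ?subr_le0 // mulr0 clamp_id ?normr0 // subrr normr0.
    exists (Num.truncn (x - a)^-1).+1 => // n /= nx.
    have xa0 : 0 < x - a by rewrite subr_gt0.
    have h1 : 1 <= n%:R * (x - a).
      rewrite -ler_pdivrMr // mul1r ltW //; apply: lt_le_trans (truncnS_gt _) _.
      by rewrite ler_nat.
    rewrite mem_set /= ?in_itv /= ?ax // /f (max_idPr _) ?ltW // /clamp.
    by rewrite (min_idPl h1) (max_idPr _) ?subrr ?normr0 //; lra.
  - exact: finite_measure_integrable_cst.
  - move=> n x; rewrite normr_id; apply: le_trans (ler_normB _ _) _.
    rewrite (_ : 2 = 1 + 1) // lerD ?clamp_bound // indicE.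
    by case: (_ \in _); rewrite ?normr1 ?normr0.
by exists (f n).
Qed.

Lemma L1_closure1 A : measurable A -> L1_closure (gauss1 R) bcont1 \1_A.
Proof.
apply: (L1_closure_measurable_set bcont1_measurable bcont1_linear (bcont1_cst 1)
  (G := RGenOInfty.G (R := R))).
- exact: RGenOInfty.measurableE.
- move=> _ _ [x ->] [y ->]; exists (Num.max x y).
  apply/seteqP; split => z /=; rewrite !in_itv /= !andbT gt_max.
    by move=> [-> ->].
  by move=> /andP[].
- by move=> _ [a ->]; exact: L1_closure_ray.
Qed.

Lemma preserves_gam1 : preserves gam (gauss1 R) fst.
Proof.
split=> [|f mf f0]; first exact: measurable_fst.
have mf1 : measurable_fun setT (fun w : mpt R => f w.1).
  by apply: measurableT_comp mf _; exact: measurable_fst.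
apply: (etrans (gam_tonelli mf1 (fun w => f0 _))); apply: eq_integral => x _ /=.
apply: (etrans (integral_cst (gauss1 R) measurableT (f x))).
exact: etrans (congr1 (mule (f x)) (probability_setT (gauss1 R))) (mule1 _).
Qed.

Lemma preserves_gam2 : preserves gam (gauss1 R) snd.
Proof.
split=> [|f mf f0]; first exact: measurable_snd.
have mf1 : measurable_fun setT (fun w : mpt R => f w.2).
  by apply: measurableT_comp mf _; exact: measurable_snd.
apply: (etrans (gam_tonelli mf1 (fun w => f0 _))) => /=.
apply: (etrans (integral_cst (gauss1 R) measurableT _)).
exact: etrans (congr1 (mule _) (probability_setT (gauss1 R))) (mule1 _).
Qed.

Lemma L1_closure_rectangle (A B : set (measurableTypeR R)) : measurable A -> measurable B ->
  L1_closure gam bcont2 \1_(A `*` B).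
Proof.
move=> mA mB; split=> [|e e0]; first by apply: measurable_indic; exact: measurableX.
have [_ hA] := L1_closure1 mA; have [_ hB] := L1_closure1 mB.
have e2 : 0 < e / 2 by lra.
have [f bf hf] := hA _ e2; have [cf [K0 fK0]] := bf.
(* In 1_A 1_B - f g = (1_A - f) 1_B + f (1_B - g) the bound K of f multiplies the error of g, so f
   is chosen first and g within [e / 2 / K]. The added 1 makes K positive. *)
pose K := K0 + 1; have K0' : 0 <= K0 by apply: le_trans (normr_ge0 _) (fK0 0).
have Kp : 0 < K by rewrite /K; lra.
have fK x : `|f x| <= K by apply: le_trans (fK0 x) _; rewrite /K; lra.
have [g bg hg] := hB _ (divr_gt0 e2 Kp); have [cg [L gL]] := bg.
exists (fun z => f z.1 * g z.2).
  split; last first.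
    exists (K * L) => z; rewrite normrM ler_pM //.
  move=> z; apply: cvgM.
    by apply: (continuous_comp (f := fst)); [exact: cvg_fst|exact: cf].
  by apply: (continuous_comp (f := snd)); [exact: cvg_snd|exact: cg].
have mf := bcont1_measurable bf; have mg := bcont1_measurable bg.
have m1 : measurable_fun setT (fun x : measurableTypeR R => `|\1_A x - f x|%:E).
  apply/measurable_EFinP; apply: measurableT_comp => //.
  by apply: measurable_funB; [exact: measurable_indic|].
have m2 : measurable_fun setT (fun x : measurableTypeR R => `|\1_B x - g x|%:E).
  apply/measurable_EFinP; apply: measurableT_comp => //.
  by apply: measurable_funB; [exact: measurable_indic|].
have m1' : measurable_fun setT (fun z : mpt R => `|\1_A z.1 - f z.1|%:E).
  exact: (measurableT_comp m1 measurable_fst).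
have m2' : measurable_fun setT (fun z : mpt R => `|\1_B z.2 - g z.2|%:E).
  exact: (measurableT_comp m2 measurable_snd).
have m2K : measurable_fun setT (fun z : mpt R => (K%:E * `|\1_B z.2 - g z.2|%:E)%E).
  exact: measurable_funeM.
have n0 (r : R) : (0 <= `|r|%:E)%E by rewrite lee_fin.
apply: (@le_lt_trans _ _ (\int[gam]_z (`|\1_A z.1 - f z.1|%:E
   + K%:E * `|\1_B z.2 - g z.2|%:E))%E).
  apply: ge0_le_integral => //.
  - apply/measurable_EFinP; apply: measurableT_comp => //; apply: measurable_funB.
      by apply: measurable_indic; exact: measurableX.
    apply: measurable_funM; [exact: (measurableT_comp mf measurable_fst)|
      exact: (measurableT_comp mg measurable_snd)].
  - exact: emeasurable_funD.
  - move=> [x y] _ /=; rewrite -EFinM -EFinD lee_fin.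
    have -> : \1_(A `*` B) (x, y) = \1_A x * \1_B y :> R.
      by rewrite !indicE in_setX -natrM mulnb.
    rewrite (_ : _ - _ = (\1_A x - f x) * \1_B y + f x * (\1_B y - g y)); last by ring.
    apply: le_trans (ler_normD _ _) _; rewrite !normrM; apply: lerD.
      rewrite ler_piMr // indicE; by case: (_ \in _); rewrite ?normr1 ?normr0.
    by rewrite ler_wpM2r.
rewrite ge0_integralD //; last by move=> z _; rewrite mule_ge0 // lee_fin ltW.
rewrite (ge0_integralZl _ measurableT m2') //; last by rewrite lee_fin ltW.
rewrite (preserves_gam1.2 _ m1) // (preserves_gam2.2 _ m2) //.
have -> : e%:E = (e / 2 + e / 2)%:E by congr EFin; lra.
rewrite [ltRHS]EFinD; apply: lteD; first exact: hf.
have -> : (e / 2)%:E = (K%:E * (e / 2 / K)%:E)%E.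
  by rewrite -EFinM; congr EFin; rewrite [RHS]mulrC divfK // gt_eqF.
by rewrite lte_pmul2l ?lte_fin //; exact: hg.
Qed.

Lemma bcont2_L1_dense u : gam.-integrable setT (fun x => (u x)%:E) -> L1_closure gam bcont2 u.
Proof.
apply: (L1_closure_integrable bcont2_measurable bcont2_linear (bcont2_cst 1)
  (G := [set A `*` B | A in measurable & B in measurable])).
- exact: measurable_prod_measurableType.
- move=> _ _ [A mA [B mB <-]] [A' mA' [B' mB' <-]]; rewrite -setXI.
  by exists (A `&` A'); [exact: measurableI|exists (B `&` B') => //; exact: measurableI].
- by move=> _ [A mA [B mB <-]]; exact: L1_closure_rectangle.
Qed.

Local Notation W := (LfunType gam (lee1n 2)).
Local Notation nm := (hnorm (ipW (P := gam))).

Lemma bcont2_L2 f : bcont2 f -> L2r gam f.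
Proof. by move=> bf; have [_ [M fM]] := bf; apply: L2_bounded fM; exact: bcont2_measurable. Qed.

Lemma nmW_lt (u : W) (e : R) : 0 < e ->
  (\int[gam]_x ((u x) ^+ 2)%:E < (e ^+ 2)%:E)%E -> nm u < e.
Proof.
move=> e0 h; rewrite -ltr_sqr ?nnegrE ?sqrtr_ge0 ?ltW // nmW_sqr -lte_fin fineK //.
exact: L2r_fin (W_L2 u).
Qed.

(** From L^1 to L^2: u is first truncated, and for functions v and g bounded by M one has |v - g|^2
    <= 2 M |v - g|, so closeness in L^1 suffices. *)
Lemma bcont2_dense (u : W) (e : R) : 0 < e ->
  exists2 f, bcont2 f & nm (u - toW gam f) < e.
Proof.
move=> e0; have e2 : 0 < e / 2 by lra.
have [mu _] := W_L2 u; have iu := L2_sqr_integrable (W_L2 u).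
pose v n x := clamp n%:R (u x).
have mv n : measurable_fun setT (v n) by exact: measurable_clamp.
have hv n : L2r gam (v n) by apply: (@L2_bounded _ _ _ _ _ n%:R) => // x; exact: clamp_bound.
have [n hn] : exists n, nm (u - toW gam (v n)) < e / 2.
  have [n hn] : exists n, (\int[gam]_x ((u x - v n x) ^+ 2)%:E < ((e / 2) ^+ 2)%:E)%E.
    apply: cvge0_lt; last by rewrite exprn_gt0.
    rewrite -[X in _ --> X](integral0 gam setT).
    apply: (dominated_cvg_real (l := fun=> 0) (g := fun x => (u x) ^+ 2)) iu _.
    - by move=> n; apply: measurable_funX; exact: measurable_funB.
    - exact: measurable_cst.
    - move=> x; apply: cvg_near_cst; exists (Num.truncn `|u x|).+1 => // n /= nx.
      rewrite /v clamp_id ?subrr ?expr0n //; apply: ltW.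
      by apply: lt_le_trans (truncnS_gt _) _; rewrite ler_nat.
    - move=> n x; rewrite ger0_norm ?sqr_ge0 //.
      rewrite -(real_normK (num_real (u x - _))) -(real_normK (num_real (u x))).
      rewrite lerXn2r ?nnegrE // /v /clamp.
      have n0 : 0 <= n%:R :> R by [].
      case: (leP n%:R (u x)) => h1.
        have -> : Num.max (- n%:R) n%:R = n%:R :> R by apply/max_idPr; lra.
        by rewrite !ger0_norm; lra.
      case: (leP (- n%:R) (u x)) => h2; first by rewrite subrr normr0.
      by rewrite !ler0_norm; lra.
  by exists n; apply: nmW_lt => //; rewrite valWB toWE.
pose M : R := n%:R + 1.
have M0 : 0 < M by rewrite ltr_wpDl.
have vM x : `|v n x| <= M by apply: le_trans (clamp_bound _ _) _ => //; rewrite lerDl.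
have d0 : 0 < (e / 2) ^+ 2 / (2 * M) by rewrite divr_gt0 ?exprn_gt0 ?mulr_gt0.
have [_ /(_ _ d0)[f bf hf]] := bcont2_L1_dense (L2_integrable (hv n)).
have [cf _] := bf; have mf := bcont2_measurable bf.
(* The L^1 approximation f has no prescribed bound; clamping imposes M without increasing the
   distance to [v n]. *)
pose g x := clamp M (f x).
have bg : bcont2 g.
  split; last by exists M => x; apply: clamp_bound; exact: ltW.
  by move=> z; apply: (continuous_comp (f := f) (g := clamp M)); [exact: cf|exact: continuous_clamp].
exists g => //.
have hvg : nm (toW gam (v n) - toW gam g) < e / 2.
  apply: nmW_lt => //; rewrite valWB !toWE //; last exact: bcont2_L2.
  apply: (@le_lt_trans _ _ (\int[gam]_x ((2 * M)%:E * `|v n x - f x|%:E))%E).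
    apply: ge0_le_integral => //.
    - by move=> x _; rewrite lee_fin sqr_ge0.
    - by apply: measurable_sqr; apply: measurable_funB => //; exact: bcont2_measurable.
    - apply: measurable_funeM; apply/measurable_EFinP; apply: measurableT_comp => //.
      exact: measurable_funB.
    move=> x _; rewrite -EFinM lee_fin -real_normK ?num_real // expr2.
    rewrite ler_pM //; last exact: clamp_dist.
    apply: le_trans (ler_normB _ _) _; rewrite mulr_natl mulr2n lerD //.
    by rewrite clamp_bound // ltW.
  rewrite ge0_integralZl //; last 2 first.
  - by apply/measurable_EFinP; apply: measurableT_comp => //; exact: measurable_funB.
  - by rewrite lee_fin ltW // mulr_gt0.
  have -> : ((e / 2) ^+ 2)%:E = ((2 * M)%:E * ((e / 2) ^+ 2 / (2 * M))%:E)%E.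
    by rewrite -EFinM; congr EFin; rewrite [RHS]mulrC divfK // gt_eqF // mulr_gt0.
  by rewrite lte_pmul2l ?lte_fin ?mulr_gt0.
apply: le_lt_trans (nm_tri (ipW_semi_inner gam) (toW gam (v n)) u (toW gam g)) _.
by rewrite [ltRHS](splitr e) ltrD.
Qed.

End density.

(** * Extension of identities and of strong continuity from a dense set *)

Section dense_extension.
Variables (R : realType) (V : lmodType R) (ip : V -> V -> R).
Hypothesis ipP : semi_inner ip.
Local Notation nm := (hnorm ip).

Lemma nonexpansive_ext (D : V -> Prop) (F G : V -> V) : hdense ip D ->
  (forall x y, nm (F x - F y) <= nm (x - y)) -> (forall x y, nm (G x - G y) <= nm (x - y)) ->
  (forall x, D x -> ipeq ip (F x) (G x)) -> forall x, ipeq ip (F x) (G x).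
Proof.
move=> dD cF cG FG x; apply/(simP ipP)/eqP; rewrite eq_le (nm_ge0 ip) andbT.
apply: le_eps => e e0; rewrite add0r.
have [y Dy xy] := dD x _ (divr_gt0 e0 (ltr0n R 2)).
have := nm_tri ipP (F y) (F x) (G x); have := nm_tri ipP (G y) (F y) (G x).
have /(simP ipP) -> := FG y Dy.
have := cF x y; have := cG y x; rewrite (nmBC ipP y x); lra.
Qed.

Lemma nonexpansive_continuous (D : V -> Prop) (T : R -> V -> V) : hdense ip D ->
  (forall t x y, 0 <= t -> nm (T t x - T t y) <= nm (x - y)) ->
  (forall x, D x -> forall e : R, 0 < e -> exists2 d : R, 0 < d & forall t, 0 <= t < d ->
    nm (T t x - x) < e) -> sg_continuous ip T.
Proof.
move=> dD cT hD x e e0; have e3 : 0 < e / 3 by rewrite divr_gt0.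
have [y Dy xy] := dD x _ e3; have [d d0 hd] := hD y Dy _ e3.
exists d => // t td; have t0 : 0 <= t by case/andP: td.
have := nm_tri ipP (T t y) (T t x) x; have := nm_tri ipP y (T t y) x.
have := cT t x y t0; have := hd t td; rewrite (nmBC ipP y x); lra.
Qed.

End dense_extension.

(** * The rotated Ornstein-Uhlenbeck semigroup on the real L^2(gamma) *)

Section OU.
Context {R : realType}.
Local Notation gam := (gam R).
Local Notation W := (LfunType gam (lee1n 2)).
Local Notation ip := (ipW (P := gam)).
Local Notation nm := (hnorm ip).
Implicit Types (th t s : R).

(** The complex number exp (- e^(i th) t), of modulus exp (- t cos th). The coefficient [st_]
    completes it to |a|^2 + s^2 = 1, as recorded in [at_st]. *)
Definition at_ th t : R * R :=
  (expR (- (t * cos th)) * cos (t * sin th), - (expR (- (t * cos th)) * sin (t * sin th))).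
Definition st_ th t : R := Num.sqrt (1 - expR (- (2 * t * cos th))).

Lemma sqnorm_at th t : sqnorm (at_ th t) = expR (- (2 * t * cos th)).
Proof.
rewrite /sqnorm /at_ /= sqrrN !exprMn -mulrDr cos2Dsin2 mulr1 expr2 -expRD.
by congr expR; ring.
Qed.

Lemma at_st th t : 0 <= cos th -> 0 <= t -> sqnorm (at_ th t) + st_ th t ^+ 2 = 1.
Proof.
move=> c0 t0; rewrite sqnorm_at /st_ sqr_sqrtr ?subrKC // subr_ge0 -[leRHS]expR0 ler_expR.
by rewrite oppr_le0 !mulr_ge0.
Qed.

Lemma at_conj th t : conjp (at_ th t) = at_ (- th) t.
Proof. by rewrite /conjp /at_ /= cosN sinN mulrN cosN sinN mulrN. Qed.

Lemma st_opp th t : st_ (- th) t = st_ th t.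
Proof. by rewrite /st_ cosN. Qed.

Lemma atD th s t : mulp (at_ th s) (at_ th t) = at_ th (s + t).
Proof.
rewrite /mulp /at_ /= !mulrDl opprD expRD cosD sinD; congr pair; ring.
Qed.

Lemma mulpC (a b : R * R) : mulp a b = mulp b a.
Proof. by rewrite /mulp; congr pair; ring. Qed.

Lemma at0 th : at_ th 0 = (1, 0).
Proof. by rewrite /at_ !mul0r oppr0 expR0 cos0 sin0 !mul1r oppr0. Qed.
Lemma st0 th : st_ th 0 = 0.
Proof. by rewrite /st_ mulr0 mul0r oppr0 expR0 subrr sqrtr0. Qed.

Definition OU th t (u : mpt R -> R) := mehler (at_ th t) (st_ th t) u.
Definition T_ th t (u : W) : W := toW gam (OU th t u).

Lemma OU0 th u x : OU th 0 u x = u x.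
Proof.
rewrite /OU at0 st0 /mehler.
have -> : \int[gam]_y u (mix (1, 0) 0 x y) = \int[gam]_y (u x).
  apply: eq_Rintegral => y _; congr u; rewrite /mix /= [RHS]surjective_pairing.
  by congr pair; ring.
by rewrite /Rintegral integral_cst_prob.
Qed.

Variable th : R.
Hypothesis c0 : 0 <= cos th.

Lemma OU_L2 t u : 0 <= t -> L2r gam u -> L2r gam (OU th t u).
Proof. by move=> t0 hu; apply: mehler_L2 => //; exact: at_st. Qed.

Lemma T_E t (u : W) : 0 <= t -> T_ th t u = OU th t u :> (mpt R -> R).
Proof. by move=> t0; rewrite /T_ toWE //; apply: OU_L2 => //; exact: W_L2. Qed.

Lemma T_contraction : sg_contraction ip (T_ th).
Proof.
move=> t u t0; rewrite -ler_sqr ?nnegrE ?sqrtr_ge0 // !nmW_sqr T_E // -lee_fin.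
rewrite !fineK; last 2 first.
- exact: L2r_fin (W_L2 u).
- by apply: L2r_fin; apply: OU_L2 => //; exact: W_L2.
by apply: mehler_sqr_le; [exact: at_st|exact: W_L2].
Qed.

End OU.

Section OU_sg.
Context {R : realType}.
Local Notation gam := (gam R).
Local Notation W := (LfunType gam (lee1n 2)).
Local Notation ip := (ipW (P := gam)).
Local Notation nm := (hnorm ip).
Let ipP := ipW_semi_inner gam.
Variable th : R.
Hypothesis c0 : 0 <= cos th.
Let c0' : 0 <= cos (- th). Proof. by rewrite cosN. Qed.

Lemma T_adjoint : sg_adjoint ip (T_ th) (T_ (- th)).
Proof.
move=> t u v t0; rewrite /ipW !T_E // /OU -at_conj st_opp.
exact: mehler_adjoint (at_st c0 t0) (W_L2 u) (W_L2 v).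
Qed.

Lemma bcont2_hdense : hdense ip (fun x => exists2 f, bcont2 f & x = toW gam f).
Proof. by move=> u e e0; have [f bf h] := bcont2_dense u e0; exists (toW gam f) => //; exists f. Qed.

Lemma T_nonexpansive t x y : 0 <= t -> nm (T_ th t x - T_ th t y) <= nm (x - y).
Proof. exact: (contrB ipP T_adjoint (T_contraction c0)). Qed.

Lemma bcont2_bounded f : bcont2 f -> exists M, forall x : mpt R, `|f x| <= M.
Proof. by case. Qed.

Lemma OU_comp s t f : bcont2 f -> 0 <= s -> 0 <= t ->
  OU th s (OU th t f) = OU th (s + t) f.
Proof.
move=> bf s0 t0; have [M fM] := bcont2_bounded bf; apply/funext => x.
rewrite /OU -atD; apply: mehler_comp (bcont2_measurable bf) fM; try exact: at_st.
by rewrite atD at_st ?addr_ge0.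
Qed.

(** Both orders give the Mehler operator of the product of the two multipliers, and [mulp] is
    commutative. *)
Lemma OU_commute s t f : bcont2 f -> 0 <= s -> 0 <= t ->
  OU th s (OU (- th) t f) = OU (- th) t (OU th s f).
Proof.
move=> bf s0 t0; have [M fM] := bcont2_bounded bf; apply/funext => x.
have h1 := at_st c0 s0; have h2 := at_st c0' t0.
(* The product of multipliers is not of the form [at_ th] in general, so its noise coefficient is
   written directly as a square root. *)
have hq : sqnorm (mulp (at_ th s) (at_ (- th) t)) +
   Num.sqrt (1 - sqnorm (mulp (at_ th s) (at_ (- th) t))) ^+ 2 = 1.
  rewrite sqr_sqrtr ?subrKC // subr_ge0 sqnormM !sqnorm_at -expRD -[leRHS]expR0 ler_expR.
  by rewrite -opprD oppr_le0 addr_ge0 ?mulr_ge0.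
rewrite /OU (mehler_comp x h1 h2 hq (bcont2_measurable bf) fM).
by rewrite mulpC in hq *; rewrite (mehler_comp x h2 h1 hq (bcont2_measurable bf) fM).
Qed.

Lemma bcont2_W f : bcont2 f -> toW gam f = f :> (mpt R -> R).
Proof. by move=> bf; rewrite toWE //; exact: bcont2_L2. Qed.

Lemma T_bcont2 t f : 0 <= t -> bcont2 f -> T_ th t (toW gam f) = OU th t f :> (mpt R -> R).
Proof. by move=> t0 bf; apply: etrans (T_E c0 _ t0) (congr1 (OU th t) (bcont2_W bf)). Qed.

Lemma T_T_bcont2 th' s t f : 0 <= cos th' -> 0 <= s -> 0 <= t -> bcont2 f ->
  T_ th' s (T_ th t (toW gam f)) = OU th' s (OU th t f) :> (mpt R -> R).
Proof.
by move=> h s0 t0 bf; apply: etrans (T_E h _ s0) (congr1 (OU th' s) (T_bcont2 t0 bf)).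
Qed.

Lemma val_T_sim (u v : W) : (u : mpt R -> R) = v -> ipeq ip u v.
Proof. by move=> uv; have -> : u = v by apply/val_inj. Qed.

End OU_sg.

Section OU_sg2.
Context {R : realType}.
Local Notation gam := (gam R).
Local Notation W := (LfunType gam (lee1n 2)).
Local Notation ip := (ipW (P := gam)).
Local Notation nm := (hnorm ip).
Let ipP := ipW_semi_inner gam.
Variable th : R.
Hypothesis c0 : 0 <= cos th.
Let c0' : 0 <= cos (- th). Proof. by rewrite cosN. Qed.

(** For bounded continuous functions this is the pointwise identity [OU_comp]; both sides are
    nonexpansive, so density extends it. *)
Lemma T_semigroup : sg_semigroup ip (T_ th).
Proof.
move=> s t + s0 t0; have st0 := addr_ge0 s0 t0.
apply: (nonexpansive_ext ipP bcont2_hdense (F := fun x => T_ th s (T_ th t x))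
  (G := T_ th (s + t))).
- by move=> x y; apply: le_trans (T_nonexpansive c0 _ _ s0) _; exact: T_nonexpansive.
- by move=> x y; exact: T_nonexpansive.
move=> _ [f bf ->]; apply: val_T_sim.
apply: etrans (T_T_bcont2 c0 c0 s0 t0 bf) (etrans _ (esym (T_bcont2 c0 st0 bf))).
exact: OU_comp.
Qed.

Lemma T_commute : sg_commute ip (T_ th) (T_ (- th)).
Proof.
move=> s t + s0 t0.
apply: (nonexpansive_ext ipP bcont2_hdense (F := fun x => T_ th s (T_ (- th) t x))
  (G := fun x => T_ (- th) t (T_ th s x))).
- by move=> x y; apply: le_trans (T_nonexpansive c0 _ _ s0) _; exact: T_nonexpansive.
- by move=> x y; apply: le_trans (T_nonexpansive c0' _ _ t0) _; exact: T_nonexpansive.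
move=> _ [f bf ->]; apply: val_T_sim.
apply: etrans (T_T_bcont2 c0' c0 s0 t0 bf) (etrans _ (esym (T_T_bcont2 c0 c0' t0 s0 bf))).
exact: OU_commute.
Qed.

Lemma T_0 (u : W) : ipeq ip (T_ th 0 u) u.
Proof.
apply: val_T_sim; apply: etrans (T_E c0 u (lexx 0)) _.
by apply/funext => x; exact: OU0.
Qed.

Lemma OU_bound t (f : mpt R -> R) (M : R) x : measurable_fun setT f -> (forall y, `|f y| <= M) -> `|OU th t f x| <= M.
Proof.
move=> mf fM; have mm : measurable_fun setT (fun y => f (mix (at_ th t) (st_ th t) x y)).
  exact: (measurableT_comp mf (measurable_mix2 _ _ _)).
have ii : gam.-integrable setT (fun y => (f (mix (at_ th t) (st_ th t) x y))%:E).
  exact: bounded_integrable mm (fun y => fM _).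
apply: le_trans (le_normr_Rintegral measurableT ii) _.
have <- : \int[gam]_y M = M by rewrite /Rintegral integral_cst_prob.
apply: le_Rintegral => //; last exact: finite_measure_integrable_cst.
exact: integrable_abse ii.
Qed.

Lemma mehler_cvg (a : nat -> R * R) (s : nat -> R) a0 s0 f x : bcont2 f ->
  (fun n => (a n).1) @ \oo --> a0.1 -> (fun n => (a n).2) @ \oo --> a0.2 ->
  s @ \oo --> s0 -> (fun n => mehler (a n) (s n) f x) @ \oo --> mehler a0 s0 f x.
Proof.
move=> bf c1 c2 cs; have [cf [M fM]] := bf; have mf := bcont2_measurable bf.
have mm b r : measurable_fun setT (fun y => f (mix b r x y)).
  exact: (measurableT_comp mf (measurable_mix2 _ _ _)).
have ii b r : gam.-integrable setT (fun y => (f (mix b r x y))%:E).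
  exact: bounded_integrable (mm b r) (fun y => fM _).
suff /fine_cvgP[] : (fun n => \int[gam]_y (f (mix (a n) (s n) x y))%:E)%E @ \oo -->
    (fine (\int[gam]_y (f (mix a0 s0 x y))%:E)%E)%:E by [].
rewrite fineK; last exact: integrable_fin_num (ii _ _).
apply: (dominated_cvg_real (g := fun=> M)) => //; last exact: finite_measure_integrable_cst.
move=> y.
have p1 : (fun n => (mix (a n) (s n) x y).1 : R) @ \oo --> ((mix a0 s0 x y).1 : R).
  by apply: cvgD; first apply: cvgB; apply: cvgM => //; exact: cvg_cst.
have p2 : (fun n => (mix (a n) (s n) x y).2 : R) @ \oo --> ((mix a0 s0 x y).2 : R).
  by apply: cvgD; first apply: cvgD; apply: cvgM => //; exact: cvg_cst.
apply: (cvg_comp (fun n => mix (a n) (s n) x y : pt R) f _ (cf (mix a0 s0 x y))).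
exact: (cvg_pair p1 p2).
Qed.

Lemma OU_cvg (t : nat -> R) t0 f x : bcont2 f -> t @ \oo --> t0 ->
  (fun n => OU th (t n) f x) @ \oo --> OU th t0 f x.
Proof.
move=> bf ct.
have cm (k : R) : (fun n => t n * k) @ \oo --> t0 * k by apply: cvgM => //; exact: cvg_cst.
have cE : (fun n => expR (- (t n * cos th))) @ \oo --> expR (- (t0 * cos th)).
  by apply: (cvg_comp _ expR (cvgN (cm _))); exact: continuous_expR.
have cC : (fun n => cos (t n * sin th)) @ \oo --> cos (t0 * sin th).
  by apply: (cvg_comp _ cos (cm _)); exact: continuous_cos.
have cS : (fun n => sin (t n * sin th)) @ \oo --> sin (t0 * sin th).
  by apply: (cvg_comp _ sin (cm _)); exact: continuous_sin.
apply: mehler_cvg => //.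
- exact: cvgM.
- by apply: cvgN; exact: cvgM.
have c2 : (fun n => 1 - expR (- (2 * t n * cos th))) @ \oo --> 1 - expR (- (2 * t0 * cos th)).
  apply: cvgB; first exact: cvg_cst.
  apply: (cvg_comp _ expR); last exact: continuous_expR.
  apply: cvgN; apply: cvgM; last exact: cvg_cst.
  by apply: cvgM => //; exact: cvg_cst.
by apply: (cvg_comp _ Num.sqrt c2); exact: sqrt_continuous.
Qed.

Lemma nm_cvg0 (g : nat -> mpt R -> R) (l : mpt R -> R) (M : R) :
  (forall n, measurable_fun setT (g n)) -> measurable_fun setT l ->
  (forall n x, `|g n x| <= M) -> (forall x, g ^~ x @ \oo --> l x) ->
  (fun n => nm (toW gam (g n) - toW gam l)) @ \oo --> 0.
Proof.
move=> mg ml gM gl.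
have lM x : `|l x| <= M.
  have c : (fun n => `|g n x|) @ \oo --> `|l x| by exact: cvg_norm (gl x).
  rewrite -(cvg_lim _ c) //.
  by apply: limr_le; [apply/cvg_ex; eexists; exact: c|exact: nearW].
have hg n : L2r gam (g n) by exact: L2_bounded (gM n).
have hl : L2r gam l by exact: L2_bounded lM.
have h : (fun n => fine (\int[gam]_x ((g n x - l x) ^+ 2)%:E)%E) @ \oo --> 0.
  suff /fine_cvgP[] : (fun n => \int[gam]_x ((g n x - l x) ^+ 2)%:E)%E @ \oo --> 0%:E by [].
  rewrite -[X in _ --> X](integral0 gam setT).
  apply: (dominated_cvg_real (l := fun=> 0) (g := fun=> (2 * M) ^+ 2)).
  - by move=> n; apply: measurable_funX; exact: measurable_funB.
  - exact: measurable_cst.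
  - move=> x; have c : (fun n => g n x - l x) @ \oo --> 0.
      by rewrite -(subrr (l x)); apply: cvgB => //; exact: cvg_cst.
    by rewrite -[X in _ --> X](mulr0 (0 : R)); exact: (cvgM c c).
  - exact: finite_measure_integrable_cst.
  move=> n x; rewrite normrX lerXn2r ?nnegrE //.
    by rewrite mulr_ge0 // (le_trans (normr_ge0 _) (lM x)).
  by apply: le_trans (ler_normB _ _) _; rewrite mulr_natl mulr2n lerD.
have E n : nm (toW gam (g n) - toW gam l) = Num.sqrt (fine (\int[gam]_x ((g n x - l x) ^+ 2)%:E)%E).
  by rewrite -[LHS](ger0_norm (sqrtr_ge0 _)) -sqrtr_sqr nmW_sqr valWB !toWE.
have c : Num.sqrt \o (fun n => fine (\int[gam]_x ((g n x - l x) ^+ 2)%:E)%E) @ \oo --> (0 : R).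
  rewrite -[0 in X in _ --> X](@sqrtr0 R).
  exact: (continuous_cvg _ (@sqrt_continuous R 0) h).
by rewrite (_ : (fun n => _) = Num.sqrt \o
  (fun n => fine (\int[gam]_x ((g n x - l x) ^+ 2)%:E)%E)) //; apply/funext => n; exact: E.
Qed.

Lemma T_continuous : sg_continuous ip (T_ th).
Proof.
apply: (nonexpansive_continuous ipP bcont2_hdense).
  by move=> t x y t0; exact: T_nonexpansive.
move=> _ [f bf ->] e e0; have [M fM] := bcont2_bounded bf.
have mf := bcont2_measurable bf; have hf := bcont2_L2 bf.
have c : (fun t => nm (T_ th t (toW gam f) - toW gam f)) @ 0^'+ --> 0.
  apply/cvg_at_rightP => t [t0 ct].
  apply: (nm_cvg0 (g := fun n => OU th (t n) (toW gam f)) (M := M)) => //.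
  - by move=> n; rewrite toWE //; apply: measurable_mehler hf; apply: at_st => //; exact: ltW.
  - by move=> n x; rewrite toWE //; exact: OU_bound.
  - by move=> x; rewrite toWE // -(OU0 th f x); exact: OU_cvg.
have /cvgrPdist_lt /(_ e e0) := c.
move=> [d /= d0 hd]; exists d => // t /andP[t0 td].
(* The right limit says nothing about t = 0, where [T_0] is used instead. *)
move: t0; rewrite le_eqVlt => /predU1P[<-|t0].
  by have /(simP ipP) -> := T_0 (toW gam f).
have := hd t; rewrite /= !sub0r !normrN gtr0_norm // => /(_ td t0).
by rewrite ger0_norm // sqrtr_ge0.
Qed.

End OU_sg2.

(** * Integrals over bounded intervals of time *)

Section interval_integrals.
Context {R : realType}.
Local Notation mu := (@lebesgue_measure R).
Local Notation mR := (measurableTypeR R).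
Implicit Types (J : set mR) (g : mR -> R).

(** With the indicator in the integrand, integrals over different intervals combine into a single
    integral over the line and can be compared pointwise. *)
Definition intJ J g : R := \int[mu]_s (\1_J s * g s).

Lemma indic_integrable J : measurable J -> (mu J < +oo)%E ->
  mu.-integrable setT (fun s => (\1_J s)%:E).
Proof.
move=> mJ fJ; apply/integrableP; split.
  by apply/measurable_EFinP; exact: measurable_indic.
under eq_integral do rewrite /= ger0_norm //.
by rewrite integral_indic // setIT.
Qed.

Lemma integral_indicE J (l : R) : measurable J -> mu J = l%:E ->
  (\int[mu]_s (\1_J s)%:E = l%:E)%E.
Proof.
by move=> mJ Jl; apply: etrans (integral_indic mu measurableT mJ) _; rewrite setIT; exact: Jl.
Qed.

Lemma indicM_integrable J g (M : R) : measurable J -> (mu J < +oo)%E ->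
  measurable_fun setT g -> (forall s, `|g s| <= M) ->
  mu.-integrable setT (fun s => (\1_J s * g s)%:E).
Proof.
move=> mJ fJ mg gM.
have i1 : mu.-integrable setT (fun s => (M * \1_J s)%:E).
  have := integrableZl measurableT M (indic_integrable mJ fJ).
  by apply: eq_integrable => // s _; rewrite EFinM.
apply: le_integrable i1 => //.
  by apply/measurable_EFinP; apply: measurable_funM => //; exact: measurable_indic.
move=> s _; rewrite lee_fin !normrM mulrC ler_wpM2r //.
exact: le_trans (gM s) (ler_norm _).
Qed.

Lemma intJ_close J g (M c e : R) (l : R) : measurable J -> mu J = l%:E ->
  measurable_fun setT g -> (forall s, `|g s| <= M) ->
  (forall s, J s -> `|g s - c| <= e) -> `|intJ J g - l * c| <= l * e.
Proof.
move=> mJ Jl mg gM gc; have fJ : (mu J < +oo)%E by rewrite Jl ltry.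
have cstE r : \int[mu]_s (\1_J s * r) = l * r.
  rewrite RintegralZr //; last exact: indic_integrable.
  by rewrite /Rintegral (integral_indicE mJ Jl).
have i1 := indicM_integrable mJ fJ mg gM.
have i2 (r : R) : mu.-integrable setT (fun s => (\1_J s * r)%:E).
  have mr : measurable_fun setT (fun _ : mR => r) by [].
  exact: (indicM_integrable mJ fJ mr (fun=> lexx `|r|)).
have mgc : measurable_fun setT (fun s => g s - c) by apply: measurable_funB.
have gcM s : `|g s - c| <= M + `|c| by apply: le_trans (ler_normB _ _) _; rewrite lerD2r.
have i3 := indicM_integrable mJ fJ mgc gcM.
rewrite -cstE -RintegralB //; last exact: i2.
rewrite (_ : \int[mu]_x _ = \int[mu]_s (\1_J s * (g s - c))); last first.
  by apply: eq_Rintegral => s _; rewrite mulrBr.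
apply: le_trans (le_normr_Rintegral measurableT i3) _.
rewrite -(cstE e); apply: le_Rintegral => //; [exact: integrable_abse i3|exact: i2|].
move=> s _; rewrite indicE; have [sJ|sJ] := boolP (s \in J).
  by rewrite !mul1r; apply: gc; rewrite inE in sJ.
by rewrite !mul0r normr0.
Qed.

Lemma mu_itv (a b : R) (r r' : bool) : a <= b ->
  mu [set` Interval (BSide r a) (BSide r' b)] = (b - a)%:E.
Proof.
move=> ab; rewrite lebesgue_measure_itv /= lte_fin; case: ifPn => [_|].
  by rewrite EFinB.
by rewrite -leNgt => ba; rewrite (le_anti (introT andP (conj ab ba))) subrr.
Qed.

Lemma preserves_shift (c : R) : preserves mu mu (fun s : mR => s + c : mR).
Proof.
split=> [|f mf f0]; first by apply: measurable_funD.
exact: lebesgue_integral_shift.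
Qed.

Lemma intJ_avg J g (M c e l : R) : 0 < l -> measurable J -> mu J = l%:E ->
  measurable_fun setT g -> (forall s, `|g s| <= M) ->
  (forall s, J s -> `|g s - c| <= e) -> `|l^-1 * intJ J g - c| <= e.
Proof.
move=> l0 mJ Jl mg gM gc; have H := intJ_close mJ Jl mg gM gc.
have -> : l^-1 * intJ J g - c = l^-1 * (intJ J g - l * c).
  by field; rewrite gt_eqF.
by rewrite normrM gtr0_norm ?invr_gt0 // mulrC ler_pdivrMr // [e * l]mulrC.
Qed.

Lemma intJ_shift g (t h : R) : measurable_fun setT g ->
  \int[mu]_s (\1_(`[0, h]%classic) s * g (s + t)) = intJ `[t, t + h]%classic g.
Proof.
move=> mg.
have mk : measurable_fun setT (fun s : mR => (\1_(`[t, t + h]%classic) s * g s)%:E).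
  by apply/measurable_EFinP; apply: measurable_funM => //; exact: measurable_indic.
rewrite /intJ /Rintegral; congr fine.
apply: etrans _ (preserves_integral (preserves_shift t) mk).
apply: eq_integral => s _; rewrite !indicE.
suff -> : (s \in `[0, h]%classic) = (s + t \in `[t, t + h]%classic) by [].
by apply/idP/idP; rewrite !inE /= !in_itv /= => /andP[? ?]; apply/andP; split; lra.
Qed.

(** Shifting a window of length h by t gains a piece of length t on the right and loses one on the
    left. With these open and closed endpoints the indicators agree at every point, whatever the
    order of t and h. *)
Lemma intJ_diff g (M t h : R) : 0 < h -> 0 < t -> measurable_fun setT g ->
  (forall s, `|g s| <= M) ->
  intJ `[t, t + h]%classic g - intJ `[0, h]%classic g =
  intJ `]h, h + t]%classic g - intJ `[0, t[%classic g.
Proof.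
move=> h0 t0 mg gM.
have ii a b (r r' : bool) : a <= b -> mu.-integrable setT
    (fun s => (\1_([set` Interval (BSide r a) (BSide r' b)]) s * g s)%:E).
  move=> ab; apply: indicM_integrable mg gM; first exact: measurable_itv.
  by rewrite mu_itv // ltry.
have th0 : t <= t + h by lra.
have hh0 : h <= h + t by lra.
rewrite /intJ -RintegralB; [|exact: measurableT|exact: ii th0|exact: ii (ltW h0)].
rewrite -RintegralB; [|exact: measurableT|exact: ii hh0|exact: ii (ltW t0)].
apply: eq_Rintegral => s _; rewrite -!mulrBl; congr (_ * _).
rewrite !indicE.
have memE (i : interval R) : (s \in [set` i]) = (s \in i).
  by apply/idP/idP => [/set_mem|si] //; exact: mem_set.
rewrite !memE !in_itv /=.
case: (leP 0 s) => s0; case: (ltP s t) => st; case: (leP s h) => sh1;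
  case: (leP s (t + h)) => sh2; case: (leP s (h + t)) => sh3;
  rewrite /= ?subrr ?subr0 ?sub0r //; exfalso; lra.
Qed.

Lemma normB_le2 (a b M : R) : `|a| <= M -> `|b| <= M -> `|a - b| <= 2 * M.
Proof. by move=> h1 h2; apply: le_trans (ler_normB _ _) _; lra. Qed.

Lemma normBB_le (a b c d e : R) : `|a - c| <= e / 2 -> `|b - d| <= e / 2 ->
  `|(c - d) - (a - b)| <= e.
Proof.
move=> h1 h2; rewrite (_ : _ - _ = (b - d) - (a - c)); last by ring.
by apply: le_trans (ler_normB _ _) _; lra.
Qed.

End interval_integrals.

(** The inner value is asked only for s in J, which is where [OU_window] knows that s is
    nonnegative. *)
Lemma integral_indic_scale d (T : measurableType d) (R : realType) (P : probability T R)
  (J : set (measurableTypeR R)) (s : measurableTypeR R) (k : T -> R) (c : R) :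
  (s \in J -> \int[P]_y (k y)%:E = c%:E)%E ->
  (\int[P]_y (\1_J s * k y)%:E = (\1_J s * c)%:E)%E.
Proof.
move=> kc; rewrite indicE; case: (boolP (s \in J)) => [/kc kE|_].
  by rewrite mul1r -kE; apply: eq_integral => y _; rewrite mul1r.
by rewrite mul0r; apply: integral0_eq => y _; rewrite mul0r.
Qed.

(** * Density of the domain of the generator, by averaging in time *)

Section generator_domain.
Context {R : realType}.
Local Notation mu := (@lebesgue_measure R).
Local Notation mR := (measurableTypeR R).
Local Notation gam := (gam R).
Local Notation W := (LfunType gam (lee1n 2)).
Local Notation ip := (ipW (P := gam)).
Local Notation nm := (hnorm ip).
Let ipP := ipW_semi_inner gam.
Variable th : R.
Hypothesis c0 : 0 <= cos th.

Section fixed_function.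
Variables (f : mpt R -> R) (M : R).
Hypotheses (bf : bcont2 f) (fM : forall x, `|f x| <= M).
Let mf := bcont2_measurable bf.
Let m (s : mR) (x : mpt R) : R := OU th s f x.

Let mM s x : `|m s x| <= M. Proof. exact: OU_bound. Qed.

(** Partial integrals are measurable by Fubini for an integrable function; giving the parameter s
    the law [gauss1] puts the bounded integrand on a probability space, where it is integrable. *)
Lemma measurable_OU2 : measurable_fun setT (fun p : mR * mpt R => OU th p.1 f p.2).
Proof.
have m1 (k : R) : measurable_fun setT (fun s : mR => s * k) by apply: measurable_funM.
have mE : measurable_fun setT (fun s : mR => expR (- (s * cos th))).
  by apply: (measurableT_comp (@measurable_expR R)); apply: measurableT_comp.
have mC : measurable_fun setT (fun s : mR => cos (s * sin th)).
  exact: (measurableT_comp (continuous_measurable_fun (@continuous_cos R)) (m1 _)).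
have mS : measurable_fun setT (fun s : mR => sin (s * sin th)).
  exact: (measurableT_comp (continuous_measurable_fun (@continuous_sin R)) (m1 _)).
have ma1 : measurable_fun setT (fun s : mR => (at_ th s).1) by apply: measurable_funM.
have ma2 : measurable_fun setT (fun s : mR => (at_ th s).2).
  have mES : measurable_fun setT (fun s : mR => expR (- (s * cos th)) * sin (s * sin th)).
    exact: measurable_funM.
  have mo : measurable_fun setT (-%R : R -> R) by [].
  exact: (measurableT_comp mo mES).
have mst : measurable_fun setT (fun s : mR => st_ th s).
  have h1 : measurable_fun setT (fun s : mR => 2 * s * cos th).
    by apply: measurable_funM => //; apply: measurable_funM.
  have mo : measurable_fun setT (-%R : R -> R) by [].
  have h2 := measurableT_comp (@measurable_expR R) (measurableT_comp mo h1).
  have h3 : measurable_fun setT (fun s : mR => 1 - expR (- (2 * s * cos th))).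
    exact: (measurable_funB (measurable_cst _) h2).
  exact: (measurableT_comp (continuous_measurable_fun (@sqrt_continuous R)) h3).
have p1 : measurable_fun setT (fun q : (mR * mpt R) * mpt R => q.1.1).
  exact: (measurableT_comp measurable_fst measurable_fst).
have px : measurable_fun setT (fun q : (mR * mpt R) * mpt R => q.1.2).
  exact: (measurableT_comp measurable_snd measurable_fst).
have px1 : measurable_fun setT (fun q : (mR * mpt R) * mpt R => q.1.2.1).
  exact: (measurableT_comp measurable_fst px).
have px2 : measurable_fun setT (fun q : (mR * mpt R) * mpt R => q.1.2.2).
  exact: (measurableT_comp measurable_snd px).
have py1 : measurable_fun setT (fun q : (mR * mpt R) * mpt R => q.2.1).
  exact: (measurableT_comp measurable_fst measurable_snd).
have py2 : measurable_fun setT (fun q : (mR * mpt R) * mpt R => q.2.2).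
  exact: (measurableT_comp measurable_snd measurable_snd).
have qa1 := measurableT_comp ma1 p1; have qa2 := measurableT_comp ma2 p1.
have qs := measurableT_comp mst p1.
have mmix : measurable_fun setT (fun q : (mR * mpt R) * mpt R =>
    mix (at_ th q.1.1) (st_ th q.1.1) q.1.2 q.2).
  apply: measurable_fun_pair.
    by apply: measurable_funD; [apply: measurable_funB|]; apply: measurable_funM.
  by apply: measurable_funD; [apply: measurable_funD|]; apply: measurable_funM.
have mfm := measurableT_comp mf mmix.
have ii := bounded_integrable ((gauss1 R \x gam) \x gam)%E mfm (fun q => fM _).
have mF := measurable_fubini_F ii.
have mfine : measurable_fun setT (@fine R) by [].
exact: (measurableT_comp mfine mF).
Qed.

Let mm : measurable_fun setT (fun p : mR * mpt R => m p.1 p.2).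
Proof. exact: measurable_OU2. Qed.

Let m_s x : measurable_fun setT (m ^~ x).
Proof.
have h : measurable_fun setT (fun s : mR => (s, x)) by apply: measurable_fun_pair.
exact: (measurableT_comp mm h).
Qed.

Section window.
Variables (J : set mR) (l : R).
Hypotheses (mJ : measurable J) (Jl : mu J = l%:E).
Let fJ : (mu J < +oo)%E. Proof. by rewrite Jl ltry. Qed.

(** Stands for the L^2-valued integral of s |-> T_s f over J, taken at each point x. *)
Definition window (x : mpt R) : R := intJ J (m ^~ x).

Lemma window_bound x : `|window x| <= l * M.
Proof.
have := @intJ_close _ J (m ^~ x) M 0 M l mJ Jl (m_s x) (mM ^~ x).
by rewrite mulr0 subr0; apply => s _; rewrite subr0.
Qed.

(** The map phi serves two uses: the identity, for measurability of the window, and y |-> a x + s y,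
    for moving T_t under the time integral. *)
Lemma window_fubini_integrable (phi : mpt R -> mpt R) : measurable_fun setT phi ->
  (gam \x mu)%E.-integrable setT (fun p => (\1_J p.2 * m p.2 (phi p.1))%:E).
Proof.
move=> mphi.
have mk : measurable_fun setT (fun p : mpt R * mR => (\1_J p.2 * m p.2 (phi p.1))%:E).
  apply/measurable_EFinP; apply: measurable_funM.
    have mi : measurable_fun setT (\1_J : mR -> R) by exact: measurable_indic.
    exact: (measurableT_comp mi measurable_snd).
  have h : measurable_fun setT (fun p : mpt R * mR => (p.2, phi p.1)).
    apply: measurable_fun_pair => //; exact: (measurableT_comp mphi measurable_fst).
  exact: (measurableT_comp mm h).
apply: (proj2 (integrable12ltyP _ _ mk)).
apply: (@le_lt_trans _ _ (\int[gam]_x (M * l)%:E)%E); last by rewrite integral_cst_prob ltry.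
apply: ge0_le_integral => //.
- by move=> x _; apply: integral_ge0.
- apply: (measurable_fun_fubini_tonelli_F (fun p => `|(\1_J p.2 * m p.2 (phi p.1))%:E|%E)) => //.
  exact: measurableT_comp.
move=> x _ /=.
have M0 : 0 <= M by exact: le_trans (normr_ge0 _) (mM 0 x).
have -> : ((M * l)%:E = \int[mu]_s (M%:E * (\1_J s)%:E))%E.
  have mi : measurable_fun setT (fun s : mR => (\1_J s : R)%:E).
    by apply/measurable_EFinP; exact: measurable_indic.
  rewrite (ge0_integralZl mu measurableT mi) ?lee_fin //.
  by rewrite (integral_indicE mJ Jl) EFinM.
apply: ge0_le_integral => //.
- have h : measurable_fun setT (fun s : mR => (x, s)) by apply: measurable_fun_pair.
  have ma : measurable_fun setT (abse : \bar R -> \bar R) by [].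
  exact: (measurableT_comp ma (measurableT_comp mk h)).
- by apply: measurable_funeM; apply/measurable_EFinP; exact: measurable_indic.
move=> s _; rewrite lee_fin normrM mulrC ler_pM // ger0_norm //.
Qed.

Lemma measurable_window : measurable_fun setT window.
Proof.
have mid : measurable_fun setT (fun x : mpt R => x) by [].
have mF := measurable_fubini_F (window_fubini_integrable mid).
have mfine : measurable_fun setT (@fine R) by [].
exact: (measurableT_comp mfine mF).
Qed.

Hypothesis J0 : forall s, J s -> 0 <= s.

Lemma OU_window t x : 0 <= t ->
  OU th t window x = \int[mu]_s (\1_J s * m (s + t) x).
Proof.
move=> t0; pose phi := mix (at_ th t) (st_ th t) x.
have mphi : measurable_fun setT phi by exact: measurable_mix2.
have ii := window_fubini_integrable mphi.
rewrite /OU /mehler /Rintegral; congr fine.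
transitivity (\int[gam]_y \int[mu]_s (\1_J s * m s (phi y))%:E)%E.
  apply: eq_integral => y _; rewrite /window /intJ /Rintegral fineK //.
  apply: integrable_fin_num => //.
  exact: indicM_integrable (m_s (phi y)) (mM ^~ (phi y)).
apply: etrans (Fubini ii) _; apply: eq_integral => s _ /=.
apply: integral_indic_scale => sJ.
have s0 : 0 <= s by apply: J0; rewrite inE in sJ.
have ms : measurable_fun setT (fun y => m s (phi y)).
  have h : measurable_fun setT (fun y : mpt R => (s, phi y)) by apply: measurable_fun_pair.
  exact: (measurableT_comp mm h).
have is_ := bounded_integrable gam ms (fun y => mM s _).
rewrite -[LHS]fineK; last exact: integrable_fin_num is_.
congr EFin; rewrite /m addrC -(OU_comp c0 bf t0 s0) //.
Qed.

End window.

Let J1 h : set mR := `[0, h]%classic.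

Lemma OU_window_diff h t x : 0 < h -> 0 < t ->
  OU th t (window (J1 h)) x - window (J1 h) x =
  intJ `]h, h + t]%classic (m ^~ x) - intJ `[0, t[%classic (m ^~ x).
Proof.
move=> h0 t0.
rewrite (@OU_window _ (h - 0)); [|exact: measurable_itv|exact: mu_itv (ltW h0)| |exact: ltW].
  have := intJ_shift t h (m_s x); rewrite /J1 => ->.
  exact: intJ_diff h0 t0 (m_s x) (mM ^~ x).
by move=> s; rewrite /J1 /= in_itv /= => /andP[].
Qed.

Lemma OU_right_continuous h x : forall e : R, 0 < e -> exists2 d : R, 0 < d &
  forall s, h <= s < h + d -> `|m s x - m h x| <= e.
Proof.
move=> e e0.
have c : (fun s => m s x) @ h^'+ --> m h x.
  by apply/cvg_at_rightP => u [_ cu]; exact: OU_cvg.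
have /cvgrPdist_le hc := c.
have [d /= d0 hd] := hc e e0; exists d => // s /andP[hs sd].
move: hs; rewrite le_eqVlt => /predU1P[<-|hs]; first by rewrite subrr normr0 ltW.
rewrite distrC; apply: hd => //=.
by rewrite distrC gtr0_norm ?subr_gt0 // ltrBlDl.
Qed.

(** The difference quotient is the mean of T_s f over ]h, h + t] minus its mean over [0, t[. Right
    continuity in s gives the pointwise limit T_h f - f, and the uniform bound 2 M upgrades it to
    convergence in norm. *)
Lemma window_generator h : 0 < h ->
  generator ip (T_ th) (toW gam (window (J1 h))) (toW gam (fun x => m h x - f x)).
Proof.
move=> h0.
have mi (i : interval R) : measurable ([set` i] : set mR) by exact: measurable_itv.
have li a b (r r' : bool) : a <= b ->
  mu [set` Interval (BSide r a) (BSide r' b)] = (b - a)%:E.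
  exact: mu_itv.
have mw : measurable_fun setT (window (J1 h)).
  by apply: (@measurable_window _ (h - 0)); [exact: mi|exact: li (ltW h0)].
have hw : L2r gam (window (J1 h)).
  apply: (@L2_bounded _ _ _ _ _ ((h - 0) * M)) => // x.
  by apply: (@window_bound _ (h - 0)); [exact: mi|exact: li (ltW h0)].
have mh : measurable_fun setT (m h).
  have k : measurable_fun setT (fun x : mpt R => (h, x) : mR * mpt R).
    by apply: measurable_fun_pair.
  exact: (measurableT_comp mm k).
have M0 : 0 <= M by exact: le_trans (normr_ge0 _) (mM 0 (0, 0)).
pose q t x := t^-1 * (OU th t (window (J1 h)) x - window (J1 h) x).
have hOU t : 0 < t -> L2r gam (OU th t (window (J1 h))).
  by move=> t0; apply: OU_L2 => //; exact: ltW.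
have mq t : 0 < t -> measurable_fun setT (q t).
  move=> t0; apply: measurable_funM => //; apply: measurable_funB => //.
  by have [] := hOU t t0.
have qE t x : 0 < t -> q t x = t^-1 * intJ `]h, h + t]%classic (m ^~ x)
    - t^-1 * intJ `[0, t[%classic (m ^~ x).
  by move=> t0; rewrite /q OU_window_diff // mulrBr.
have cl t x (c e : R) : 0 < t -> (forall s, h < s <= h + t -> `|m s x - c| <= e) ->
    `|t^-1 * intJ `]h, h + t]%classic (m ^~ x) - c| <= e.
  move=> t0 hc; have ht : h <= h + t by rewrite lerDl ltW.
  have lt : mu `]h, h + t]%classic = t%:E.
    by rewrite (mu_itv false false ht); congr EFin; ring.
  apply: (intJ_avg t0 _ lt (m_s x) (mM ^~ x)) => [|s /=]; first exact: mi.
  by rewrite in_itv /=; exact: hc.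
have cr t x (c e : R) : 0 < t -> (forall s, 0 <= s < t -> `|m s x - c| <= e) ->
    `|t^-1 * intJ `[0, t[%classic (m ^~ x) - c| <= e.
  move=> t0 hc.
  have lt : mu `[0, t[%classic = t%:E by rewrite (mu_itv true true (ltW t0)) subr0.
  apply: (intJ_avg t0 _ lt (m_s x) (mM ^~ x)) => [|s /=]; first exact: mi.
  by rewrite in_itv /=; exact: hc.
have q2M t x : 0 < t -> `|q t x| <= 2 * M.
  move=> t0; rewrite qE //; apply: normB_le2.
    by have := cl t x 0 M t0; rewrite subr0; apply => s _; rewrite subr0.
  by have := cr t x 0 M t0; rewrite subr0; apply => s _; rewrite subr0.
have m0 x : m 0 x = f x by exact: OU0.
move: (toWE hw); move: (toW gam (window (J1 h))) => w wE.
have hq t : 0 < t -> L2r gam (q t).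
  move=> t0; apply: (@L2_bounded _ _ _ _ _ (2 * M)); first exact: mq.
  by move=> x; exact: q2M.
have WE t : 0 < t -> t^-1 *: (T_ th t w - w) = toW gam (q t).
  move=> t0; apply/LfuneqP => x; have E0 := T_E c0 w (ltW t0).
  have E1 : T_ th t w x = OU th t (window (J1 h)) x by rewrite E0 wE.
  have E2 : w x = window (J1 h) x by rewrite wE.
  have E3 : toW gam (q t) x = q t x by rewrite (toWE (hq t t0)).
  by rewrite E3 /q -E1 -E2.
have c : (fun t => nm (t^-1 *: (T_ th t w - w) - toW gam (fun x => m h x - f x)))
    @ 0^'+ --> 0.
  apply/cvg_at_rightP => t [t0 ct].
  have -> : (fun n => nm ((t n)^-1 *: (T_ th (t n) w - w) - toW gam (fun x => m h x - f x))) =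
      (fun n => nm (toW gam (q (t n)) - toW gam (fun x => m h x - f x))).
    by apply/funext => n; rewrite WE.
  apply: (nm_cvg0 (g := fun n => q (t n)) (M := 2 * M)).
  - by move=> n; exact: mq.
  - exact: measurable_funB.
  - by move=> n x; exact: q2M.
  move=> x; apply/cvgrPdist_le => e e0; have e2 : 0 < e / 2 by rewrite divr_gt0.
  have [d d0 hd] := OU_right_continuous h x e2.
  have [d' d'0 hd'] := OU_right_continuous 0 x e2.
  have dm : 0 < Num.min d d' by rewrite lt_min d0.
  have /cvgrPdist_lt /(_ _ dm) [N _ hN] := ct; exists N => // n Nn.
  have := hN n Nn; rewrite /= sub0r normrN gtr0_norm // lt_min => /andP[td td'].
  rewrite qE //.
  have B1 : `|(t n)^-1 * intJ `]h, h + t n]%classic (m ^~ x) - m h x| <= e / 2.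
    apply: cl => // s /andP[s1 s2]; apply: hd; rewrite (ltW s1) /=.
    by apply: le_lt_trans s2 _; rewrite ltrD2l.
  have B2 : `|(t n)^-1 * intJ `[0, t n[%classic (m ^~ x) - f x| <= e / 2.
    apply: cr => // s /andP[s1 s2]; rewrite -m0; apply: hd'; rewrite s1 /= add0r.
    exact: lt_trans s2 td'.
  exact: normBB_le B1 B2.
move=> e e0; have /cvgrPdist_lt /(_ e e0) := c.
move=> [d /= d0 hd]; exists d => // t /andP[t0 td].
have := hd t; rewrite /= !sub0r !normrN gtr0_norm // => /(_ td t0).
by rewrite ger0_norm // sqrtr_ge0.
Qed.

Lemma window_approx (e : R) : 0 < e -> exists2 h, 0 < h &
  nm (toW gam f - h^-1 *: toW gam (window (J1 h))) < e.
Proof.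
move=> e0; pose h n : R := n.+1%:R^-1.
have h0 n : 0 < h n by rewrite invr_gt0 ltr0n.
have mi (i : interval R) : measurable ([set` i] : set mR) by exact: measurable_itv.
have li n : mu (J1 (h n)) = (h n - 0)%:E by exact: mu_itv (ltW (h0 n)).
have mw n : measurable_fun setT (window (J1 (h n))).
  by apply: (@measurable_window _ (h n - 0)); [exact: mi|exact: li].
have hw n : L2r gam (window (J1 (h n))).
  apply: (@L2_bounded _ _ _ _ _ ((h n - 0) * M)) => // x.
  by apply: (@window_bound _ (h n - 0)); [exact: mi|exact: li].
have cr n x (c e' : R) : (forall s, 0 <= s <= h n -> `|m s x - c| <= e') ->
    `|(h n)^-1 * window (J1 (h n)) x - c| <= e'.
  move=> hc; have lt : mu (J1 (h n)) = (h n)%:E by rewrite li subr0.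
  apply: (intJ_avg (h0 n) _ lt (m_s x) (mM ^~ x)) => [|s]; first exact: mi.
  by rewrite /J1 /= in_itv /=; exact: hc.
have m0 x : m 0 x = f x by exact: OU0.
pose g n x := (h n)^-1 * window (J1 (h n)) x.
have c : (fun n => nm (toW gam (g n) - toW gam f)) @ \oo --> 0.
  apply: (nm_cvg0 (M := M)) => //.
  - by move=> n; apply: measurable_funM.
  - by move=> n x; have := cr n x 0 M; rewrite subr0; apply => s _; rewrite subr0.
  move=> x; apply/cvgrPdist_le => e' e'0.
  have [d d0 hd] := OU_right_continuous 0 x e'0.
  exists (Num.truncn d^-1) => // n /= dn; rewrite distrC; apply: cr => s /andP[s0 sh].
  rewrite -m0; apply: hd; rewrite s0 add0r /=; apply: le_lt_trans sh _.
  rewrite /h -(invrK d) ltf_pV2 ?posrE ?ltr0n ?invr_gt0 //.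
  by apply: lt_le_trans (truncnS_gt _) _; rewrite ler_nat ltnS.
have /cvgrPdist_lt /(_ e e0) [N _ /(_ N (leqnn N)) /=] := c.
rewrite sub0r normrN ger0_norm ?sqrtr_ge0 // => hN; exists (h N) => //.
rewrite (nmBC ipP).
have hg : L2r gam (g N).
  apply: (@L2_bounded _ _ _ _ _ M) => [|x]; first by apply: measurable_funM.
  by have := cr N x 0 M; rewrite subr0; apply => s _; rewrite subr0.
suff -> : (h N)^-1 *: toW gam (window (J1 (h N))) = toW gam (g N) by exact: hN.
apply/LfuneqP => x; have E1 : toW gam (g N) x = g N x by rewrite (toWE hg).
have E2 : toW gam (window (J1 (h N))) x = window (J1 (h N)) x by rewrite (toWE (hw N)).
by rewrite E1 /g -E2.
Qed.

End fixed_function.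

Lemma generator_dense : hdense ip (fun x => exists y, generator ip (T_ th) x y).
Proof.
move=> u e e0; have e2 : 0 < e / 2 by rewrite divr_gt0.
have [f bf hf] := bcont2_dense u e2; have [M fM] := bcont2_bounded bf.
have [h h0 hh] := window_approx bf fM e2.
exists (h^-1 *: toW gam (window f `[0, h]%classic)).
  eexists; apply: (generator_scale ipP (T_adjoint c0)).
  exact: window_generator bf fM _ h0.
apply: le_lt_trans (nm_tri ipP (toW gam f) _ _) _.
by rewrite [ltRHS](splitr e) ltrD.
Qed.

End generator_domain.

Local Open Scope complex_scope.

(** * From real graphs to normal operators on the complex L^2(gamma) *)

Section complexification.
Context {R : realType}.
Local Notation gam := (gam R).
Local Notation W := (LfunType gam (lee1n 2)).
Local Notation ip := (ipW (P := gam)).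
Local Notation nm := (hnorm ip).
Local Notation fn := (fn R).
Let ipP := ipW_semi_inner gam.
Implicit Types f g h k : fn.

Definition re_ f : mpt R -> R := fun y => complex.Re (f y).
Definition im_ f : mpt R -> R := fun y => complex.Im (f y).
Definition wRe f : W := toW gam (re_ f).
Definition wIm f : W := toW gam (im_ f).
Definition cplx (u v : W) : fn := fun y => (u y) +i* (v y).

Lemma toW_val (u : W) : toW gam u = u.
Proof. by apply/LfuneqP => x; rewrite toWE //; exact: W_L2. Qed.

Lemma wRe_cplx u v : wRe (cplx u v) = u. Proof. exact: toW_val. Qed.
Lemma wIm_cplx u v : wIm (cplx u v) = v. Proof. exact: toW_val. Qed.

Lemma integral_sqmod f : measurable_fun setT (re_ f) -> measurable_fun setT (im_ f) ->
  gint (fun y => sqmod (f y)) =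
  (\int[gam]_y ((re_ f y) ^+ 2)%:E + \int[gam]_y ((im_ f y) ^+ 2)%:E)%E.
Proof.
move=> m1 m2; have s1 := measurable_sqr m1; have s2 := measurable_sqr m2.
rewrite (gintE (f := fun y => sqmod (f y))); last first.
  by apply: measurable_funD; apply: measurable_funX.
rewrite -(ge0_integralD gam measurableT _ s1 _ s2).
- by apply: eq_integral => y _; rewrite /sqmod EFinD.
- by move=> y _; rewrite lee_fin sqr_ge0.
- by move=> y _; rewrite lee_fin sqr_ge0.
Qed.

Lemma L2E f : L2 f <-> L2r gam (re_ f) /\ L2r gam (im_ f).
Proof.
have p (u : mpt R -> R) : (0 <= \int[gam]_y ((u y) ^+ 2)%:E)%E.
  by apply: integral_ge0 => y _; rewrite lee_fin sqr_ge0.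
split=> [[m1 [m2 fy]]|[[m1 f1] [m2 f2]]].
  move: fy; rewrite (integral_sqmod m1 m2) => fy.
  by split; split=> //; apply: le_lt_trans fy; [rewrite leeDl|rewrite leeDr].
split; [exact: m1|split; first exact: m2].
by rewrite (integral_sqmod m1 m2) lte_add_pinfty.
Qed.

Lemma L2_cplx u v : L2 (cplx u v).
Proof. by apply/L2E; split; exact: W_L2. Qed.

Lemma wReE f : L2 f -> wRe f = re_ f :> (mpt R -> R).
Proof. by move=> /L2E[h _]; rewrite /wRe toWE. Qed.
Lemma wImE f : L2 f -> wIm f = im_ f :> (mpt R -> R).
Proof. by move=> /L2E[_ h]; rewrite /wIm toWE. Qed.

Lemma cplxK f : L2 f -> cplx (wRe f) (wIm f) = f.
Proof.
move=> hf; apply/funext => y; rewrite /cplx (wReE hf) (wImE hf) /re_ /im_.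
by case: (f y).
Qed.

Lemma norm2_cplx u v : norm2 (cplx u v) = Num.sqrt (nm u ^+ 2 + nm v ^+ 2).
Proof.
have [m1 _] := W_L2 u; have [m2 _] := W_L2 v.
rewrite /norm2 (integral_sqmod (f := cplx u v) m1 m2) fineD.
- by rewrite !nmW_sqr.
- exact: L2r_fin (W_L2 u).
- exact: L2r_fin (W_L2 v).
Qed.

Lemma nm_le_norm2 u v : nm u <= norm2 (cplx u v) /\ nm v <= norm2 (cplx u v).
Proof.
rewrite norm2_cplx; split; rewrite -[leLHS](ger0_norm (sqrtr_ge0 _)) -sqrtr_sqr ler_wsqrtr //.
  by rewrite lerDl sqr_ge0.
by rewrite lerDr sqr_ge0.
Qed.

Lemma norm2_le u v : norm2 (cplx u v) <= nm u + nm v.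
Proof.
have u0 := nm_ge0 ip u; have v0 := nm_ge0 ip v.
rewrite norm2_cplx -[leRHS](ger0_norm (addr_ge0 u0 v0)) -sqrtr_sqr ler_wsqrtr //.
by rewrite sqrrD; have := mulr_ge0 u0 v0; lra.
Qed.

Lemma fsub_cplx u v u' v' : fsub (cplx u v) (cplx u' v') = cplx (u - u') (v - v').
Proof. by []. Qed.

Lemma fscale_cplx (c : R) u v : fscale (c +i* 0) (cplx u v) = cplx (c *: u) (c *: v).
Proof.
apply/funext => y; rewrite /fscale /cplx.
by congr (_ +i* _); rewrite !mul0r ?subr0 ?addr0.
Qed.

Lemma inner_cplx u v u' v' : inner (cplx u v) (cplx u' v') =
  (ip u u' + ip v v') +i* (ip v u' - ip u v').
Proof.
have iM (x y : W) := L2_mul_integrable (W_L2 x) (W_L2 y).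
have mM (x y : W) : measurable_fun setT (fun z => x z * y z).
  by apply: measurable_funM; [case: (W_L2 x)|case: (W_L2 y)].
rewrite /inner /cint; congr (_ +i* _).
  rewrite (_ : (fun y => complex.Re _) = (fun y => u y * u' y + v y * v' y)); last first.
    by apply/funext => y; rewrite /cplx /=; ring.
  rewrite (gintE (f := fun y => u y * u' y + v y * v' y)); last exact: measurable_funD.
  exact: (RintegralD measurableT (iM u u') (iM v v')).
rewrite (_ : (fun y => complex.Im _) = (fun y => v y * u' y - u y * v' y)); last first.
  by apply/funext => y; rewrite /cplx /=; ring.
rewrite (gintE (f := fun y => v y * u' y - u y * v' y)); last exact: measurable_funB.
exact: (RintegralB measurableT (iM v u') (iM u v')).
Qed.

(** What normality needs from a real graph r and its candidate adjoint r'. The third clause puts r'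
    inside the adjoint of r and the fourth gives the reverse inclusion. The last one includes the
    domain of r in that of r'; the exchanged pair gives the other inclusion. *)
Definition adjoint_pair (r r' : W -> W -> Prop) :=
  [/\ forall x y z, r x y -> r x z -> ipeq ip y z,
      hdense ip (fun x => exists y, r x y),
      forall x y x' y', r x y -> r' x' y' -> ip y x' = ip x y',
      forall z w, (forall x y, r x y -> ip y z = ip x w) -> r' z w
    & r 0 0 /\ forall x y, r x y -> exists2 z, r' x z & nm z = nm y].

Section normality.
Variables (A : op R) (r r' : W -> W -> Prop).
Hypothesis AE : forall f g, A f g <->
  [/\ L2 f, L2 g, r (wRe f) (wRe g) & r (wIm f) (wIm g)].
Hypotheses (p : adjoint_pair r r') (p' : adjoint_pair r' r).

Lemma adjointE g h : adjoint A g h <->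
  [/\ L2 g, L2 h, r' (wRe g) (wRe h) & r' (wIm g) (wIm h)].
Proof.
have [_ _ pair adj [r0 _]] := p; split=> [[hg [hh k]]|[hg hh kr ki]].
  rewrite -(cplxK hg) -(cplxK hh) in k.
  have key x y : r x y -> ip y (wRe g) = ip x (wRe h) /\ ip y (wIm g) = ip x (wIm h).
    (* Tested on a real vector, admissible because r relates 0 to 0, the complex identity splits
       into one condition on real parts and one on imaginary parts. *)
    move=> xy; have : A (cplx x 0) (cplx y 0).
      by apply/AE; rewrite !wRe_cplx !wIm_cplx; split => //; exact: L2_cplx.
    move=> /k; rewrite !inner_cplx => -[].
    have z0 (w : W) : ip 0 w = 0 by rewrite -(scale0r 0) (ipZl ipP) mul0r.
    by rewrite !z0 !addr0 !sub0r => -> /oppr_inj ->.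
  by split => //; apply: adj => x y /key[].
split=> //; split=> // f l /AE[hf hl rr ri].
rewrite -(cplxK hg) -(cplxK hh) -(cplxK hf) -(cplxK hl) !inner_cplx.
by rewrite (pair _ _ _ _ rr kr) (pair _ _ _ _ ri ki) (pair _ _ _ _ ri kr) (pair _ _ _ _ rr ki).
Qed.

Lemma normal_of_adjoint_pair : normal_op A.
Proof.
have [un de pair adj [r0 no]] := p; have [un' _ pair' adj' [_ no']] := p'.
split; [|split; [|split; [|split]]].
- split=> [f g /AE[]//|f g1 g2 /AE[hf h1 rr ri] /AE[_ h2 rr' ri']].
  rewrite -(cplxK h1) -(cplxK h2) fsub_cplx norm2_cplx.
  have /(simP ipP) -> := un _ _ _ rr rr'; have /(simP ipP) -> := un _ _ _ ri ri'.
  by rewrite expr0n addr0 sqrtr0.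
- move=> f hf e e0; have e2 : 0 < e / 2 by rewrite divr_gt0.
  have [x [x' xx'] hx] := de (wRe f) _ e2; have [y [y' yy'] hy] := de (wIm f) _ e2.
  exists (cplx x y); split.
    exists (cplx x' y'); apply/AE; rewrite !wRe_cplx !wIm_cplx.
    by split => //; exact: L2_cplx.
  rewrite -(cplxK hf) fsub_cplx; apply: le_lt_trans (norm2_le _ _) _.
  by rewrite (splitr e) ltrD.
- move=> fs gs f g hA hf hg cf cg; apply/AE.
  have L n : L2 (fs n) /\ L2 (gs n) by have /AE[] := hA n.
  have key (w : fn -> W) : (forall n, r (w (fs n)) (w (gs n))) ->
      (forall n, nm (w (fs n) - w f) <= norm2 (fsub (fs n) f)) ->
      (forall n, nm (w (gs n) - w g) <= norm2 (fsub (gs n) g)) -> r (w f) (w g).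
    (* Since r contains the adjoint of r', closedness only requires a limit in the pairing with one
       fixed pair of r'. *)
    move=> rw bf bg; apply: adj' => x y xy.
    apply/eqP; rewrite -subr_eq0 -normr_le0; apply: le_eps => e e0; rewrite add0r.
    pose c := nm x + nm y + 1.
    have c0 : 0 < c by rewrite ltr_wpDl // addr_ge0 // nm_ge0.
    have ec := divr_gt0 e0 c0.
    have /cvgrPdist_lt /(_ _ ec) [N1 _ h1] := cf; have /cvgrPdist_lt /(_ _ ec) [N2 _ h2] := cg.
    have := h1 _ (leq_maxl N1 N2); have := h2 _ (leq_maxr N1 N2).
    set n := maxn N1 N2; rewrite /= !sub0r !normrN.
    move=> /(le_lt_trans (le_trans (bg n) (ler_norm _))) bg'.
    move=> /(le_lt_trans (le_trans (bf n) (ler_norm _))) bf'.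
    have E : ip y (w (fs n)) = ip x (w (gs n)).
      by rewrite (ipC ipP) -(pair _ _ _ _ (rw n) xy) (ipC ipP).
    have -> : ip y (w f) - ip x (w g) = ip x (w (gs n) - w g) - ip y (w (fs n) - w f).
      by rewrite !(ipBr ipP) E; ring.
    apply: le_trans (ler_normB _ _) _.
    apply: le_trans (lerD (cauchy_schwarz ipP _ _) (cauchy_schwarz ipP _ _)) _.
    have b1 : nm x * nm (w (gs n) - w g) <= nm x * (e / c) by rewrite ler_wpM2l ?nm_ge0 // ltW.
    have b2 : nm y * nm (w (fs n) - w f) <= nm y * (e / c) by rewrite ler_wpM2l ?nm_ge0 // ltW.
    apply: le_trans (lerD b1 b2) _; rewrite -mulrDl mulrCA ger_pMr // ler_pdivrMr // mul1r.
    by rewrite /c lerDl.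
  have bnd k l : L2 k -> L2 l -> nm (wRe k - wRe l) <= norm2 (fsub k l) /\
      nm (wIm k - wIm l) <= norm2 (fsub k l).
    move=> hk hl; rewrite -{2 4}(cplxK hk) -{2 4}(cplxK hl) fsub_cplx.
    exact: nm_le_norm2.
  split => //.
    apply: (key wRe) => n; first by have /AE[] := hA n.
      by have [h1 _] := L n; case: (bnd _ _ h1 hf).
    by have [_ h2] := L n; case: (bnd _ _ h2 hg).
  apply: (key wIm) => n; first by have /AE[] := hA n.
    by have [h1 _] := L n; case: (bnd _ _ h1 hf).
  by have [_ h2] := L n; case: (bnd _ _ h2 hg).
- move=> f; split=> [[g /AE[hf hg rr ri]]|[g /adjointE[hf hg rr ri]]].
    have [z z1 _] := no _ _ rr; have [z' z1' _] := no _ _ ri.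
    exists (cplx z z'); apply/adjointE; rewrite wRe_cplx wIm_cplx.
    by split => //; exact: L2_cplx.
  have [z z1 _] := no' _ _ rr; have [z' z1' _] := no' _ _ ri.
  exists (cplx z z'); apply/AE; rewrite wRe_cplx wIm_cplx.
  by split => //; exact: L2_cplx.
- move=> f g h /AE[hf hg rr ri] /adjointE[_ hh rr' ri'].
  rewrite -(cplxK hg) -(cplxK hh) !norm2_cplx.
  (* These vectors have the norms of the parts of g; single-valuedness of r' identifies them with
     the parts of h modulo null vectors. *)
  have [z z1 <-] := no _ _ rr; have [z' z1' <-] := no _ _ ri.
  by rewrite (sim_nm ipP (un' _ _ _ z1 rr')) (sim_nm ipP (un' _ _ _ z1' ri')).
Qed.

End normality.

End complexification.

(** * Identification of the complex semigroup and generator with the real ones *)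

Section operators.
Context {R : realType}.
Local Notation gam := (gam R).
Local Notation W := (LfunType gam (lee1n 2)).
Local Notation ip := (ipW (P := gam)).
Local Notation nm := (hnorm ip).
Local Notation fn := (fn R).
Let ipP := ipW_semi_inner gam.
Implicit Types f g h k : fn.

Lemma ofC_mix (th t : R) (x y : pt R) :
  ofC (cexp (- ((cos th +i* sin th) * (t +i* 0))) * toC x
    + (Num.sqrt (1 - expR (- (2 * t * cos th))) +i* 0) * toC y) =
  mix (at_ th t) (st_ th t) x y.
Proof.
rewrite /ofC /cexp /toC /mix /at_ -/(st_ th t) /=.
rewrite !mulr0 subr0 add0r cosN sinN [cos th * t]mulrC [sin th * t]mulrC.
by congr pair; ring.
Qed.

(** P_t integrates against a real measure, so it acts on real and imaginary parts separately. *)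
Lemma re_Pt th t f : measurable_fun setT (re_ f) -> re_ (Pt th t f) = OU th t (re_ f).
Proof.
move=> mf; apply/funext => x; rewrite /OU /mehler /Rintegral /re_ /=.
have mm : measurable_fun setT (fun y => re_ f (mix (at_ th t) (st_ th t) x y)).
  exact: (measurableT_comp mf (measurable_mix2 _ _ _)).
rewrite -(gintE mm); congr (fine (gint _)).
by apply/funext => y; rewrite /re_ ofC_mix.
Qed.

Lemma im_Pt th t f : measurable_fun setT (im_ f) -> im_ (Pt th t f) = OU th t (im_ f).
Proof.
move=> mf; apply/funext => x; rewrite /OU /mehler /Rintegral /im_ /=.
have mm : measurable_fun setT (fun y => im_ f (mix (at_ th t) (st_ th t) x y)).
  exact: (measurableT_comp mf (measurable_mix2 _ _ _)).
rewrite -(gintE mm); congr (fine (gint _)).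
by apply/funext => y; rewrite /im_ ofC_mix.
Qed.

Lemma Cb_bcont2 f : Cb f -> bcont2 (re_ f) /\ bcont2 (im_ f).
Proof.
move=> [cr [ci [M fM]]].
(* From 2 |r| <= r^2 + 1. *)
have b (r : R) : r ^+ 2 <= M -> `|r| <= M + 1.
  move=> rM; rewrite -(real_normK (num_real r)) in rM.
  by have := sqr_ge0 (`|r| - 1); have := normr_ge0 r; rewrite sqrrB1; lra.
split; split=> //; exists (M + 1) => x; apply: b; apply: le_trans (fM x); rewrite /sqmod.
  by rewrite lerDl sqr_ge0.
by rewrite lerDr sqr_ge0.
Qed.

Lemma Cb_L2 f : Cb f -> L2 f.
Proof. by move=> /Cb_bcont2[b1 b2]; apply/L2E; split; exact: bcont2_L2. Qed.

Lemma bcont2_Cb (a b : mpt R -> R) : bcont2 a -> bcont2 b -> Cb (cplx (toW gam a) (toW gam b)).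
Proof.
move=> [ca [M aM]] [cb [M' bM]].
have hE : cplx (toW gam a) (toW gam b) = (fun y => a y +i* b y).
  apply/funext => y; rewrite /cplx !toWE //; apply: bcont2_L2;
    by [split; last exists M|split; last exists M'].
rewrite hE; split=> //; split=> //; exists (M ^+ 2 + M' ^+ 2) => y; rewrite /sqmod /=.
rewrite -(real_normK (num_real (a y))) -(real_normK (num_real (b y))).
have M0 := le_trans (normr_ge0 _) (aM y); have M'0 := le_trans (normr_ge0 _) (bM y).
by apply: lerD; rewrite lerXn2r ?nnegrE.
Qed.

Lemma nm_le_fsub f g : L2 f -> L2 g ->
  nm (wRe f - wRe g) <= norm2 (fsub f g) /\ nm (wIm f - wIm g) <= norm2 (fsub f g).
Proof.
by move=> hf hg; rewrite -{2 4}(cplxK hf) -{2 4}(cplxK hg) fsub_cplx; exact: nm_le_norm2.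
Qed.

Lemma norm2_fsub_le f g : L2 f -> L2 g ->
  norm2 (fsub f g) <= nm (wRe f - wRe g) + nm (wIm f - wIm g).
Proof.
by move=> hf hg; rewrite -{1}(cplxK hf) -{1}(cplxK hg) fsub_cplx; exact: norm2_le.
Qed.

Lemma Cb_dense f (e : R) : L2 f -> 0 < e -> exists2 phi, Cb phi & norm2 (fsub phi f) < e.
Proof.
move=> hf e0; have e2 : 0 < e / 2 by rewrite divr_gt0.
have [a ba ha] := bcont2_dense (wRe f) e2; have [b bb hb] := bcont2_dense (wIm f) e2.
have Cphi := bcont2_Cb ba bb; exists (cplx (toW gam a) (toW gam b)) => //.
apply: le_lt_trans (norm2_fsub_le (Cb_L2 Cphi) hf) _; rewrite wRe_cplx wIm_cplx.
rewrite [ltRHS](splitr e).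
by apply: ltrD; rewrite (nmBC ipP); [exact: ha|exact: hb].
Qed.

Lemma cvg0_inv (a : nat -> R) (c : R) : 0 < c -> (forall n, 0 <= a n <= c * n.+1%:R^-1) ->
  a @ \oo --> 0.
Proof.
move=> c0 ha; apply/cvgrPdist_lt => e e0.
exists (Num.truncn (c / e)) => // n /= ne; rewrite sub0r normrN.
have /andP[a0 ac] := ha n; rewrite ger0_norm //; apply: le_lt_trans ac _.
rewrite ltr_pdivrMr ?ltr0n // mulrC -ltr_pdivrMr //.
by apply: lt_le_trans (truncnS_gt _) _; rewrite ler_nat ltnS.
Qed.

Lemma quotient_cplx (c : R) k f g : L2 k -> L2 f -> L2 g ->
  fsub (fscale (c +i* 0) (fsub k f)) g =
  cplx (c *: (wRe k - wRe f) - wRe g) (c *: (wIm k - wIm f) - wIm g).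
Proof.
move=> hk hf hg; rewrite -fsub_cplx -fscale_cplx -fsub_cplx.
by rewrite (cplxK hk) (cplxK hf) (cplxK hg).
Qed.

Section semigroup.
Variable th : R.
Hypothesis c0 : 0 <= cos th.

Lemma L2_Pt t f : 0 <= t -> L2 f -> L2 (Pt th t f).
Proof.
move=> t0 /[dup] hf /L2E[h1 h2]; apply/L2E; split.
  by rewrite re_Pt; [exact: OU_L2|case: h1].
by rewrite im_Pt; [exact: OU_L2|case: h2].
Qed.

Lemma wRe_Pt t f : L2 f -> wRe (Pt th t f) = T_ th t (wRe f).
Proof. by move=> hf; rewrite /T_ (wReE hf) /wRe re_Pt //; case: hf. Qed.

Lemma wIm_Pt t f : L2 f -> wIm (Pt th t f) = T_ th t (wIm f).
Proof. by move=> hf; rewrite /T_ (wImE hf) /wIm im_Pt //; case: hf => _ []. Qed.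

(** From left to right, the nonexpansive T_t passes to the limit along the given sequence.
    Conversely any sequence of C_b converging to f will do; it is taken with error 1 / (n + 1),
    which the two components turn into 2 / (n + 1). *)
Lemma TtE t f g : 0 <= t -> Tt th t f g <->
  [/\ L2 f, L2 g, ipeq ip (T_ th t (wRe f)) (wRe g) & ipeq ip (T_ th t (wIm f)) (wIm g)].
Proof.
move=> t0; split=> [[hf [hg [phi [Cphi [cf cg]]]]]|[hf hg sr si]].
  have key (w : fn -> W) : (forall n, w (Pt th t (phi n)) = T_ th t (w (phi n))) ->
      (forall n, nm (w (phi n) - w f) <= norm2 (fsub (phi n) f)) ->
      (forall n, nm (w (Pt th t (phi n)) - w g) <= norm2 (fsub (Pt th t (phi n)) g)) ->
      ipeq ip (T_ th t (w f)) (w g).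
    move=> wP b1 b2; apply/(simP ipP)/eqP; rewrite eq_le (nm_ge0 ip) andbT.
    apply: le_eps => e e0; rewrite add0r; have e2 : 0 < e / 2 by rewrite divr_gt0.
    have /cvgrPdist_lt /(_ _ e2) [N1 _ h1] := cf; have /cvgrPdist_lt /(_ _ e2) [N2 _ h2] := cg.
    have := h1 _ (leq_maxl N1 N2); have := h2 _ (leq_maxr N1 N2).
    set n := maxn N1 N2; rewrite /= !sub0r !normrN.
    move=> /(le_lt_trans (le_trans (b2 n) (ler_norm _))); rewrite wP => b2'.
    move=> /(le_lt_trans (le_trans (b1 n) (ler_norm _))) b1'.
    apply: le_trans (nm_tri ipP (T_ th t (w (phi n))) _ _) _.
    rewrite [leRHS](splitr e); apply: lerD; last exact: ltW b2'.
    rewrite (nmBC ipP); apply: le_trans (T_nonexpansive c0 _ _ t0) _.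
    exact: ltW b1'.
  have Lp n := Cb_L2 (Cphi n).
  split; [exact: hf|exact: hg| |].
    apply: (key wRe) => n; [exact: wRe_Pt|by case: (nm_le_fsub (Lp n) hf)|].
    by case: (nm_le_fsub (L2_Pt t0 (Lp n)) hg).
  apply: (key wIm) => n; [exact: wIm_Pt|by case: (nm_le_fsub (Lp n) hf)|].
  by case: (nm_le_fsub (L2_Pt t0 (Lp n)) hg).
split=> //; split=> //.
have /choice[phi hphi] : forall n : nat, exists phi, Cb phi /\ norm2 (fsub phi f) < n.+1%:R^-1.
  move=> n; have n0 : 0 < n.+1%:R^-1 :> R by rewrite invr_gt0 ltr0n.
  by have [phi C h] := Cb_dense hf n0; exists phi.
exists phi; split; first by move=> n; case: (hphi n).
have Lp n : L2 (phi n) by apply: Cb_L2; case: (hphi n).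
split.
  apply: (cvg0_inv ltr01) => n; rewrite mul1r sqrtr_ge0 /=.
  by apply: ltW; case: (hphi n).
apply: (cvg0_inv (ltr0n R 2)) => n; rewrite sqrtr_ge0 /=.
apply: le_trans (norm2_fsub_le (L2_Pt t0 (Lp n)) hg) _.
rewrite (wRe_Pt _ (Lp n)) (wIm_Pt _ (Lp n)).
have -> : 2 * n.+1%:R^-1 = n.+1%:R^-1 + n.+1%:R^-1 :> R by rewrite mulr_natl mulr2n.
have [b1 b2] := nm_le_fsub (Lp n) hf; have [_ /ltW hn] := hphi n.
have E (u v z : W) : ipeq ip (T_ th t u) z -> nm (T_ th t v - z) <= nm (v - u).
  move=> s; have -> : nm (T_ th t v - z) = nm (T_ th t v - T_ th t u).
    apply: (sim_nm ipP); apply: (simB ipP); [exact: sim_refl|exact: sim_sym].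
  exact: T_nonexpansive.
by apply: lerD; [apply: le_trans (E _ _ _ sr) (le_trans b1 hn)|
  apply: le_trans (E _ _ _ si) (le_trans b2 hn)].
Qed.

(** [gen] allows any representative [u t] of T_t f; by [TtE] it can be exchanged for the real
    operators applied to both parts without changing the norms. *)
Lemma genE f g : gen th f g <->
  [/\ L2 f, L2 g, generator ip (T_ th) (wRe f) (wRe g) & generator ip (T_ th) (wIm f) (wIm g)].
Proof.
split=> [[hf [hg [u [hu cu]]]]|[hf hg gr gi]].
  have ub t : 0 < t ->
      nm (t^-1 *: (T_ th t (wRe f) - wRe f) - wRe g) <=
        norm2 (fsub (fscale (t^-1 +i* 0) (fsub (u t) f)) g) /\
      nm (t^-1 *: (T_ th t (wIm f) - wIm f) - wIm g) <=
        norm2 (fsub (fscale (t^-1 +i* 0) (fsub (u t) f)) g).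
    move=> t0; have /(TtE _ _ (ltW t0))[_ hut sr si] := hu t t0.
    rewrite (quotient_cplx _ hut hf hg).
    have [b1 b2] := nm_le_norm2 (t^-1 *: (wRe (u t) - wRe f) - wRe g)
      (t^-1 *: (wIm (u t) - wIm f) - wIm g).
    split; [apply: le_trans b1|apply: le_trans b2]; rewrite le_eqVlt;
      apply/orP; left; apply/eqP; apply: (sim_nm ipP); apply: (simB ipP);
      [|exact: sim_refl| |exact: sim_refl]; apply: (simZ ipP); apply: (simB ipP);
      by [exact: sr|exact: si|exact: sim_refl].
  have key e : 0 < e -> exists2 d, 0 < d & forall t, 0 < t < d ->
      norm2 (fsub (fscale (t^-1 +i* 0) (fsub (u t) f)) g) < e.
    move=> e0; have /cvgrPdist_lt /(_ e e0) := cu.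
    move=> [d /= d0 hd]; exists d => // t /andP[t0 td].
    have := hd t; rewrite /= !sub0r !normrN gtr0_norm // => /(_ td t0).
    by rewrite ger0_norm // sqrtr_ge0.
  split; [exact: hf|exact: hg| |]; move=> e /key[d d0 hd]; (exists d; first exact: d0); move=> t td.
    have t0 : 0 < t by case/andP: td.
    by have [b _] := ub t t0; apply: le_lt_trans b (hd t td).
  have t0 : 0 < t by case/andP: td.
  by have [_ b] := ub t t0; apply: le_lt_trans b (hd t td).
split=> //; split=> //.
exists (fun t => cplx (T_ th t (wRe f)) (T_ th t (wIm f))); split.
  move=> t t0; apply/(TtE _ _ (ltW t0)); rewrite wRe_cplx wIm_cplx.
  by split => //; exact: L2_cplx.
apply/cvgrPdist_lt => e e0; have e2 : 0 < e / 2 by rewrite divr_gt0.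
have [d d0 hd] := gr _ e2; have [d' d'0 hd'] := gi _ e2.
have dm : 0 < Num.min d d' by rewrite lt_min d0.
exists (Num.min d d'); first exact: dm.
move=> t /= tm t0; move: tm; rewrite sub0r normrN (gtr0_norm t0) lt_min => /andP[td td'].
rewrite sub0r normrN ger0_norm ?sqrtr_ge0 //.
rewrite (quotient_cplx _ (L2_cplx _ _) hf hg) wRe_cplx wIm_cplx.
apply: le_lt_trans (norm2_le _ _) _; rewrite [ltRHS](splitr e); apply: ltrD.
  by apply: hd; rewrite t0.
by apply: hd'; rewrite t0.
Qed.

End semigroup.

(** T_t is defined everywhere, so density is immediate. The graphs are taken modulo [ipeq] because
    pairings determine an adjoint vector only up to null vectors. *)
Lemma Tt_adjoint_pair (th t : R) : 0 <= cos th -> 0 <= t ->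
  adjoint_pair (fun x y => ipeq ip (T_ th t x) y) (fun x y => ipeq ip (T_ (- th) t x) y).
Proof.
move=> c0 t0; have adj := T_adjoint c0; split.
- by move=> x y z h k; exact: sim_trans (sim_sym h) k.
- move=> x e e0; exists x; last by rewrite subrr (nm0 ipP).
  by exists (T_ th t x).
- move=> x y x' y' h h'; rewrite -h (adj _ _ _ t0) !(ipC ipP x) h'.
  exact: erefl.
- move=> z w hzw x; rewrite (adjointC ipP adj _ _ t0) (ipC ipP) (hzw x (T_ th t x) (fun=> erefl)).
  exact: (ipC ipP).
split.
  have := sim_opZ ipP adj 0 0 t0; by rewrite !scale0r.
move=> x y h; exists (T_ (- th) t x); first exact: sim_refl.
exact: etrans (esym (normal_nm ipP adj (T_commute c0) x t0)) (sim_nm ipP h).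
Qed.

Lemma gen_adjoint_pair (th : R) : 0 <= cos th ->
  adjoint_pair (generator ip (T_ th)) (generator ip (T_ (- th))).
Proof.
move=> c0; have c0' : 0 <= cos (- th) by rewrite cosN.
have adj := T_adjoint c0; split.
- by move=> x y z; exact: (generator_unique ipP).
- exact: generator_dense.
- by move=> x y x' y'; exact: (generator_adjoint ipP adj).
- move=> z w; apply: (adjoint_generator ipP adj (T_contraction c0) (T_semigroup c0)
    (T_continuous c0') (generator_dense c0) (T_0 c0)).
split.
  move=> e e0; exists 1; first exact: ltr01.
  move=> t /andP[t0 _].
  have h : ipeq ip (T_ th t 0) 0 by have := sim_opZ ipP adj 0 0 (ltW t0); rewrite !scale0r.
  rewrite subr0 subr0 (nmZ ipP) (sim_nm ipP h) (nm0 ipP) mulr0.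
  exact: e0.
move=> x y; apply: (normal_generator ipP adj (T_commute c0)); exact: L2_complete.
Qed.

End operators.

Theorem theorem3p4 (R : realType) (th : R) :
  - (pi / 2) < th < pi / 2 ->
  (forall t : R, 0 <= t -> normal_op (Tt th t)) /\ normal_op (gen th).
Proof.
move=> hth; have c0 : 0 <= cos th by apply: ltW; exact: cos_gt0_pihalf.
have c0' : 0 <= cos (- th) by rewrite cosN.
split=> [t t0|].
  apply: (normal_of_adjoint_pair (fun f g => TtE c0 f g t0) (Tt_adjoint_pair c0 t0)).
  (* The exchanged pair is the same statement for the angle - th, whose opposite is th again. *)
  by have := Tt_adjoint_pair c0' t0; rewrite opprK.
apply: (normal_of_adjoint_pair (genE c0) (gen_adjoint_pair c0)).
by have := gen_adjoint_pair c0'; rewrite opprK.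
Qed.
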